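(* Let $\eta\ge 3$ be an integer. Suppose $(x^*,u^* )$ is a local minimizer of the continuous problem (P) described in the context, suppose the standing smoothness assumptions hold, and suppose (A1)–(A3) hold, and that (P1)–(P4) hold for every $N$. Then there are constants $c$ and $N_0$, independent of $N$, such that for every $N\ge N_0$ with $N>\eta+1$ the nonlinear program (NLP) has a strict local minimizer $(X^N,U^N)=(X^N_0,\dots,X^N_N,U^N_1,\dots,U^N_N)$ together with a vector $\Lambda^N=(\Lambda^N_0,\dots,\Lambda^N_N)\in(\mathbb{R}^n)^{N+1}$ satisfying $\mathcal{T}(X^N,U^N,\Lambda^N)=0$, and $$\max\Big\{\max_{0\le i\le N}|X^N_i-x^*(\tau_i)|,\ \max_{1\le i\le N}|U^N_i-u^*(\tau_i)|,\ \max_{0\le i\le N}|\Lambda^N_i-\lambda^*(\tau_i)|\Big\}\le cN^{2-\eta}.$$ (Equivalently, the polynomial $x^N\in\mathcal{P}_N^n$ with $x^N(\tau_i)=X^N_i$, together with the controls $u_i=U^N_i$, is a local minimizer of the collocated problem: minimize $C(x(1))$ subject to $\dot x(\tau_i)=f(x(\tau_i),u_i)$, $1\le i\le N$, $x(-1)=x_0$, $x\in\mathcal{P}_N^n$.)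
   Context: Notation: $|\cdot|$ is the Euclidean norm; for a matrix, $\|\cdot\|_\infty$ is the largest absolute row sum; $\mathcal{P}_N$ is the space of real polynomials of degree at most $N$ on $[-1,1]$ and $\mathcal{P}_N^n$ its $n$-fold product. Radau collocation data: for an integer $N\ge 2$, let $-1<\tau_1<\dots<\tau_N=1$ and $\omega_1,\dots,\omega_N>0$ be the nodes and weights of the $N$-point Gauss–Radau quadrature rule on $[-1,1]$ with fixed node $+1$ (exact for polynomials of degree $\le 2N-2$; $\sum_i\omega_i=2$). Set $\tau_0=-1$. For $0\le j\le N$ let $L_j(\tau)=\prod_{i=0,i\ne j}^{N}\frac{\tau-\tau_i}{\tau_j-\tau_i}$ and let $D$ be the $N\times(N+1)$ matrix $D_{ij}=L_j'(\tau_i)$, $1\le i\le N$, $0\le j\le N$. Let $D_0$ denote its column indexed $0$ and $D_{1:N}$ the $N\times N$ submatrix formed by columns $1,\dots,N$. Let $D^\ddagger$ be the $N\times N$ matrix $D^\ddagger_{ij}=-(\omega_j/\omega_i)D_{ji}$, $1\le i,j\le N$, and $W=\mathrm{diag}(\omega_1,\dots,\omega_N)$. Properties: (P1) $D_{1:N}$ is invertible and $\|D_{1:N}^{-1}\|_\infty\le 2$. (P2) every row of $(W^{1/2}D_{1:N})^{-1}$ has Euclidean norm at most $\sqrt2$. (P3) $D^\ddagger$ is invertible and $\|(D^\ddagger)^{-1}\|_\infty\le 2$. (P4) every row of $(W^{1/2}D^\ddagger)^{-1}$ has Euclidean norm at most $\sqrt2$. Continuous problem (P): minimize $C(x(1))$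 subject to $\dot x(t)=f(x(t),u(t))$, $t\in[-1,1]$, $x(-1)=x_0$, where $f:\mathbb{R}^n\times\mathbb{R}^m\to\mathbb{R}^n$, $C:\mathbb{R}^n\to\mathbb{R}$, $x_0\in\mathbb{R}^n$ given. Standing assumptions: $(x^*,u^* )\in C^1([-1,1];\mathbb{R}^n)\times C^0([-1,1];\mathbb{R}^m)$ is a local minimizer; there are an open set $\Omega\subset\mathbb{R}^{n+m}$ and $\rho>0$ with the closed ball of radius $\rho$ about $(x^*(t),u^*(t))$ contained in $\Omega$ for all $t\in[-1,1]$; the first two derivatives of $f$ are continuous on the closure of $\Omega$ and those of $C$ on the closed ball of radius $\rho$ about $x^*(1)$. The Hamiltonian is $H(x,u,\lambda)=\lambda^{\mathsf T}f(x,u)$, and $\lambda^*$ solves $\dot\lambda^*(t)=-\nabla_xH(x^*(t),u^*(t),\lambda^*(t))$, $\lambda^*(1)=\nabla C(x^*(1))$; moreover $\nabla_uH(x^*(t),u^*(t),\lambda^*(t))=0$ for all $t\in[-1,1]$. Assumptions: (A1) $x^*,\lambda^*\in C^{\eta+1}$. (A2) for some $\alpha>0$ the smallest eigenvalues of $\nabla^2C(x^*(1))$ and of $\nabla^2_{(x,u)}H(x^*(t),u^*(t),\lambda^*(t))$ exceed $\alpha$ uniformly in $t\in[-1,1]$. (A3) $\|\nabla_xf(x^*(t),u^*(t))\|_\infty\le 1/4$ and $\|\nabla_xf(x^*(t),u^*(t))^{\mathsf T}\|_\infty\le1/4$ for all $t\in[-1,1]$, where $\nabla_x f$ is the $n\times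 n$ Jacobian. (NLP): minimize $C(X_N)$ over $X_0,\dots,X_N\in\mathbb{R}^n$, $U_1,\dots,U_N\in\mathbb{R}^m$ subject to $\sum_{j=0}^ND_{ij}X_j=f(X_i,U_i)$, $1\le i\le N$, and $X_0=x_0$. The map $\mathcal{T}(X,U,\Lambda)$, with $\Lambda=(\Lambda_0,\dots,\Lambda_N)\in(\mathbb{R}^n)^{N+1}$, has components $\mathcal{T}_{1i}=\sum_{j=0}^ND_{ij}X_j-f(X_i,U_i)$ ($1\le i\le N$); $\mathcal{T}_2=X_0-x_0$; $\mathcal{T}_3=\Lambda_0-\nabla C(X_N)-\sum_{i=1}^N\omega_i\nabla_xH(X_i,U_i,\Lambda_i)$; $\mathcal{T}_{4i}=\sum_{j=1}^ND^\ddagger_{ij}\Lambda_j+\nabla_xH(X_i,U_i,\Lambda_i)$ ($1\le i<N$); $\mathcal{T}_5=\sum_{j=1}^ND^\ddagger_{Nj}\Lambda_j+\nabla_xH(X_N,U_N,\Lambda_N)+\nabla C(X_N)/\omega_N$; $\mathcal{T}_{6i}=\nabla_uH(X_i,U_i,\Lambda_i)$ ($1\le i\le N$). (The system $\mathcal{T}=0$ is the first-order optimality system of (NLP), with $\Lambda_i$, $i\ge1$, equal to the multiplier of the $i$-th dynamics constraint divided by $\omega_i$ and $\Lambda_0$ the multiplier of $X_0=x_0$.) *)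

(* Defs.v *)
From Stdlib Require Import Reals.
From mathcomp Require Import ssreflect ssrfun ssrbool eqtype ssrnat seq fintype bigop.
Set Implicit Arguments. Unset Strict Implicit. Unset Printing Implicit Defensive.
Open Scope R_scope.

Definition vec (p : nat) := 'I_p -> R.
Definition vsub (p : nat) (v w : vec p) : vec p := fun i => v i - w i.
Definition vnorm (p : nat) (v : vec p) : R := sqrt (\big[Rplus/0]_(i < p) (v i * v i)).
Definition dotv (p : nat) (v w : vec p) : R := \big[Rplus/0]_(i < p) (v i * w i).

Definition zjoin (n m : nat) (x : vec n) (u : vec m) : vec (n + m) :=
  fun k => match fintype.split k with inl i => x i | inr j => u j end.

Definition infnorm (p : nat) (A : 'I_p -> 'I_p -> R) : R :=
  \big[Rmax/0]_(i < p) \big[Rplus/0]_(j < p) Rabs (A i j).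

(* "the smallest eigenvalue of A exceeds alpha": every (real) eigenvalue of A
   exceeds alpha (A is a real symmetric matrix here, so all eigenvalues are real) *)
Definition is_eigenvalue (p : nat) (A : 'I_p -> 'I_p -> R) (lam : R) : Prop :=
  exists v : vec p, (exists i, v i <> 0) /\
    forall i, \big[Rplus/0]_(j < p) (A i j * v j) = lam * v i.
Definition min_eig_gt (p : nat) (A : 'I_p -> 'I_p -> R) (alpha : R) : Prop :=
  forall lam, is_eigenvalue A lam -> alpha < lam.

Definition is_open (p : nat) (S : vec p -> Prop) : Prop :=
  forall z, S z -> exists r, 0 < r /\ forall w, vnorm (vsub w z) < r -> S w.
Definition closure (p : nat) (S : vec p -> Prop) : vec p -> Prop :=
  fun z => forall eps, 0 < eps -> exists w, S w /\ vnorm (vsub w z) < eps.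
Definition cont_on (p : nat) (g : vec p -> R) (S : vec p -> Prop) : Prop :=
  forall z, S z -> forall eps, 0 < eps -> exists delta, 0 < delta /\
    forall w, S w -> vnorm (vsub w z) < delta -> Rabs (g w - g z) < eps.
Definition has_grad_on (p : nat) (g : vec p -> R) (G : vec p -> vec p) (S : vec p -> Prop) : Prop :=
  forall z, S z -> forall eps, 0 < eps -> exists delta, 0 < delta /\
    forall h : vec p, vnorm h < delta ->
      Rabs (g (fun i => z i + h i) - g z - dotv (G z) h) <= eps * vnorm h.

Definition C2_with (p : nat) (g : vec p -> R) (G : vec p -> vec p)
    (Hs : vec p -> 'I_p -> 'I_p -> R) (S : vec p -> Prop) : Prop :=
  has_grad_on g G S /\
  (forall k, has_grad_on (fun z => G z k) (fun z => Hs z k) S) /\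
  (forall k, cont_on (fun z => G z k) (closure S)) /\
  (forall k l, cont_on (fun z => Hs z k l) (closure S)).

Definition open_ball (p : nat) (c : vec p) (r : R) : vec p -> Prop :=
  fun z => vnorm (vsub z c) < r.

Definition deriv_within (a b : R) (g : R -> R) (t l : R) : Prop :=
  forall eps, 0 < eps -> exists delta, 0 < delta /\
    forall h, h <> 0 -> Rabs h < delta -> a <= t + h <= b ->
      Rabs ((g (t + h) - g t) / h - l) < eps.
Definition cont_within (a b : R) (g : R -> R) (t : R) : Prop :=
  forall eps, 0 < eps -> exists delta, 0 < delta /\
    forall s, a <= s <= b -> Rabs (s - t) < delta -> Rabs (g s - g t) < eps.
Definition Ck_on (k : nat) (g : R -> R) : Prop :=
  exists d : nat -> R -> R,
    (forall t, -1 <= t <= 1 -> d 0%N t = g t) /\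
    (forall j t, (j < k)%N -> -1 <= t <= 1 -> deriv_within (-1) 1 (d j) t (d j.+1 t)) /\
    (forall j t, (j <= k)%N -> -1 <= t <= 1 -> cont_within (-1) 1 (d j) t).

Definition feasible_P (n m : nat) (f : vec n -> vec m -> vec n) (x0 : vec n)
    (x : R -> vec n) (u : R -> vec m) : Prop :=
  (forall k, Ck_on 1 (fun t => x t k)) /\ (forall j, Ck_on 0 (fun t => u t j)) /\
  (forall k t, -1 <= t <= 1 -> deriv_within (-1) 1 (fun s => x s k) t (f (x t) (u t) k)) /\
  x (-1) = x0.

Definition loc_min_P (n m : nat) (f : vec n -> vec m -> vec n) (C : vec n -> R) (x0 : vec n)
    (xs : R -> vec n) (us : R -> vec m) : Prop :=
  feasible_P f x0 xs us /\
  exists r, 0 < r /\ forall x u, feasible_P f x0 x u ->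
    (forall t, -1 <= t <= 1 -> vnorm (vsub (x t) (xs t)) < r /\ vnorm (vsub (u t) (us t)) < r) ->
    C (xs 1) <= C (x 1).

(* derivatives of f / Hamiltonian H(x,u,lam) = lam^T f(x,u), built from the
   Jacobian Df z k l = d f_k / d z_l and second derivatives D2f z k l l' *)
Section Ham.
Variables (n m : nat).
Variable Df : vec (n + m) -> 'I_n -> 'I_(n + m) -> R.
Variable D2f : vec (n + m) -> 'I_n -> 'I_(n + m) -> 'I_(n + m) -> R.
Definition jac_x (x : vec n) (u : vec m) : 'I_n -> 'I_n -> R :=
  fun k l => Df (zjoin x u) k (lshift m l).
Definition gradxH (x : vec n) (u : vec m) (lam : vec n) : vec n :=
  fun l => \big[Rplus/0]_(k < n) (lam k * Df (zjoin x u) k (lshift m l)).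
Definition graduH (x : vec n) (u : vec m) (lam : vec n) : vec m :=
  fun l => \big[Rplus/0]_(k < n) (lam k * Df (zjoin x u) k (rshift n l)).
Definition hessH (x : vec n) (u : vec m) (lam : vec n) : 'I_(n + m) -> 'I_(n + m) -> R :=
  fun a b => \big[Rplus/0]_(k < n) (lam k * D2f (zjoin x u) k a b).
End Ham.

Definition sumR (a b : nat) (g : nat -> R) : R := \big[Rplus/0]_(a <= i < b.+1) g i.

(* tau, omega: tau 0 = -1 and tau_1..tau_N, omega_1..omega_N are the nodes and
   weights of the N-point Gauss-Radau rule with fixed node +1 *)
Definition Radau (N : nat) (tau omega : nat -> R) : Prop :=
  tau 0%N = -1 /\ -1 < tau 1%N /\
  (forall i, (1 <= i < N)%N -> tau i < tau i.+1) /\ tau N = 1 /\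
  (forall i, (1 <= i <= N)%N -> 0 < omega i) /\
  forall a : nat -> R,
    exists pr : Riemann_integrable (fun t => sumR 0 (2 * N - 2) (fun k => a k * t ^ k)) (-1) 1,
      RiemannInt pr = sumR 1 N (fun i => omega i * sumR 0 (2 * N - 2) (fun k => a k * tau i ^ k)).

Definition Lag (N : nat) (tau : nat -> R) (j : nat) (t : R) : R :=
  \big[Rmult/1]_(0 <= i < N.+1 | i != j) ((t - tau i) / (tau j - tau i)).

Definition Dmat_spec (N : nat) (tau : nat -> R) (D : nat -> nat -> R) : Prop :=
  forall i j, (1 <= i <= N)%N -> (j <= N)%N -> derivable_pt_lim (Lag N tau j) (tau i) (D i j).

Definition Ddag (omega : nat -> R) (D : nat -> nat -> R) : nat -> nat -> R :=
  fun i j => - (omega j / omega i) * D j i.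

Definition is_inv (N : nat) (A B : nat -> nat -> R) : Prop :=
  forall i k, (1 <= i <= N)%N -> (1 <= k <= N)%N ->
    sumR 1 N (fun j => A i j * B j k) = (if i == k then 1 else 0) /\
    sumR 1 N (fun j => B i j * A j k) = (if i == k then 1 else 0).
Definition infnormN (N : nat) (B : nat -> nat -> R) : R :=
  \big[Rmax/0]_(1 <= i < N.+1) sumR 1 N (fun j => Rabs (B i j)).
Definition rows_bounded (N : nat) (B : nat -> nat -> R) : Prop :=
  forall i, (1 <= i <= N)%N -> sqrt (sumR 1 N (fun j => B i j * B i j)) <= sqrt 2.

Definition P1234 (N : nat) (omega : nat -> R) (D : nat -> nat -> R) : Prop :=
  (exists B, is_inv N D B /\ infnormN N B <= 2) /\
  (exists B, is_inv N (fun i j => sqrt (omega i) * D i j) B /\ rows_bounded N B) /\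
  (exists B, is_inv N (Ddag omega D) B /\ infnormN N B <= 2) /\
  (exists B, is_inv N (fun i j => sqrt (omega i) * Ddag omega D i j) B /\ rows_bounded N B).

Definition feasible_NLP (n m : nat) (f : vec n -> vec m -> vec n) (x0 : vec n)
    (N : nat) (D : nat -> nat -> R) (X : nat -> vec n) (U : nat -> vec m) : Prop :=
  (forall i k, (1 <= i <= N)%N -> sumR 0 N (fun j => D i j * X j k) = f (X i) (U i) k) /\
  X 0%N = x0.

Definition strict_loc_min_NLP (n m : nat) (f : vec n -> vec m -> vec n) (C : vec n -> R)
    (x0 : vec n) (N : nat) (D : nat -> nat -> R) (X : nat -> vec n) (U : nat -> vec m) : Prop :=
  feasible_NLP f x0 N D X U /\
  exists r, 0 < r /\ forall X' U', feasible_NLP f x0 N D X' U' ->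
    (forall i, (i <= N)%N -> vnorm (vsub (X' i) (X i)) < r) ->
    (forall i, (1 <= i <= N)%N -> vnorm (vsub (U' i) (U i)) < r) ->
    ((forall i, (i <= N)%N -> X' i = X i) /\ (forall i, (1 <= i <= N)%N -> U' i = U i))
    \/ C (X N) < C (X' N).

Definition T_zero (n m : nat) (f : vec n -> vec m -> vec n) (x0 : vec n)
    (Df : vec (n + m) -> 'I_n -> 'I_(n + m) -> R) (gradC : vec n -> vec n)
    (N : nat) (omega : nat -> R) (D : nat -> nat -> R)
    (X : nat -> vec n) (U : nat -> vec m) (Lam : nat -> vec n) : Prop :=
  (forall i k, (1 <= i <= N)%N -> sumR 0 N (fun j => D i j * X j k) - f (X i) (U i) k = 0) /\
  (forall k, X 0%N k - x0 k = 0) /\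
  (forall k, Lam 0%N k - gradC (X N) k
              - sumR 1 N (fun i => omega i * gradxH Df (X i) (U i) (Lam i) k) = 0) /\
  (forall i k, (1 <= i < N)%N ->
     sumR 1 N (fun j => Ddag omega D i j * Lam j k) + gradxH Df (X i) (U i) (Lam i) k = 0) /\
  (forall k, sumR 1 N (fun j => Ddag omega D N j * Lam j k) + gradxH Df (X N) (U N) (Lam N) k
              + gradC (X N) k / omega N = 0) /\
  (forall i l, (1 <= i <= N)%N -> graduH Df (X i) (U i) (Lam i) l = 0).

(* Main.v *)
(** Let [B] and [Bd] be the inverses of [D_{1:N}] and [D^ddag].  The optimality system
    is then [X_i = x0 + sum_j B_ij f(X_j, U_j)], [Lam_i = grad C(X_N) - sum_j Bd_ij grad_x H_j],
    [grad_u H_i = 0].  Its linearisation at the reference trajectory has an inverse bounded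
    in the sup norm uniformly in [N]: by (A3), (P1) and (P3) the state and the costate are
    bounded by the data and, through (P2) and (P4), by the weighted L2 norm of the control;
    the duality [w_i Bd_ij = - w_j B_ji] turns the coercivity (A2) into a bound of that norm
    by the data.  A Newton iteration with frozen derivative therefore produces a solution
    near every point with a small residual.  The iteration is not started from the nodal
    values of [xs] and [lams] but from primitives of Jackson approximations of their
    derivatives, normalised by [x0] at [-1] and by [grad C] at [1]: collocation
    differentiates these polynomials exactly, so no bound on [D] is needed, and the factor
    [1 / w_N] in the terminal costate equation does no harm.  Finally, the Lagrangian of the
    nonlinear program is strictly convex near the reference trajectory and stationary at
    the solution, which makes the solution a strict minimiser. *)

Require Import Defs.
From Stdlib Require Import Reals Lra FunctionalExtensionality ClassicalEpsilon Classical.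
From mathcomp Require Import all_boot all_algebra zify.
From mathcomp Require Import Rstruct.
From Coquelicot Require Hierarchy Compactness RInt RInt_analysis Derive.
Set Implicit Arguments. Unset Strict Implicit. Unset Printing Implicit Defensive.
Open Scope R_scope.

(** No single norm closes the estimates: coercivity bounds the control only in the weighted L2 norm,
    whereas the Taylor remainders of [f] and [H] are small only in the sup norm. (P2) and (P4) lead
    from L2 control to sup-norm state and costate. The control itself returns to the sup norm node
    by node, because stationarity at a node involves only values at that node and the control block
    of the Hessian is coercive. The bounds 2 in (P1), (P3) and 1/4 in (A3) multiply to 1/2, so the
    feedback of state and costate on themselves can be absorbed.

    Exactness fixes the degrees of the starting polynomials: [N] for the state, where [D] is exact,
    and [N - 1] for the costate, where [(p L_j)'] has degree at most [2N - 2] and summation by parts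
    under the quadrature is exact. The costate polynomial ends at [grad C] of the endpoint of the
    state polynomial, so that the boundary terms cancel. [X_0] and [Lambda_0] are not unknowns of
    the iteration; [Lambda_0] is recovered by quadrature and estimated separately. The controls
    start from their exact nodal values. *)

Local Notation funext := functional_extensionality.

Local Notation "\rsum_ ( i < n ) F" := (\big[Rplus/0]_(i < n) F)
  (at level 34, F at level 41, i name, n at level 50).
Local Notation "\rsum_ i F" := (\big[Rplus/0]_i F)
  (at level 34, F at level 41, i name).
Local Notation "\rsum_ ( i : I ) F" := (\big[Rplus/0]_(i : I) F)
  (at level 34, F at level 41, i name, only parsing).

(** * Finite sums of reals *)

(** The points [(c, -b)] and [(-b, a)] give [c (ac - b^2) >= 0] and [a (ac - b^2) >= 0]; if
    [a = c = 0], the point [(1, -b)] forces [b = 0]. Common source of the Cauchy-Schwarz inequality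
    for sums and for semidefinite matrices. *)
Lemma discriminant_le a b c :
  (forall s t, 0 <= s * s * a + 2 * s * t * b + t * t * c) -> b ^ 2 <= a * c.
Proof.
move=> q; have a0 := q 1 0; have c0 := q 0 1.
have h1 := q c (- b); have h2 := q (- b) a; have h3 := q 1 (- b).
have cancel x y : 0 < x -> x * y <= 0 -> y <= 0 by move=> hx hxy; apply: Rnot_lt_le => hy; nra.
have [c_pos|c_eq] : 0 < c \/ c = 0 by lra.
  by apply: Rminus_le; apply: (cancel c) => //; nra.
have [a_pos|a_eq] : 0 < a \/ a = 0 by lra.
  by apply: Rminus_le; apply: (cancel a) => //; nra.
by move: h3; rewrite c_eq a_eq; nra.
Qed.

Lemma Rabs_add_le x y a b : Rabs x <= a -> Rabs y <= b -> Rabs (x + y) <= a + b.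
Proof. by move=> hx hy; apply: Rle_trans (Rabs_triang _ _) _; lra. Qed.

Lemma Rabs_mult_le x y a b : Rabs x <= a -> Rabs y <= b -> Rabs x * Rabs y <= a * b.
Proof. by move=> hx hy; apply: Rmult_le_compat => //; exact: Rabs_pos. Qed.

Lemma Rdiv_ge0 x y : 0 <= x -> 0 < y -> 0 <= x / y.
Proof. by move=> hx hy; apply: Rmult_le_pos => //; apply: Rlt_le; exact: Rinv_0_lt_compat. Qed.

Section RealSums.
Variable I : finType.
Implicit Types F G : I -> R.

Lemma rsumD F G : \rsum_i (F i + G i) = \rsum_i F i + \rsum_i G i.
Proof. exact: big_split. Qed.

Lemma rsumZ c F : \rsum_i (c * F i) = c * \rsum_i F i.
Proof. by rewrite big_distrr. Qed.

Lemma rsumZr c F : \rsum_i (F i * c) = (\rsum_i F i) * c.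
Proof. by rewrite big_distrl. Qed.

Lemma rsumN F : \rsum_i (- F i) = - \rsum_i F i.
Proof.
rewrite -[RHS]Rmult_1_l -Ropp_mult_distr_r Ropp_mult_distr_l -rsumZ.
by apply: eq_bigr => i _; lra.
Qed.

Lemma rsumB F G : \rsum_i (F i - G i) = \rsum_i F i - \rsum_i G i.
Proof. by rewrite /Rminus -rsumN -rsumD. Qed.

Lemma rsum_le F G : (forall i, F i <= G i) -> \rsum_i F i <= \rsum_i G i.
Proof. by move=> h; elim/big_ind2: _ => // *; lra. Qed.

Lemma rsum_ge0 F : (forall i, 0 <= F i) -> 0 <= \rsum_i F i.
Proof. by move=> h; elim/big_ind: _ => // *; lra. Qed.

Lemma rsum_abs F : Rabs (\rsum_i F i) <= \rsum_i Rabs (F i).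
Proof.
elim/big_ind2: _ => [|x y z t h1 h2|i _]; [by rewrite Rabs_R0; lra| |lra].
by apply: Rle_trans (Rabs_triang _ _) _; lra.
Qed.

Lemma rsum_const c : \rsum_(i : I) c = INR #|I| * c.
Proof.
rewrite big_const; elim: #|I| => [|k IH]; first by rewrite /=; lra.
by rewrite iterS IH S_INR; lra.
Qed.

Lemma rsum_term F i : (forall j, 0 <= F j) -> F i <= \rsum_j F j.
Proof.
move=> h; rewrite (bigD1 i) //=.
suff: 0 <= \big[Rplus/0]_(j | j != i) F j by lra.
by elim/big_ind: _ => // *; lra.
Qed.

Lemma rsum_delta F i : \rsum_j (if j == i then F j else 0) = F i.
Proof. by rewrite -big_mkcond big_pred1_eq. Qed.

Lemma rsum0 F : (forall i, F i = 0) -> \rsum_i F i = 0.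
Proof. by move=> h; rewrite big1. Qed.

Lemma rsum_CS F G :
  (\rsum_i (F i * G i)) ^ 2 <= (\rsum_i (F i * F i)) * (\rsum_i (G i * G i)).
Proof.
apply: discriminant_le => s t.
have -> : s * s * (\rsum_i (F i * F i)) + 2 * s * t * (\rsum_i (F i * G i))
    + t * t * (\rsum_i (G i * G i)) = \rsum_i ((s * F i + t * G i) * (s * F i + t * G i)).
  by rewrite -!rsumZ -!rsumD; apply: eq_bigr => i _; ring.
by apply: rsum_ge0 => i; exact: Rle_0_sqr.
Qed.

End RealSums.

(** * Trigonometric sums over equispaced points and Parseval's identity *)

Lemma telescope_sum (T : nat -> R) n : \rsum_(k < n) (T k.+1 - T k) = T n - T 0%N.
Proof. elim: n => [|n IH]; [rewrite big_ord0; lra|rewrite big_ord_recr IH /=; lra]. Qed.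

(** Multiplied by [2 sin (d PI / M)], the sum telescopes, and over [M] steps the phase advances by
    [2 d PI]; the condition on [d] keeps the multiplier positive. *)
Lemma sum_cos_progression (M d : nat) (phi : R) : (0 < d < M)%N ->
  \rsum_(j < M) cos (INR d * (2 * (PI / INR M) * INR j) + phi) = 0.
Proof.
case/andP=> d0 dM.
have M0 : 0 < INR M by apply: lt_0_INR; apply/ltP; apply: leq_trans dM.
have d0' : 0 < INR d by apply: lt_0_INR; apply/ltP.
have dM' : INR d < INR M by apply: lt_INR; apply/ltP.
set b := PI / INR M.
have Mb : INR M * b = PI by rewrite /b; field; lra.
have PI0 := PI_RGT_0.
have b0 : 0 < b by apply: Rdiv_lt_0_compat.
have s0 : 0 < sin (INR d * b) by apply: sin_gt_0; nra.
suff h : 2 * sin (INR d * b) * \rsum_(j < M) cos (INR d * (2 * b * INR j) + phi) = 0.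
  by case: (Rmult_integral _ _ h) => //; lra.
rewrite -rsumZ.
pose T j := sin (INR d * (2 * b * INR j) + phi - INR d * b).
rewrite (eq_bigr (fun j : 'I_M => T j.+1 - T j)) => [|j _]; last first.
  rewrite /T S_INR.
  have -> : INR d * (2 * b * (INR j + 1)) + phi - INR d * b
    = (INR d * (2 * b * INR j) + phi) + INR d * b by ring.
  by rewrite sin_plus sin_minus; ring.
rewrite telescope_sum /T.
have -> : INR d * (2 * b * INR M) + phi - INR d * b
  = (INR d * (2 * b * INR 0) + phi - INR d * b) + 2 * INR d * PI.
  by rewrite -Mb /=; ring.
by rewrite sin_period; lra.
Qed.

(** Real and imaginary part of [sum_k a_k e^(iks)]. *)
Definition cosum n (a : nat -> R) s := \rsum_(k < n) (a k * cos (INR k * s)).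
Definition sisum n (a : nat -> R) s := \rsum_(k < n) (a k * sin (INR k * s)).

Lemma trig_sqE n a s : cosum n a s ^ 2 + sisum n a s ^ 2 =
  \rsum_(k < n) \rsum_(l < n) (a k * a l * cos ((INR k - INR l) * s)).
Proof.
have -> : cosum n a s ^ 2 + sisum n a s ^ 2
  = cosum n a s * cosum n a s + sisum n a s * sisum n a s by ring.
rewrite {1}/cosum {2}/sisum -!rsumZr -rsumD; apply: eq_bigr => k _.
rewrite -!rsumZ -rsumD; apply: eq_bigr => l _.
by rewrite Rmult_minus_distr_r cos_minus; ring.
Qed.

(** Frequencies [k <> l] below [n] differ by less than [M], so their products average to zero over
    [M] equispaced points; only the diagonal survives. *)
Lemma trig_parseval (M n : nat) (a : nat -> R) (th : R) : (n <= M)%N -> (0 < M)%N ->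
  \rsum_(j < M) (cosum n a (th - 2 * (PI / INR M) * INR j) ^ 2
    + sisum n a (th - 2 * (PI / INR M) * INR j) ^ 2)
  = INR M * \rsum_(k < n) (a k * a k).
Proof.
move=> nM M0.
rewrite (eq_bigr _ (fun j _ => trig_sqE n a _)) exchange_big -rsumZ.
apply: eq_bigr => k _; rewrite exchange_big /=.
rewrite -(rsum_delta (fun l : 'I_n => INR M * (a k * a l)) k).
apply: eq_bigr => l _; rewrite rsumZ.
case: eqP => [->|/eqP lk].
  rewrite (eq_bigr (fun=> 1)) => [|j _]; first by rewrite rsum_const card_ord; ring.
  by rewrite -cos_0; congr cos; ring.
apply: Rmult_eq_0_compat_l.
have [kl|lk'] := ltnP k l.
  rewrite -[RHS](@sum_cos_progression M (l - k) ((INR k - INR l) * th)).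
    apply: eq_bigr => j _; congr cos.
    by rewrite minus_INR; [ring|apply/leP/ltnW].
  by rewrite subn_gt0 kl (leq_ltn_trans (leq_subr _ _)) // (leq_trans (ltn_ord l)).
have {}lk' : (l < k)%N by rewrite ltn_neqAle lk' andbT.
rewrite -[RHS](@sum_cos_progression M (k - l) ((INR l - INR k) * th)).
  apply: eq_bigr => j _; rewrite -cos_neg; congr cos.
  by rewrite minus_INR; [ring|apply/leP/ltnW].
by rewrite subn_gt0 lk' (leq_ltn_trans (leq_subr _ _)) // (leq_trans (ltn_ord k)).
Qed.

Lemma rsum_recr n (F : 'I_n.+1 -> R) :
  \rsum_(i < n.+1) F i = \rsum_(i < n) F (widen_ord (leqnSn n) i) + F ord_max.
Proof. exact: big_ord_recr. Qed.

Lemma rsum_recl n (F : 'I_n.+1 -> R) :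
  \rsum_(i < n.+1) F i = F ord0 + \rsum_(i < n) F (lift ord0 i).
Proof. exact: big_ord_recl. Qed.

(** * Jackson's theorem *)

Lemma one_sub_cos_le x : 0 < x -> 2 * (1 - cos x) <= x * x.
Proof.
move=> x0; have -> : cos x = 1 - 2 * sin (x / 2) * sin (x / 2).
  by rewrite -cos_2a_sin; congr cos; field.
have := SIN_bound (x / 2); have := sin_lt_x (x / 2) ltac:(lra).
have : 0 < sin (x / 2) \/ x / 2 >= 1.
  case: (Rlt_le_dec (x / 2) 1) => h; [left|by right; lra].
  by apply: sin_gt_0; have := PI2_1; lra.
by nra.
Qed.

(* The kernel [K = |sum_k sin ((k+1) b) e^(iks)|^2], [b = PI/(N+1)], is the
   nonnegative trigonometric kernel of degree [N-1] that minimises the mean of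
   [1 - cos]; that mean is obtained by applying Parseval to [(1 - e^(is)) sum_k ...]. *)
Section Kernel.
Variables (N : nat) (th : R).
Hypothesis N0 : (0 < N)%N.
Let b := PI / INR N.+1.
Let s (j : nat) := th - 2 * b * INR j.
Let a (k : nat) := sin (INR k.+1 * b).
Let A := \rsum_(k < N) (a k * a k).

Definition jackson_kernel (j : nat) := cosum N a (s j) ^ 2 + sisum N a (s j) ^ 2.
Let K := jackson_kernel.

(** Coefficients of [(1 - e^(is)) sum_k a_k e^(iks)]; the boundary terms vanish because
    [sin 0 = sin ((N+1) b) = 0]. The next two identities are the real and the imaginary part of this
    product. *)
Let dlt (k : nat) := sin (INR k.+1 * b) - sin (INR k * b).

Let Mb : INR N.+1 * b = PI.
Proof. by rewrite /b; field; apply: not_0_INR. Qed.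

Let cosum_diff x :
  cosum N.+1 dlt x = cosum N a x * (1 - cos x) + sisum N a x * sin x.
Proof.
rewrite /cosum /sisum -!rsumZr -rsumD /dlt.
rewrite (eq_bigr (fun k : 'I_N.+1 => sin (INR k.+1 * b) * cos (INR k * x)
  - sin (INR k * b) * cos (INR k * x))) => [|k _]; last by ring.
rewrite rsumB rsum_recr rsum_recl Mb sin_PI (_ : INR (@ord0 N) = 0) // !(Rmult_0_l b) sin_0.
rewrite !Rmult_0_l Rplus_0_r Rplus_0_l -rsumB.
apply: eq_bigr => k _; rewrite (_ : INR (lift ord0 k) = INR k + 1) ?lift0 ?S_INR //.
by rewrite (Rmult_plus_distr_r _ _ x) Rmult_1_l cos_plus /a S_INR /=; ring.
Qed.

Let sisum_diff x :
  sisum N.+1 dlt x = sisum N a x * (1 - cos x) - cosum N a x * sin x.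
Proof.
rewrite /cosum /sisum -!rsumZr -rsumB /dlt.
rewrite (eq_bigr (fun k : 'I_N.+1 => sin (INR k.+1 * b) * sin (INR k * x)
  - sin (INR k * b) * sin (INR k * x))) => [|k _]; last by ring.
rewrite [LHS]rsumB rsum_recr rsum_recl Mb sin_PI (_ : INR (@ord0 N) = 0) // !(Rmult_0_l b) sin_0.
rewrite !Rmult_0_l Rplus_0_r Rplus_0_l -rsumB.
apply: eq_bigr => k _; rewrite (_ : INR (lift ord0 k) = INR k + 1) ?lift0 ?S_INR //.
by rewrite (Rmult_plus_distr_r _ _ x) Rmult_1_l sin_plus /a S_INR /=; ring.
Qed.

Lemma jackson_kernel_ge0 j : 0 <= K j.
Proof. by rewrite /K /jackson_kernel; nra. Qed.

Lemma jackson_kernel_mass : \rsum_(j < N.+1) K j = INR N.+1 * A.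
Proof. by apply: trig_parseval. Qed.

(** Summation by parts: [sin (k b)] is an eigenvector of the second difference with zero boundary
    values, with eigenvalue [2 (1 - cos b)]. The boundary terms are collected in [T]. *)
Let dlt_sq : \rsum_(k < N.+1) (dlt k * dlt k) = 2 * (1 - cos b) * A.
Proof.
pose T (k : nat) := sin (INR k * b) * (sin (INR k * b) - sin ((INR k - 1) * b)).
have -> : A = \rsum_(k < N.+1) (sin (INR k * b) * sin (INR k * b)).
  by rewrite rsum_recl (_ : INR (@ord0 N) = 0) // !(Rmult_0_l b) sin_0 !Rmult_0_l Rplus_0_l.
rewrite -rsumZ; apply: Rminus_diag_uniq; rewrite -rsumB.
rewrite (eq_bigr (fun k : 'I_N.+1 => T k.+1 - T k)) => [|k _].
  rewrite telescope_sum /T Mb sin_PI (_ : INR 0 = 0) // !(Rmult_0_l b) sin_0; ring.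
rewrite /T /dlt S_INR.
have -> : (INR k + 1 - 1) * b = INR k * b by ring.
have -> : (INR k + 1) * b = INR k * b + b by ring.
have -> : (INR k - 1) * b = INR k * b - b by ring.
by rewrite sin_plus sin_minus; ring.
Qed.

(** [2 - 2 cos s = |1 - e^(is)|^2], so the weighted kernel is the squared modulus of the sum with
    coefficients [dlt], to which Parseval applies. *)
Lemma jackson_kernel_moment :
  \rsum_(j < N.+1) (K j * (2 - 2 * cos (s j))) = INR N.+1 * (2 * (1 - cos b) * A).
Proof.
rewrite -dlt_sq -(@trig_parseval N.+1 N.+1 dlt th) //.
apply: eq_bigr => j _; rewrite -/b -/(s j) cosum_diff sisum_diff /K /jackson_kernel.
have := sin2_cos2 (s j); rewrite /Rsqr => h.
set c := cosum _ _ _; set d := sisum _ _ _.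
have -> : (c * (1 - cos (s j)) + d * sin (s j)) ^ 2 + (d * (1 - cos (s j)) - c * sin (s j)) ^ 2
  = (c ^ 2 + d ^ 2) * (1 - 2 * cos (s j) + (sin (s j) * sin (s j) + cos (s j) * cos (s j))) by ring.
by rewrite h; ring.
Qed.

(** The chord bound [|cos th - cos t|^2 <= 2 - 2 cos (th - t)] and [sqrt x <= b/2 + x/(2b)] reduce
    the error to the moment of the kernel, which is at most [b^2] times its mass. The two halves add
    up to [L b]. *)
Lemma jackson_average (h : R -> R) (L : R) : 0 <= L ->
  (forall x y, -1 <= x <= 1 -> -1 <= y <= 1 -> Rabs (h x - h y) <= L * Rabs (x - y)) ->
  Rabs (h (cos th) * (INR N.+1 * A) - \rsum_(j < N.+1) (K j * h (cos (2 * b * INR j))))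
    <= L * b * (INR N.+1 * A).
Proof.
move=> L0 hL.
have M0 : 0 < INR N.+1 by apply: lt_0_INR; apply/ltP.
have b0 : 0 < b by apply: Rdiv_lt_0_compat => //; exact: PI_RGT_0.
have A0 : 0 <= A by apply: rsum_ge0 => k; exact: Rle_0_sqr.
have step (j : 'I_N.+1) : Rabs (K j * h (cos th) - K j * h (cos (2 * b * INR j)))
    <= L * (b / 2) * K j + L / (2 * b) * (K j * (2 - 2 * cos (s j))).
  rewrite -Rmult_minus_distr_l Rabs_mult (Rabs_pos_eq _ (jackson_kernel_ge0 j)).
  have := hL _ _ (COS_bound th) (COS_bound (2 * b * INR j)).
  set t := 2 * b * INR j; set dh := Rabs _ => h1.
  have K0 : 0 <= K j := jackson_kernel_ge0 j.
  have h2 : Rabs (cos th - cos t) <= b / 2 + (2 - 2 * cos (s j)) / (2 * b).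
    have h3 : Rabs (cos th - cos t) * Rabs (cos th - cos t) <= 2 - 2 * cos (s j).
      rewrite -Rabs_mult Rabs_pos_eq; last by exact: Rle_0_sqr.
      rewrite /s -/t cos_minus.
      have := sin2_cos2 th; have := sin2_cos2 t; rewrite /Rsqr.
      by have := Rle_0_sqr (sin th - sin t); rewrite /Rsqr; nra.
    have -> : b / 2 + (2 - 2 * cos (s j)) / (2 * b) = (b * b + (2 - 2 * cos (s j))) / (2 * b).
      by field; lra.
    apply: (Rmult_le_reg_r (2 * b)); first by lra.
    rewrite /Rdiv Rmult_assoc Rinv_l; last by lra.
    by have := Rle_0_sqr (b - Rabs (cos th - cos t)); rewrite /Rsqr; nra.
  have -> : L * (b / 2) * K j + L / (2 * b) * (K j * (2 - 2 * cos (s j)))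
    = K j * (L * (b / 2 + (2 - 2 * cos (s j)) / (2 * b))) by field; lra.
  by apply: Rmult_le_compat_l => //; apply: Rle_trans h1 _; apply: Rmult_le_compat_l.
have -> : h (cos th) * (INR N.+1 * A) = \rsum_(j < N.+1) (K j * h (cos th)).
  by rewrite rsumZr jackson_kernel_mass; ring.
rewrite -rsumB; apply: Rle_trans (rsum_abs _) _.
apply: Rle_trans (rsum_le step) _.
rewrite rsumD !rsumZ jackson_kernel_mass jackson_kernel_moment.
have -> : L / (2 * b) * (INR N.+1 * (2 * (1 - cos b) * A))
  = (L * (INR N.+1 * A)) * ((2 * (1 - cos b)) / (2 * b)) by field; lra.
have h4 : (2 * (1 - cos b)) / (2 * b) <= b / 2.
  apply: (Rmult_le_reg_r (2 * b)); first by lra.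
  have := one_sub_cos_le b0.
  by rewrite /Rdiv Rmult_assoc Rinv_l; last lra; lra.
have h5 : 0 <= L * (INR N.+1 * A) by apply: Rmult_le_pos => //; apply: Rmult_le_pos; lra.
by nra.
Qed.

Lemma jackson_mass_gt0 : 0 < INR N.+1 * A.
Proof.
apply: Rmult_lt_0_compat; first by apply: lt_0_INR; apply/ltP.
apply: Rlt_le_trans (rsum_term (Ordinal N0) _); last by move=> k; exact: Rle_0_sqr.
have PI0 := PI_RGT_0.
have : 0 < a 0%N.
  have M2 : 2 <= INR N.+1 by apply: (le_INR 2); apply/leP.
  rewrite /a /= Rmult_1_l; apply: sin_gt_0; first by apply: Rdiv_lt_0_compat; lra.
  by have := Mb; nra.
by rewrite /=; nra.
Qed.

End Kernel.

(** Even trigonometric polynomials of degree below [d], represented by an algebraic polynomial in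
    [cos], which is the form the approximation on [[-1, 1]] needs. *)
Definition cospoly (d : nat) (F : R -> R) :=
  exists p : {poly R}, (size p <= d)%N /\ forall th, F th = horner p (cos th).

Lemma cospoly_ext d F G : (forall th, F th = G th) -> cospoly d G -> cospoly d F.
Proof. by move=> e [p [sp hp]]; exists p; split=> // th; rewrite e. Qed.

Lemma cospolyD d F G : cospoly d F -> cospoly d G -> cospoly d (fun th => F th + G th).
Proof.
move=> [p [sp hp]] [q [sq hq]]; exists (GRing.add p q); split.
  by rewrite (leq_trans (size_polyD _ _)) // geq_max sp.
by move=> th; rewrite hp hq hornerD.
Qed.

Lemma cospolyZ d c F : cospoly d F -> cospoly d (fun th => c * F th).
Proof.
move=> [p [sp hp]]; exists (GRing.scale c p); split.
  exact: leq_trans (size_scale_leq _ _) sp.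
by move=> th; rewrite hp hornerZ.
Qed.

Lemma cospoly_sum (I : finType) d (F : I -> R -> R) :
  (forall i, cospoly d (F i)) -> cospoly d (fun th => \rsum_i F i th).
Proof.
move=> hF; suff h s : cospoly d (fun th => \big[Rplus/0]_(i <- s) F i th).
  by case: (h (index_enum I)) => p hp; exists p.
elim: s => [|i s IH].
  exists (0%R : {poly R}); split; first by rewrite size_poly0.
  by move=> th; rewrite big_nil horner0.
by apply: cospoly_ext (cospolyD (hF i) IH) => th; rewrite big_cons.
Qed.

(** Chebyshev recurrence [cos ((n+2) th) = 2 cos th cos ((n+1) th) - cos (n th)]; the induction
    therefore carries two consecutive orders. *)
Lemma cospoly_cos n d : (n < d)%N -> cospoly d (fun th => cos (INR n * th)).
Proof.
move=> nd; suff [h _] : cospoly n.+1 (fun th => cos (INR n * th)) /\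
    cospoly n.+2 (fun th => cos (INR n.+1 * th)).
  by case: h => p [sp hp]; exists p; split=> //; apply: leq_trans sp nd.
elim: n {nd} => [|n [h1 h2]].
  split.
    exists (polyC (1 : R)); split; first exact: size_polyC_leq1.
    by move=> th; rewrite hornerC /= Rmult_0_l cos_0.
  exists (polyX R); split; first by rewrite size_polyX.
  by move=> th; rewrite hornerX /= Rmult_1_l.
split=> //.
have h3 : cospoly n.+3 (fun th => cos th * cos (INR n.+1 * th)).
  case: h2 => p [sp hp]; exists (GRing.mul p (polyX R)); split.
    case: (eqVneq p (0%R : {poly R})) => [->|p0]; first by rewrite GRing.mul0r size_poly0.
    by rewrite size_mulX.
  by move=> th; rewrite hp hornerMX; apply: Rmult_comm.
have h4 : cospoly n.+3 (fun th => cos (INR n * th)).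
  by case: h1 => p [sp hp]; exists p; split=> //; apply: leq_trans sp _; rewrite ltnW.
apply: cospoly_ext (cospolyD (cospolyZ 2 h3) (cospolyZ (-1) h4)) => th.
have -> : INR n.+2 * th = INR n.+1 * th + th by rewrite !S_INR; ring.
have -> : INR n * th = INR n.+1 * th - th by rewrite !S_INR; ring.
by rewrite cos_plus cos_minus; ring.
Qed.

(** The kernel average of [h (cos t)] over [N + 1] points is a trigonometric polynomial in [th].
    Averaging its values at [th] and [- th] removes the sines and keeps the error bound, since
    [h (cos th)] is even. *)
Lemma jackson_lipschitz (N : nat) (h : R -> R) (L : R) : (0 < N)%N -> 0 <= L ->
  (forall x y, -1 <= x <= 1 -> -1 <= y <= 1 -> Rabs (h x - h y) <= L * Rabs (x - y)) ->
  exists p : {poly R}, (size p <= N)%N /\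
    forall x, -1 <= x <= 1 -> Rabs (h x - horner p x) <= L * (PI / INR N.+1).
Proof.
move=> N0 L0 hL; set b := PI / INR N.+1.
pose a k := sin (INR k.+1 * b).
pose A := INR N.+1 * \rsum_(k < N) (a k * a k).
have A0 : 0 < A := jackson_mass_gt0 N0.
pose P th := \rsum_(j < N.+1) (jackson_kernel N th j * h (cos (2 * b * INR j))).
have [p [sp hp]] : cospoly N (fun th => / (2 * A) * (P th + P (- th))).
  apply: cospolyZ.
  apply: (@cospoly_ext _ _ (fun th => \rsum_(j < N.+1) \rsum_(k < N) \rsum_(l < N)
    (a k * a l * (2 * cos ((INR k - INR l) * (2 * b * INR j))) * h (cos (2 * b * INR j))
      * cos ((INR k - INR l) * th)))) => [th|].
    rewrite /P -rsumD; apply: eq_bigr => j _.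
    rewrite -Rmult_plus_distr_r /jackson_kernel !trig_sqE -rsumD -rsumZr.
    apply: eq_bigr => k _; rewrite -rsumD -rsumZr; apply: eq_bigr => l _.
    rewrite -/b -/(a k) -/(a l).
    have -> : (INR k - INR l) * (th - 2 * b * INR j)
      = (INR k - INR l) * th - (INR k - INR l) * (2 * b * INR j) by ring.
    have -> : (INR k - INR l) * (- th - 2 * b * INR j)
      = - ((INR k - INR l) * th + (INR k - INR l) * (2 * b * INR j)) by ring.
    by rewrite cos_neg cos_minus cos_plus; ring.
  apply: cospoly_sum => j; apply: cospoly_sum => k; apply: cospoly_sum => l.
  apply: cospolyZ; have [kl|lk] := leqP k l.
    apply: (@cospoly_ext _ _ (fun th => cos (INR (l - k) * th))) => [th|].
      by rewrite -cos_neg minus_INR; [congr cos; ring|apply/leP].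
    by apply: cospoly_cos; apply: leq_ltn_trans (leq_subr _ _) (ltn_ord l).
  apply: (@cospoly_ext _ _ (fun th => cos (INR (k - l) * th))) => [th|].
    by rewrite minus_INR //; apply/leP/ltnW.
  by apply: cospoly_cos; apply: leq_ltn_trans (leq_subr _ _) (ltn_ord k).
exists p; split=> // x hx; rewrite -(cos_acos x hx) -hp.
set th := acos x.
have h1 : Rabs (h (cos th) * A - P th) <= L * b * A := @jackson_average N th h L L0 hL.
have h2 : Rabs (h (cos th) * A - P (- th)) <= L * b * A.
  by have := @jackson_average N (- th) h L L0 hL; rewrite cos_neg.
have -> : h (cos th) - / (2 * A) * (P th + P (- th))
  = / (2 * A) * ((h (cos th) * A - P th) + (h (cos th) * A - P (- th))) by field; lra.
rewrite Rabs_mult Rabs_pos_eq; last by apply: Rlt_le; apply: Rinv_0_lt_compat; lra.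
apply: (Rmult_le_reg_l (2 * A)); first by lra.
rewrite -Rmult_assoc Rinv_r; last by lra.
by have := Rabs_triang (h (cos th) * A - P th) (h (cos th) * A - P (- th)); lra.
Qed.

(** * Polynomial derivatives and primitives; calculus within [-1, 1] *)

Lemma horner_derivable (p : {poly R}) x : derivable_pt_lim (horner p) x (horner (deriv p) x).
Proof.
elim/poly_ind: p => [|p c IH].
  rewrite deriv0 horner0; apply: (derivable_pt_lim_ext (fun=> 0)); last exact: derivable_pt_lim_const.
  by move=> z; rewrite horner0.
apply: (derivable_pt_lim_ext (fun z => horner p z * z + c)).
  by move=> z; rewrite hornerD hornerMX hornerC.
have -> : horner (deriv (p * 'X + c%:P)%R) x = (horner (deriv p) x * x + horner p x * 1) + 0.
  rewrite derivD derivC GRing.addr0 derivM derivX GRing.mulr1 hornerD hornerMX.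
  by rewrite Rplus_0_r Rmult_1_r.
apply: (derivable_pt_lim_plus (fun z => horner p z * z) (fun=> c)); last exact: derivable_pt_lim_const.
exact: derivable_pt_lim_mult IH (derivable_pt_lim_id x).
Qed.

Lemma poly_primitive (F : numFieldType) (p : {poly F}) (a v : F) :
  exists P : {poly F}, [/\ (size P <= (size p).+1)%N, deriv P = p & horner P a = v].
Proof.
pose P0 : {poly F} := (\poly_(i < (size p).+1) (p`_(i.-1) / i%:R))%R.
exists (P0 + (v - horner P0 a)%:P)%R; split.
- rewrite (leq_trans (size_polyD _ _)) // geq_max size_poly /=.
  by rewrite (leq_trans (size_polyC_leq1 _)).
- rewrite derivD derivC GRing.addr0; apply/polyP => i.
  rewrite coef_deriv coef_poly ltnS -pred_Sn; case: (ltnP i (size p)) => hi.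
    by rewrite -[LHS]GRing.mulr_natr GRing.mulfVK // Num.Theory.pnatr_eq0.
  by rewrite GRing.mul0rn nth_default.
- by rewrite hornerD hornerC GRing.addrC GRing.subrK.
Qed.

(* Composition with [clamp] turns continuity within [-1, 1] into the two-sided continuity
   that the mean value and extreme value theorems for [R -> R] require. *)
Definition clamp t := Rmax (-1) (Rmin 1 t).

Lemma clamp_itv t : -1 <= clamp t <= 1.
Proof.
split; first exact: Rmax_l.
by apply: Rmax_lub; [lra|exact: Rmin_l].
Qed.

Lemma clamp_id t : -1 <= t <= 1 -> clamp t = t.
Proof. by move=> h; rewrite /clamp Rmin_right ?Rmax_right; lra. Qed.

Lemma clamp_lip s t : Rabs (clamp s - clamp t) <= Rabs (s - t).
Proof.
have := Rle_abs (s - t); have := Rle_abs (- (s - t)); rewrite Rabs_Ropp => h1 h2.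
apply: Rabs_le; rewrite /clamp /Rmin /Rmax.
by case: (Rle_dec 1 s) => ?; case: (Rle_dec 1 t) => ?; repeat (case: Rle_dec => ?); lra.
Qed.

Lemma cont_within_clamp g t : (forall s, -1 <= s <= 1 -> cont_within (-1) 1 g s) ->
  continuity_pt (fun s => g (clamp s)) t.
Proof.
move=> hg eps eps0; have [dl [dl0 h]] := hg _ (clamp_itv t) _ eps0.
exists dl; split=> // s [_ hs]; apply: h; first exact: clamp_itv.
exact: Rle_lt_trans (clamp_lip _ _) hs.
Qed.

Lemma deriv_within_cont g t l : -1 <= t <= 1 ->
  deriv_within (-1) 1 g t l -> cont_within (-1) 1 g t.
Proof.
move=> ht hd eps eps0; have [dl [dl0 h]] := hd 1 ltac:(lra).
have q0 : 0 < eps / (Rabs l + 1) by apply: Rdiv_lt_0_compat => //; have := Rabs_pos l; lra.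
exists (Rmin dl (eps / (Rabs l + 1))); split; first exact: Rmin_glb_lt.
move=> s hs hst; have [->|st] := Req_dec s t; first by rewrite Rminus_diag Rabs_R0.
have h1 := Rlt_le_trans _ _ _ hst (Rmin_l _ _); have h2 := Rlt_le_trans _ _ _ hst (Rmin_r _ _).
have := h (s - t) ltac:(lra) h1; have -> : t + (s - t) = s by ring.
move=> /(_ hs) h3.
have d0 : 0 < Rabs (s - t) by apply: Rabs_pos_lt; lra.
have -> : g s - g t = ((g s - g t) / (s - t) - l + l) * (s - t) by field; lra.
rewrite Rabs_mult.
have := Rabs_triang ((g s - g t) / (s - t) - l) l => h4.
have l1 : 0 < Rabs l + 1 by have := Rabs_pos l; lra.
apply: (Rle_lt_trans _ ((Rabs l + 1) * Rabs (s - t))).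
  by apply: Rmult_le_compat_r; lra.
have -> : eps = (Rabs l + 1) * (eps / (Rabs l + 1)) by field; lra.
exact: Rmult_lt_compat_l.
Qed.

Lemma deriv_within_interior g t l : -1 < t < 1 ->
  deriv_within (-1) 1 g t l -> derivable_pt_lim (fun s => g (clamp s)) t l.
Proof.
move=> ht hd eps eps0; have [dl [dl0 h]] := hd _ eps0.
have m0 : 0 < Rmin dl (Rmin (1 - t) (t + 1)) by do !apply: Rmin_glb_lt; lra.
exists (mkposreal _ m0) => x x0 /= hx.
have h1 := Rlt_le_trans _ _ _ hx (Rmin_l _ _); have h2 := Rlt_le_trans _ _ _ hx (Rmin_r _ _).
have h3 := Rlt_le_trans _ _ _ h2 (Rmin_l _ _); have h4 := Rlt_le_trans _ _ _ h2 (Rmin_r _ _).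
have [h5 h6] := Rabs_def2 _ _ h3; have [h7 h8] := Rabs_def2 _ _ h4.
by rewrite !clamp_id; [apply: h => //| |]; lra.
Qed.

Lemma deriv_within_MVT g g' s t :
  (forall u, -1 <= u <= 1 -> deriv_within (-1) 1 g u (g' u)) ->
  -1 <= s -> s < t -> t <= 1 ->
  exists u, -1 <= u <= 1 /\ g t - g s = g' u * (t - s).
Proof.
move=> hd hs hst ht.
have cg u : continuity_pt (fun s => g (clamp s)) u.
  by apply: cont_within_clamp => v hv; exact: deriv_within_cont (hd v hv).
have dg u (hu : s < u < t) : derivable_pt_lim (fun s => g (clamp s)) u (g' u).
  by apply: deriv_within_interior; [lra|apply: hd; lra].
pose pr1 u hu : derivable_pt (fun s => g (clamp s)) u := exist _ _ (dg u hu).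
pose pr2 u (hu : s < u < t) : derivable_pt id u := derivable_pt_id u.
have [u [hu]] := MVT (fun s => g (clamp s)) id s t pr1 pr2 hst (fun c _ => cg c)
  (fun c _ => derivable_continuous_pt _ _ (derivable_pt_id c)).
rewrite (derive_pt_eq_0 _ _ _ (pr1 u hu) (dg u hu)) (derive_pt_eq_0 _ _ _ (pr2 u hu) (derivable_pt_lim_id u)).
rewrite /id !clamp_id; [|lra|lra] => e.
by exists u; split; lra.
Qed.

Lemma deriv_within_lipschitz g g' L :
  (forall u, -1 <= u <= 1 -> deriv_within (-1) 1 g u (g' u)) ->
  (forall u, -1 <= u <= 1 -> Rabs (g' u) <= L) ->
  forall s t, -1 <= s <= 1 -> -1 <= t <= 1 -> Rabs (g s - g t) <= L * Rabs (s - t).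
Proof.
move=> hd hL.
have h s t : -1 <= s -> s < t -> t <= 1 -> Rabs (g t - g s) <= L * Rabs (t - s).
  move=> hs hst ht; have [u [hu ->]] := deriv_within_MVT hd hs hst ht.
  by rewrite Rabs_mult; apply: Rmult_le_compat_r; [exact: Rabs_pos|exact: hL].
move=> s t hs ht; have [st|[->|ts]] := Rtotal_order s t.
- by rewrite Rabs_minus_sym (Rabs_minus_sym s); apply: h; lra.
- by rewrite !Rminus_diag Rabs_R0; lra.
- by apply: h; lra.
Qed.

Lemma cont_within_bounded g : (forall t, -1 <= t <= 1 -> cont_within (-1) 1 g t) ->
  exists c, 0 <= c /\ forall t, -1 <= t <= 1 -> Rabs (g t) <= c.
Proof.
move=> hg.
have cg u : continuity_pt (fun s => Rabs (g (clamp s))) u.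
  by apply: (continuity_pt_comp (fun s => g (clamp s)) Rabs); [exact: cont_within_clamp|exact: Rcontinuity_abs].
have [x [hx _]] := continuity_ab_maj _ (-1) 1 ltac:(lra) (fun c _ => cg c).
exists (Rabs (g (clamp x))); split; first exact: Rabs_pos.
by move=> t ht; have := hx t ht; rewrite (clamp_id ht).
Qed.

Lemma deriv_within_horner (p : {poly R}) t : deriv_within (-1) 1 (horner p) t (horner (deriv p) t).
Proof.
move=> eps eps0; have [dl h] := horner_derivable p t eps0.
by exists dl; split; [case: dl {h}|move=> k k0 kd _; apply: h].
Qed.

Lemma deriv_withinB g h t l m : deriv_within (-1) 1 g t l -> deriv_within (-1) 1 h t m ->
  deriv_within (-1) 1 (fun s => g s - h s) t (l - m).
Proof.
move=> hg hh eps eps0.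
have [d1 [d10 h1]] := hg (eps / 2) ltac:(lra); have [d2 [d20 h2]] := hh (eps / 2) ltac:(lra).
exists (Rmin d1 d2); split; first exact: Rmin_glb_lt.
move=> k k0 kd hk.
have {}h1 := h1 k k0 (Rlt_le_trans _ _ _ kd (Rmin_l _ _)) hk.
have {}h2 := h2 k k0 (Rlt_le_trans _ _ _ kd (Rmin_r _ _)) hk.
have -> : (g (t + k) - h (t + k) - (g t - h t)) / k - (l - m)
  = ((g (t + k) - g t) / k - l) - ((h (t + k) - h t) / k - m) by field.
by apply: Rle_lt_trans (Rabs_triang _ _) _; rewrite Rabs_Ropp; lra.
Qed.

(** Derivatives within [[-1, 1]] are unique, so [g'] agrees there with the first derivative supplied
    by the witness of [Ck_on], and the shifted witness serves [g']. *)
Lemma Ck_deriv k g g' : Ck_on k.+1 g ->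
  (forall t, -1 <= t <= 1 -> deriv_within (-1) 1 g t (g' t)) -> Ck_on k g'.
Proof.
move=> [d [d0 [dd dc]]] hg; exists (fun j => d j.+1); split; last first.
  by split=> [j t jk ht|j t jk ht]; [apply: dd|apply: dc].
move=> t ht.
have h1 : deriv_within (-1) 1 (fun s => g s - d 0%N s) t (g' t - d 1%N t).
  by apply: deriv_withinB; [exact: hg|apply: dd].
apply: NNPP => ne.
have e0 : 0 < Rabs (g' t - d 1%N t) by apply: Rabs_pos_lt; lra.
have [dl [dl0 h]] := h1 _ e0.
pose m := Rmin (dl / 2) (1 / 2).
have m0 : 0 < m by apply: Rmin_glb_lt; lra.
have [m1 m2] : m <= dl / 2 /\ m <= 1 / 2 by split; [exact: Rmin_l|exact: Rmin_r].
(* The increment points towards the middle of the interval, so that [t + k'] stays inside even when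
   [t] is an endpoint. *)
have [k' [k'0 k'd k't]] : exists k', [/\ k' <> 0, Rabs k' < dl & -1 <= t + k' <= 1].
  case: (Rle_lt_dec t 0) => t0; [exists m|exists (- m)]; split; try lra.
    by rewrite Rabs_pos_eq; lra.
  by rewrite Rabs_Ropp Rabs_pos_eq; lra.
have := h _ k'0 k'd k't; rewrite !d0 //.
have -> : (g (t + k') - g (t + k') - (g t - g t)) / k' - (g' t - d 1%N t)
  = - (g' t - d 1%N t) by field.
by rewrite Rabs_Ropp; lra.
Qed.

Lemma Ck_cont k g t : Ck_on k g -> -1 <= t <= 1 -> cont_within (-1) 1 g t.
Proof.
move=> [d [d0 [_ dc]]] ht eps eps0; have [dl [dl0 h]] := dc 0%N t (leq0n _) ht _ eps0.
by exists dl; split=> // s hs st; rewrite -!d0 //; apply: h.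
Qed.

Lemma Ck_le j k g : (j <= k)%N -> Ck_on k g -> Ck_on j g.
Proof.
move=> jk [d [d0 [dd dc]]]; exists d; split=> //; split=> i t ij ht.
  by apply: dd => //; apply: leq_trans jk.
by apply: dc => //; apply: leq_trans jk.
Qed.

(** Induction on [k]: a polynomial [q] of size [N - 1] close to the derivative has a primitive [Q],
    and [g - Q] is Lipschitz with the error of [q] as constant; [jackson_lipschitz] gains the
    remaining power of [N]. *)
Lemma jackson k g : Ck_on k g -> exists c, 0 <= c /\
  forall N, (0 < N)%N -> exists p : {poly R}, (size p <= N)%N /\
    forall t, -1 <= t <= 1 -> Rabs (g t - horner p t) <= c / INR N ^ k.
Proof.
elim: k g => [|k IH] g hg.
  have [c [c0 hc]] := cont_within_bounded (fun t ht => Ck_cont hg ht).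
  exists c; split=> // N N0; exists (0%R : {poly R}); split; first by rewrite size_poly0.
  by move=> t ht; rewrite horner0 Rminus_0_r /= Rdiv_1_r; apply: hc.
have [c0 [c00 hc0]] := cont_within_bounded (fun t ht => Ck_cont hg ht).
have [d [d0 [dd dc]]] := hg.
have dg t : -1 <= t <= 1 -> deriv_within (-1) 1 (d 0%N) t (d 1%N t) by move=> ht; apply: dd.
have [c1 [c10 hc1]] : exists c, 0 <= c /\
  forall N, (0 < N)%N -> exists p : {poly R}, (size p <= N)%N /\
    forall t, -1 <= t <= 1 -> Rabs (d 1%N t - horner p t) <= c / INR N ^ k.
  apply: IH; exists (fun j => d j.+1); split=> //.
  by split=> j t jk ht; [apply: dd|apply: dc].
have k2 : 0 < 2 ^ k by apply: pow_lt; lra.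
have ck : 0 <= c1 * 2 ^ k by nra.
(* [c0] serves [N = 1], where the zero polynomial is taken; [2 ^ k] pays for passing from [N - 1] to
   [N], and 4 bounds [PI]. *)
exists (c0 + c1 * 2 ^ k * 4); split; first lra.
case=> [//|[_|N _]].
  exists (0%R : {poly R}); split; first by rewrite size_poly0.
  move=> t ht; rewrite horner0 Rminus_0_r pow1 Rdiv_1_r.
  by have := hc0 t ht; lra.
have [q [sq hq]] := hc1 N.+1 isT.
have [Q [sQ dQ _]] := poly_primitive q (0 : R) (0 : R).
have M0 : 0 < INR N.+1 by apply: lt_0_INR; apply/ltP.
have M1 : 1 <= INR N.+1 by apply: (le_INR 1); apply/leP.
set M := INR N.+2; have MN : M = INR N.+1 + 1 by rewrite /M S_INR.
have Mk : 0 < M ^ k by apply: pow_lt; lra.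
have Nk : 0 < INR N.+1 ^ k by apply: pow_lt.
pose L := c1 * 2 ^ k / M ^ k.
have L0 : 0 <= L by apply: Rdiv_ge0 => //; nra.
have hL : c1 / INR N.+1 ^ k <= L.
  rewrite /L /Rdiv Rmult_assoc; apply: Rmult_le_compat_l => //.
  apply: (Rmult_le_reg_r (M ^ k * INR N.+1 ^ k)); first by nra.
  have -> : / INR N.+1 ^ k * (M ^ k * INR N.+1 ^ k) = M ^ k by field; lra.
  have -> : 2 ^ k * / M ^ k * (M ^ k * INR N.+1 ^ k) = (2 * INR N.+1) ^ k.
    by rewrite Rpow_mult_distr; field; lra.
  by apply: pow_incr; lra.
have hlip := deriv_within_lipschitz (g := fun t => d 0%N t - horner Q t)
  (g' := fun t => d 1%N t - horner q t) (L := L).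
have {}hlip := hlip _ (fun u hu => Rle_trans _ _ _ (hq u hu) hL).
have {}hlip : forall s t, -1 <= s <= 1 -> -1 <= t <= 1 ->
    Rabs (d 0%N s - horner Q s - (d 0%N t - horner Q t)) <= L * Rabs (s - t).
  by apply: hlip => u hu; apply: deriv_withinB; [exact: dg|rewrite -dQ; exact: deriv_within_horner].
have [p [sp hp]] := jackson_lipschitz (N := N.+2) isT L0 hlip.
exists (p + Q)%R; split.
  by rewrite (leq_trans (size_polyD _ _)) // geq_max sp (leq_trans sQ).
move=> t ht; rewrite hornerD -(d0 t ht).
have := hp t ht; rewrite -RplusE.
have -> : d 0%N t - (horner p t + horner Q t) = d 0%N t - horner Q t - horner p t by ring.
move/Rle_trans; apply.
have M3 : 0 < INR N.+3 by apply: lt_0_INR; apply/ltP.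
have h1 : PI / INR N.+3 <= 4 / M.
  apply: (Rmult_le_reg_r (INR N.+3 * M)); first by nra.
  have -> : PI / INR N.+3 * (INR N.+3 * M) = PI * M by field; lra.
  have -> : 4 / M * (INR N.+3 * M) = 4 * INR N.+3 by field; lra.
  have M4 : INR N.+3 = M + 1 by rewrite /M -S_INR.
  by have := PI_4; nra.
apply: Rle_trans (Rmult_le_compat_l _ _ _ L0 h1) _.
have -> : L * (4 / M) = (c1 * 2 ^ k * 4) / M ^ k.+1 by rewrite /L /=; field; lra.
apply: Rmult_le_compat_r; last by lra.
by apply: Rlt_le; apply: Rinv_0_lt_compat; apply: pow_lt; lra.
Qed.

(** * Matrices and calculus in several variables *)

Definition mxapp (I J : finType) (A : I -> J -> R) (v : J -> R) : I -> R :=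
  fun i => \rsum_j (A i j * v j).

Lemma mxapp_lincomb (I J : finType) (A : I -> J -> R) s t (v w : J -> R) i :
  mxapp A (fun j => s * v j + t * w j) i = s * mxapp A v i + t * mxapp A w i.
Proof. by rewrite /mxapp -!rsumZ -rsumD; apply: eq_bigr => j _; ring. Qed.

(** The Fredholm alternative over an arbitrary finite index type, transported along [enum_val] to
    square matrices, where the determinant decides. The Newton iteration uses it with a structured
    index type. *)
Lemma singular_or_invertible (I : finType) (A : I -> I -> R) :
  (exists v, (exists i, v i <> 0) /\ forall i, mxapp A v i = 0) \/
  (exists B, (forall v, mxapp B (mxapp A v) = v) /\ (forall v, mxapp A (mxapp B v) = v)).
Proof.
pose M : 'M[R]_#|I| := (\matrix_(i, j) A (enum_val i) (enum_val j))%R.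
pose col (v : I -> R) : 'cV[R]_#|I| := (\col_i v (enum_val i))%R.
have bigE (F : I -> R) : \rsum_(i < #|I|) F (enum_val i) = \rsum_(i : I) F i.
  rewrite [RHS](reindex (@enum_val I I)) //=; exact: onW_bij (enum_val_bij I).
have appE (B : I -> I -> R) v i :
    ((\matrix_(i, j) B (enum_val i) (enum_val j))%R *m col v)%R i ord0 = mxapp B v (enum_val i).
  rewrite mxE /mxapp -bigE; apply: eq_bigr => j _; by rewrite !mxE.
have colP v w : col v = col w -> v = w.
  move/matrixP => h; apply: funext => i.
  by have := h (enum_rank i) ord0; rewrite !mxE enum_rankK.
have appcol (B : I -> I -> R) v :
    ((\matrix_(i, j) B (enum_val i) (enum_val j))%R *m col v)%R = col (mxapp B v).
  by apply/matrixP => i j; rewrite ord1 appE [RHS]mxE.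
case: (boolP (M \in unitmx)) => hM; [right|left].
  pose B i j := invmx M (enum_rank i) (enum_rank j).
  have BE : (\matrix_(i, j) B (enum_val i) (enum_val j))%R = invmx M.
    by apply/matrixP => i j; rewrite mxE /B !enum_valK.
  exists B; split=> v; apply: colP; rewrite -!appcol BE mulmxA.
    by rewrite mulVmx // mul1mx.
  by rewrite mulmxV // mul1mx.
have : (\det M^T = 0)%R.
  by rewrite det_tr; apply/eqP; move: hM; rewrite unitmxE GRing.unitfE negbK.
move/eqP/det0P => [v v0 hv].
exists (fun i => v ord0 (enum_rank i)); split.
  apply: NNPP => hn; case/negP: v0; apply/eqP/rowP => i; rewrite mxE.
  by apply: NNPP => hi; apply: hn; exists (enum_val i); rewrite enum_valK.
move=> i.
have e : col (fun i => v ord0 (enum_rank i)) = (v^T)%R.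
  by apply/matrixP => a b; rewrite !mxE (ord1 b) enum_valK.
have := appE _ A (fun i => v ord0 (enum_rank i)) (enum_rank i).
rewrite enum_rankK => <-; rewrite e -/M -[M]trmxK -trmx_mul hv.
by rewrite !mxE.
Qed.

Lemma dotv_comm p (v w : vec p) : dotv v w = dotv w v.
Proof. by apply: eq_bigr => i _; ring. Qed.

Lemma dotv_lincomb p s t (u v w : vec p) :
  dotv u (fun i => s * v i + t * w i) = s * dotv u v + t * dotv u w.
Proof. by rewrite /dotv -!rsumZ -rsumD; apply: eq_bigr => j _; ring. Qed.

Lemma dotv_ge0 p (v : vec p) : 0 <= dotv v v.
Proof. by apply: rsum_ge0 => i; exact: Rle_0_sqr. Qed.

Lemma dotv_CS p (v w : vec p) : dotv v w ^ 2 <= dotv v v * dotv w w.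
Proof. exact: rsum_CS. Qed.

Lemma dotv_eq0 p (v : vec p) : dotv v v = 0 -> forall i, v i = 0.
Proof.
move=> h i; have := rsum_term i (fun j => Rle_0_sqr (v j)).
by rewrite /Rsqr -/(dotv v v) h; nra.
Qed.

Lemma dotv_gt0 p (v : vec p) i : v i <> 0 -> 0 < dotv v v.
Proof.
by move=> vi; have := dotv_ge0 v; case=> // h; case: vi; exact: (dotv_eq0 (esym h)).
Qed.

Lemma mxapp_sq_le (p : nat) (B : 'I_p -> 'I_p -> R) (v : vec p) :
  dotv (mxapp B v) (mxapp B v) <= (\rsum_i \rsum_j (B i j * B i j)) * dotv v v.
Proof.
rewrite -rsumZr; apply: rsum_le => i.
by have := rsum_CS (B i) v; rewrite -/(mxapp B v i) -/(dotv v v); nra.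
Qed.

Lemma mxapp_sym (p : nat) (A : 'I_p -> 'I_p -> R) (v w : vec p) :
  (forall i j, A i j = A j i) -> dotv v (mxapp A w) = dotv w (mxapp A v).
Proof.
move=> hA; rewrite /dotv /mxapp.
under eq_bigr do rewrite -rsumZ; rewrite exchange_big.
by apply: eq_bigr => i _; rewrite -rsumZ; apply: eq_bigr => j _; rewrite hA; ring.
Qed.

Lemma dotv_mxapp_bound (p : nat) (A : 'I_p -> 'I_p -> R) : exists K, 0 < K /\
  forall v, Rabs (dotv v (mxapp A v)) <= K * dotv v v.
Proof.
set F := \rsum_i \rsum_j (A i j * A i j).
have F0 : 0 <= F by apply: rsum_ge0 => i; apply: rsum_ge0 => j; exact: Rle_0_sqr.
exists (F + 1); split=> [|w]; first by lra.
have h1 := dotv_CS w (mxapp A w); have h2 := mxapp_sq_le A w; rewrite -/F in h2.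
have h3 := dotv_ge0 w; have h4 := dotv_ge0 (mxapp A w).
apply: Rsqr_incr_0_var; last by nra.
rewrite -Rsqr_abs /Rsqr; apply: (Rle_trans _ (dotv w w * (F * dotv w w))); nra.
Qed.

(* The largest [mu] with [A - mu] positive semidefinite makes [A - mu] singular:
   an invertible semidefinite matrix is coercive, so [mu] could be increased. *)
Lemma min_eig_coercive (p : nat) (A : 'I_p -> 'I_p -> R) (alpha : R) :
  (forall i j, A i j = A j i) -> min_eig_gt A alpha ->
  forall v, alpha * dotv v v <= dotv v (mxapp A v).
Proof.
move=> hA hal v.
have [K [K0 hK]] := dotv_mxapp_bound A.
case: (classic (exists i, v i <> 0)) => [[i0 vi0]|nv]; last first.
  have v0 i : v i = 0 by apply: NNPP => h; apply: nv; exists i.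
  by rewrite /dotv !rsum0 => [|i|i]; rewrite ?v0; lra.
pose E r := forall w : vec p, r * dotv w w <= dotv w (mxapp A w).
have vv := dotv_gt0 vi0.
have [mu [mu_ub mu_lub]] : {m | is_lub E m}.
  apply: completeness.
    exists (dotv v (mxapp A v) / dotv v v) => r /(_ v) hr.
    by apply: (Rmult_le_reg_r (dotv v v)) => //; rewrite /Rdiv Rmult_assoc Rinv_l; lra.
  by exists (- K) => w; have := hK w; have := Rle_abs (- dotv w (mxapp A w)); rewrite Rabs_Ropp; lra.
have hmu : E mu.
  move=> w; case: (classic (exists i, w i <> 0)) => [[i wi]|nw]; last first.
    have w0 i : w i = 0 by apply: NNPP => h; apply: nw; exists i.
    by rewrite /dotv !rsum0 => [|i|i]; rewrite ?w0; lra.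
  have ww := dotv_gt0 wi.
  have : mu <= dotv w (mxapp A w) / dotv w w.
    apply: mu_lub => r /(_ w) hr.
    by apply: (Rmult_le_reg_r (dotv w w)) => //; rewrite /Rdiv Rmult_assoc Rinv_l; lra.
  move/(Rmult_le_compat_r _ _ _ (Rlt_le _ _ ww)).
  by rewrite /Rdiv Rmult_assoc Rinv_l; lra.
pose P i j := A i j - mu * (if j == i then 1 else 0).
have PE w i : mxapp P w i = mxapp A w i - mu * w i.
  rewrite /mxapp /P -(rsum_delta (fun j => mu * w j) i) -rsumB.
  by apply: eq_bigr => j _; case: eqP => _; ring.
have PEq u w : dotv u (mxapp P w) = dotv u (mxapp A w) - mu * dotv u w.
  have -> : mxapp P w = fun i => 1 * mxapp A w i + (- mu) * w i.
    by apply: funext => i; rewrite PE; ring.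
  by rewrite dotv_lincomb; ring.
suff [w [w0 hw]] : exists w, (exists i, w i <> 0) /\ forall i, mxapp P w i = 0.
  have /hal : is_eigenvalue A mu.
    by exists w; split=> // i; change (mxapp A w i = mu * w i); have := hw i; rewrite PE; lra.
  by have := hmu v; nra.
case: (singular_or_invertible P) => // - [B [hB _]]; exfalso.
have Psym i j : P i j = P j i by rewrite /P hA eq_sym.
have Ppos w : 0 <= dotv w (mxapp P w) by rewrite PEq; have := hmu w; lra.
have [K' [K'0 hK']] := dotv_mxapp_bound P.
set F := \rsum_i \rsum_j (B i j * B i j).
have F0 : 0 <= F by apply: rsum_ge0 => i; apply: rsum_ge0 => j; exact: Rle_0_sqr.
(* Cauchy-Schwarz for the semidefinite form of [P] at [u = P w]: [|u|^4 <= (u, P u) (w, P w)], and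
   [(u, P u) <= K' |u|^2]. *)
have cP w : dotv (mxapp P w) (mxapp P w) <= K' * dotv w (mxapp P w).
  set u := mxapp P w.
  have : dotv u (mxapp P w) ^ 2 <= dotv u (mxapp P u) * dotv w (mxapp P w).
    apply: discriminant_le => s t.
    have := Ppos (fun i => s * u i + t * w i); set z := (fun i => s * u i + t * w i).
    have -> : mxapp P z = fun i => s * mxapp P u i + t * mxapp P w i.
      by apply: funext => i; rewrite mxapp_lincomb.
    rewrite dotv_lincomb !(dotv_comm z) !dotv_lincomb.
    rewrite (dotv_comm (mxapp P u) u) (dotv_comm (mxapp P u) w) (dotv_comm (mxapp P w) u).
    by rewrite (dotv_comm (mxapp P w) w) (mxapp_sym w u Psym); lra.
  rewrite -/u; have := hK' u; have := Rle_abs (dotv u (mxapp P u)).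
  have : 0 <= dotv w u := Ppos w; have : 0 <= dotv u u := dotv_ge0 u.
  move: (dotv u u) (dotv w u) (dotv u (mxapp P u)) => q m x.
  case=> [q0|<-] m0 h1 h2 h3; last by nra.
  apply: (Rmult_le_reg_l q) => //.
  have : x * m <= K' * q * m by apply: Rmult_le_compat_r; lra.
  by lra.
have cw w : dotv w w <= F * K' * dotv w (mxapp P w).
  have := mxapp_sq_le B (mxapp P w); rewrite hB -/F; have := cP w; nra.
have FK : 0 <= F * K' by nra.
(* The lower bound on [P] lets [mu] grow by this amount inside [E], against its choice as least
   upper bound. *)
have : E (mu + / (F * K' + 1)).
  move=> w; have := cw w; rewrite PEq => h.
  have g0 : 0 <= dotv w (mxapp A w) - mu * dotv w w by rewrite -PEq.
  have : dotv w w <= (F * K' + 1) * (dotv w (mxapp A w) - mu * dotv w w) by lra.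
  have iF : 0 < / (F * K' + 1) by apply: Rinv_0_lt_compat; lra.
  move/(Rmult_le_compat_l _ _ _ (Rlt_le _ _ iF)).
  by rewrite -Rmult_assoc Rinv_l; lra.
move/mu_ub; have : 0 < / (F * K' + 1) by apply: Rinv_0_lt_compat; lra.
by lra.
Qed.

(** * Euclidean norm and derivatives along segments *)

Lemma vnorm_ge0 p (v : vec p) : 0 <= vnorm v.
Proof. exact: sqrt_pos. Qed.

Lemma vnorm_sq p (v : vec p) : vnorm v * vnorm v = dotv v v.
Proof. exact: sqrt_sqrt (dotv_ge0 v). Qed.

Lemma vnorm_coord p (v : vec p) i : Rabs (v i) <= vnorm v.
Proof.
apply: Rsqr_incr_0_var; last exact: vnorm_ge0.
rewrite -Rsqr_abs [X in _ <= X]vnorm_sq.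
exact: (rsum_term i (fun j => Rle_0_sqr (v j))).
Qed.

Lemma vnorm_le p (v : vec p) r : 0 <= r -> (forall i, Rabs (v i) <= r) -> vnorm v <= INR p * r.
Proof.
move=> r0 h; have pr : 0 <= INR p * r by apply: Rmult_le_pos => //; exact: pos_INR.
apply: Rsqr_incr_0_var => //; rewrite [X in X <= _]vnorm_sq /Rsqr.
have : dotv v v <= INR p * (r * r).
  rewrite -[p in INR p]card_ord -rsum_const; apply: rsum_le => i.
  by have := h i; have := Rabs_pos (v i); rewrite -[v i * v i]/(Rsqr (v i)) (Rsqr_abs (v i)) /Rsqr; nra.
move/Rle_trans; apply.
have : INR p <= INR p * INR p.
  case: p {v h pr} => [|p]; first by rewrite /=; lra.
  have : 1 <= INR p.+1 by apply: (le_INR 1); apply/leP.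
  by nra.
by nra.
Qed.

Lemma vnormZ p (v : vec p) s : vnorm (fun i => s * v i) = Rabs s * vnorm v.
Proof.
rewrite -sqrt_Rsqr_abs /vnorm -sqrt_mult; [|exact: Rle_0_sqr|exact: dotv_ge0].
by rewrite -rsumZ /Rsqr; congr sqrt; apply: eq_bigr => i _; ring.
Qed.

Lemma dotvZ p s (u v : vec p) : dotv u (fun i => s * v i) = s * dotv u v.
Proof. by rewrite /dotv -rsumZ; apply: eq_bigr => j _; ring. Qed.

Definition move_along p (z v : vec p) (s : R) : vec p := fun i => z i + s * v i.

Lemma line_derivable p (g : vec p -> R) G S (z v : vec p) s :
  has_grad_on g G S -> S (move_along z v s) ->
  derivable_pt_lim (fun s => g (move_along z v s)) s (dotv (G (move_along z v s)) v).
Proof.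
move=> hg hS eps eps0; have n0 := vnorm_ge0 v.
have e0 : 0 < eps / (2 * (vnorm v + 1)) by apply: Rdiv_lt_0_compat; lra.
have [dl [dl0 h]] := hg _ hS _ e0.
have m0 : 0 < dl / (vnorm v + 1) by apply: Rdiv_lt_0_compat; lra.
exists (mkposreal _ m0) => k k0 /= hk.
have hk' : vnorm (fun i => k * v i) < dl.
  rewrite vnormZ; have -> : dl = dl / (vnorm v + 1) * (vnorm v + 1) by field; lra.
  by have := Rabs_pos k; nra.
have := h _ hk'; rewrite dotvZ vnormZ.
have -> : (fun i => move_along z v s i + k * v i) = move_along z v (s + k).
  by apply: funext => i; rewrite /move_along; ring.
set a := g _; set b := g _; set l := dotv _ _ => h1.
have k1 : 0 < Rabs k by apply: Rabs_pos_lt.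
have -> : (a - b) / k - l = (a - b - k * l) / k by field.
rewrite /Rdiv Rabs_mult Rabs_inv; apply: (Rmult_lt_reg_r (Rabs k)) => //.
rewrite Rmult_assoc Rinv_l; last by lra.
rewrite Rmult_1_r; apply: Rle_lt_trans h1 _.
have -> : eps / (2 * (vnorm v + 1)) * (Rabs k * vnorm v)
  = (eps * Rabs k) * (vnorm v / (2 * (vnorm v + 1))) by field; lra.
rewrite -[X in _ < X]Rmult_1_r; apply: Rmult_lt_compat_l; first by nra.
by apply: (Rmult_lt_reg_r (2 * (vnorm v + 1))); [lra|rewrite /Rdiv Rmult_assoc Rinv_l; lra].
Qed.

Lemma segment_MVT p (g : vec p -> R) G S (z v : vec p) b : 0 < b ->
  has_grad_on g G S -> (forall s, 0 <= s <= b -> S (move_along z v s)) ->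
  exists s, 0 < s < b /\ g (move_along z v b) - g z = b * dotv (G (move_along z v s)) v.
Proof.
move=> b0 hg hS.
have [s [h1 h2]] := MVT_cor2 (fun s => g (move_along z v s))
  (fun s => dotv (G (move_along z v s)) v) 0 b b0 (fun c hc => line_derivable hg (hS c hc)).
exists s; split=> //; move: h1.
have -> : move_along z v 0 = z by apply: funext => i; rewrite /move_along; ring.
by move=> ->; ring.
Qed.

Definition unit_vec p (a : 'I_p) : vec p := fun i => if i == a then 1 else 0.

Lemma dotv_unit p (u : vec p) a : dotv u (unit_vec a) = u a.
Proof.
rewrite -[RHS](rsum_delta u); apply: eq_bigr => i _.
by rewrite /unit_vec; case: eqP => _; ring.
Qed.

Lemma vnorm_unit p (a : 'I_p) : vnorm (unit_vec a) = 1.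
Proof.
by rewrite -sqrt_1 /vnorm; congr sqrt; rewrite -/(dotv _ _) dotv_unit /unit_vec eqxx.
Qed.

(** A crude form of the triangle inequality, obtained from coordinate bounds; its constant only
    enters the choice of radii. *)
Lemma vnormD_lt p (v w : vec p) r : vnorm v < r / (INR p + 1) / 2 -> vnorm w < r / (INR p + 1) / 2 ->
  vnorm (fun i => v i + w i) < r.
Proof.
move=> hv hw; have p0 := pos_INR p; have v0 := vnorm_ge0 v; have w0 := vnorm_ge0 w.
apply: (Rle_lt_trans _ (INR p * (vnorm v + vnorm w))).
  apply: vnorm_le; first by lra.
  move=> i; apply: Rle_trans (Rabs_triang _ _) _.
  by apply: Rplus_le_compat; exact: vnorm_coord.
have e : r = (r / (INR p + 1)) * (INR p + 1) by field; lra.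
have q : vnorm v + vnorm w < r / (INR p + 1) by lra.
rewrite [X in _ < X]e; nra.
Qed.

(** * Symmetry of second derivatives *)

Section Schwarz.
Variables (p : nat) (g : vec p -> R) (G : vec p -> vec p) (Hs : vec p -> 'I_p -> 'I_p -> R).
Variables (S : vec p -> Prop).
Hypothesis hg : has_grad_on g G S.
Hypothesis hG : forall k, has_grad_on (fun z => G z k) (fun z => Hs z k) S.

Let shift2 (z : vec p) (a b : 'I_p) s t := move_along (move_along z (unit_vec a) s) (unit_vec b) t.

(** Mean value theorem in direction [a] for the increment of [g] in direction [b], then in direction
    [b] for the partial derivative [G a]. *)
Lemma second_difference z a b h : 0 < h ->
  (forall s t, 0 <= s <= h -> 0 <= t <= h -> S (shift2 z a b s t)) ->
  exists s t, 0 < s < h /\ 0 < t < h /\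
    g (shift2 z a b h h) - g (shift2 z a b h 0) - (g (shift2 z a b 0 h) - g (shift2 z a b 0 0))
      = h * (h * Hs (shift2 z a b s t) a b).
Proof.
move=> h0 hS.
have shiftC s t : shift2 z a b s t = move_along (move_along z (unit_vec b) t) (unit_vec a) s.
  by apply: funext => i; rewrite /shift2 /move_along; ring.
have d t s : 0 <= t <= h -> 0 <= s <= h ->
    derivable_pt_lim (fun s => g (shift2 z a b s t)) s (G (shift2 z a b s t) a).
  move=> ht hs; rewrite -(dotv_unit _ a) shiftC.
  apply: (derivable_pt_lim_ext (fun s => g (move_along (move_along z (unit_vec b) t) (unit_vec a) s))).
    by move=> x; rewrite shiftC.
  by apply: line_derivable hg _; rewrite -shiftC; apply: hS.
have [s [e hs]] := MVT_cor2 (fun s => g (shift2 z a b s h) - g (shift2 z a b s 0))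
  (fun s => G (shift2 z a b s h) a - G (shift2 z a b s 0) a) 0 h h0
  (fun s hs => derivable_pt_lim_minus _ _ _ _ _ (d h s ltac:(lra) hs) (d 0 s ltac:(lra) hs)).
have [t [ht e2]] := segment_MVT h0 (hG a) (z := move_along z (unit_vec a) s) (v := unit_vec b)
  (fun t ht => hS s t ltac:(lra) ht).
exists s, t; split=> //; split=> //.
have -> : g (shift2 z a b h h) - g (shift2 z a b h 0) - (g (shift2 z a b 0 h) - g (shift2 z a b 0 0))
  = (G (shift2 z a b s h) a - G (shift2 z a b s 0) a) * (h - 0) by lra.
have -> : shift2 z a b s 0 = move_along z (unit_vec a) s.
  by apply: funext => i; rewrite /shift2 /move_along; ring.
have -> : G (shift2 z a b s h) a - G (move_along z (unit_vec a) s) a = h * Hs (shift2 z a b s t) a b.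
  by rewrite -(dotv_unit (Hs _ a)); exact: e2.
by ring.
Qed.

(** The mixed second difference is symmetric in [a] and [b]. It represents both mixed derivatives,
    each at some point within any prescribed distance of [z], and continuity closes the gap. *)
Lemma schwarz z a b : (exists r, 0 < r /\ forall w, vnorm (vsub w z) < r -> S w) ->
  (forall k l, cont_on (fun w => Hs w k l) S) -> S z -> Hs z a b = Hs z b a.
Proof.
move=> [r [r0 hr]] cH Sz; apply: cond_eq => eps eps0.
have [d1 [d10 h1]] := cH a b _ Sz (eps / 2) ltac:(lra).
have [d2 [d20 h2]] := cH b a _ Sz (eps / 2) ltac:(lra).
pose m := Rmin r (Rmin d1 d2).
have m0 : 0 < m by do !apply: Rmin_glb_lt.
have mr : m <= r := Rmin_l _ _.
have md1 : m <= d1 := Rle_trans _ _ _ (Rmin_r _ _) (Rmin_l _ _).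
have md2 : m <= d2 := Rle_trans _ _ _ (Rmin_r _ _) (Rmin_r _ _).
have p0 := pos_INR p.
pose h := m / (INR p + 1) / 2 / 2.
have h0 : 0 < h by do !apply: Rdiv_lt_0_compat; lra.
have hh : h < m / (INR p + 1) / 2 by rewrite /h in h0 *; lra.
have near c e s t : 0 <= s <= h -> 0 <= t <= h -> vnorm (vsub (shift2 z c e s t) z) < m.
  move=> hs ht.
  have -> : vsub (shift2 z c e s t) z = fun i => s * unit_vec c i + t * unit_vec e i.
    by apply: funext => i; rewrite /vsub /shift2 /move_along; ring.
  by apply: vnormD_lt; rewrite vnormZ vnorm_unit Rmult_1_r Rabs_pos_eq; lra.
have inS c e s t : 0 <= s <= h -> 0 <= t <= h -> S (shift2 z c e s t).
  by move=> hs ht; apply: hr; apply: Rlt_le_trans (near c e s t hs ht) mr.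
have [s [t [hs [ht e1]]]] := second_difference h0 (inS a b).
have [s' [t' [hs' [ht' e2]]]] := second_difference h0 (inS b a).
have sC x y : shift2 z b a x y = shift2 z a b y x.
  by apply: funext => i; rewrite /shift2 /move_along; ring.
have e : Hs (shift2 z a b s t) a b = Hs (shift2 z b a s' t') b a.
  rewrite !(sC h) !(sC 0) in e2.
  have : h * (h * Hs (shift2 z a b s t) a b) = h * (h * Hs (shift2 z b a s' t') b a) by lra.
  by do 2 move/Rmult_eq_reg_l => /(_ ltac:(lra)).
have n1 := h1 _ (inS a b s t ltac:(lra) ltac:(lra))
  (Rlt_le_trans _ _ _ (near a b s t ltac:(lra) ltac:(lra)) md1).
have n2 := h2 _ (inS b a s' t' ltac:(lra) ltac:(lra))
  (Rlt_le_trans _ _ _ (near b a s' t' ltac:(lra) ltac:(lra)) md2).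
have -> : Hs z a b - Hs z b a = - (Hs (shift2 z a b s t) a b - Hs z a b)
  + (Hs (shift2 z b a s' t') b a - Hs z b a) by rewrite e; ring.
by apply: Rle_lt_trans (Rabs_triang _ _) _; rewrite Rabs_Ropp; lra.
Qed.

End Schwarz.

(** * Sup-norm cubes, uniform continuity along curves, Taylor remainders *)

Lemma Rabs_bounds x r : Rabs x <= r -> - r <= x <= r.
Proof. by move=> h; have := Rle_abs x; have := Rle_abs (- x); rewrite Rabs_Ropp; lra. Qed.

Lemma common_radius (I : finType) (P : I -> R -> Prop) :
  (forall i e e', 0 < e' <= e -> P i e -> P i e') ->
  (forall i, exists e, 0 < e /\ P i e) -> exists e, 0 < e /\ forall i, P i e.
Proof.
move=> hP h; suff [e [e0 he]] : exists e, 0 < e /\ forall i, i \in enum I -> P i e.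
  by exists e; split=> // i; apply: he; rewrite mem_enum.
elim: (enum I) => [|i s [e [e0 he]]]; first by exists 1; split; [lra|].
have [e' [e'0 he']] := h i.
have m0 : 0 < Rmin e e' by apply: Rmin_glb_lt.
exists (Rmin e e'); split=> // j; rewrite inE => /orP[/eqP->|js].
  by apply: hP he'; split; [|exact: Rmin_r].
by apply: hP (he j js); split; [|exact: Rmin_l].
Qed.

(** Closed ball of the sup norm, the norm in which stability and the Newton iteration are
    formulated. *)
Definition cube p (c : vec p) (r : R) : vec p -> Prop := fun z => forall k, Rabs (z k - c k) <= r.

Lemma cube_center p (c : vec p) r : 0 <= r -> cube c r c.
Proof. by move=> r0 k; rewrite Rminus_diag Rabs_R0. Qed.

Lemma cube_le p (c : vec p) r r' z : r <= r' -> cube c r z -> cube c r' z.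
Proof. by move=> h hz k; apply: Rle_trans (hz k) h. Qed.

Lemma cube_trans p (a b z : vec p) r s : cube a r b -> cube b s z -> cube a (r + s) z.
Proof.
move=> h1 h2 k; have -> : z k - a k = (b k - a k) + (z k - b k) by ring.
by apply: Rle_trans (Rabs_triang _ _) _; have := h1 k; have := h2 k; lra.
Qed.

Lemma cube_segment p (c z v : vec p) r s : 0 <= s <= 1 ->
  cube c r z -> cube c r (move_along z v 1) -> cube c r (move_along z v s).
Proof.
move=> hs h0 h1 k; have := h0 k; have := h1 k; rewrite /move_along Rmult_1_l.
move=> /Rabs_bounds a /Rabs_bounds b; apply: Rabs_le; nra.
Qed.

Lemma cube_vnorm_lt p (c z : vec p) r d : 0 <= r -> r * (INR p + 1) < d -> cube c r z ->
  vnorm (vsub z c) < d.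
Proof.
move=> r0 hd hz; apply: Rle_lt_trans (vnorm_le r0 hz) _.
by have := pos_INR p; nra.
Qed.

Section Curve.
Variables (p : nat) (c : R -> vec p) (S : vec p -> Prop).
Hypothesis cc : forall k t, -1 <= t <= 1 -> cont_within (-1) 1 (fun s => c s k) t.

Lemma curve_cont t d : -1 <= t <= 1 -> 0 < d -> exists e, 0 < e /\
  forall s, -1 <= s <= 1 -> Rabs (s - t) < e -> cube (c t) d (c s).
Proof.
move=> ht d0.
have [e [e0 he]] := @common_radius 'I_p (fun k e => forall s, -1 <= s <= 1 -> Rabs (s - t) < e ->
  Rabs (c s k - c t k) <= d)
  (fun k e e' he h s hs st => h s hs (Rlt_le_trans _ _ _ st (proj2 he)))
  (fun k => match cc k ht d0 with ex_intro e (conj e0 he) =>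
     ex_intro _ e (conj e0 (fun s hs st => Rlt_le _ _ (he s hs st))) end).
by exists e; split=> // s hs st k; apply: he.
Qed.

Lemma cont_within_comp (g : vec p -> R) t : cont_on g S ->
  (forall t, -1 <= t <= 1 -> S (c t)) -> -1 <= t <= 1 -> cont_within (-1) 1 (fun s => g (c s)) t.
Proof.
move=> hg hS ht eps eps0; have [d [d0 hd]] := hg _ (hS t ht) _ eps0.
have p0 := pos_INR p.
have q0 : 0 < d / (INR p + 1) / 2 by do !apply: Rdiv_lt_0_compat; lra.
have [e [e0 he]] := curve_cont ht q0.
exists e; split=> // s hs st; apply: hd; first exact: hS.
apply: cube_vnorm_lt (he s hs st); first by lra.
have -> : d / (INR p + 1) / 2 * (INR p + 1) = d / 2 by field; lra.
by lra.
Qed.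

(** Heine's theorem around a compact curve: the radius is uniform in [t], while [z] ranges over
    points off the curve. Pointwise continuity gives a radius at each [t], and compactness of
    [[-1, 1]] a common one. *)
Lemma heine_curve (g : vec p -> R) r0 eps : cont_on g S -> 0 < r0 ->
  (forall t z, -1 <= t <= 1 -> cube (c t) r0 z -> S z) -> 0 < eps ->
  exists r, 0 < r /\ forall t z, -1 <= t <= 1 -> cube (c t) r z -> Rabs (g z - g (c t)) <= eps.
Proof.
move=> hg r00 hS eps0; have p0 := pos_INR p.
(* The gauge must be defined on all of [R]; outside [[-1, 1]] it takes the default value 1. *)
have loc t : exists d : posreal, -1 <= t <= 1 -> forall s z, -1 <= s <= 1 -> Rabs (s - t) < d ->
    cube (c s) d z -> Rabs (g z - g (c s)) <= eps.
  case: (classic (-1 <= t <= 1)) => [ht|]; last by exists (mkposreal 1 Rlt_0_1).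
  have Sc s : -1 <= s <= 1 -> S (c s) by move=> hs; apply: (hS s) => //; apply: cube_center; lra.
  have [d [d0 hd]] := hg _ (Sc t ht) (eps / 2) ltac:(lra).
  pose m := Rmin (d / (INR p + 1) / 4) r0.
  have m0 : 0 < m by apply: Rmin_glb_lt => //; do !apply: Rdiv_lt_0_compat; lra.
  have [e [e0 he]] := curve_cont ht m0.
  have me0 : 0 < Rmin m e by apply: Rmin_glb_lt.
  exists (mkposreal _ me0) => _ s z hs /= st hz.
  have hz' : cube (c s) m z by apply: cube_le hz; exact: Rmin_l.
  have hs' : cube (c t) m (c s) by apply: he => //; apply: Rlt_le_trans st (Rmin_r _ _).
  have hm : (m + m) * (INR p + 1) < d.
    have h1 : m <= d / (INR p + 1) / 4 := Rmin_l _ _.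
    have e1 : d = d / (INR p + 1) / 4 * (INR p + 1) * 4 by field; lra.
    by rewrite [X in _ < X]e1; nra.
  have mm : 0 <= m + m /\ m <= m + m by lra.
  have n1 := hd z (hS s z hs (cube_le (Rmin_r _ _) hz')) (cube_vnorm_lt (proj1 mm) hm (cube_trans hs' hz')).
  have n2 := hd (c s) (Sc s hs) (cube_vnorm_lt (proj1 mm) hm (cube_le (proj2 mm) hs')).
  have -> : g z - g (c s) = (g z - g (c t)) - (g (c s) - g (c t)) by ring.
  by apply: Rle_trans (Rabs_triang _ _) _; rewrite Rabs_Ropp; lra.
have [dl hdl] := choice _ loc.
(* Every [t] lies within [dl s] of some [s] with [d <= dl s]; this existence comes doubly negated,
   whence the classical step below. *)
have [d hd] := Compactness.compactness_value_1d (-1) 1 dl.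
exists d; split=> [|t z ht hz]; first by case: d {hd}.
apply: NNPP => ne; apply: (hd t ht) => -[s [hs [st ds]]]; apply: ne.
by apply: (hdl s hs) => //; apply: cube_le ds hz.
Qed.

End Curve.

Lemma rsum_abs_le (I : finType) (F G : I -> R) : (forall i, Rabs (F i) <= G i) ->
  Rabs (\rsum_i F i) <= \rsum_i G i.
Proof. by move=> h; apply: Rle_trans (rsum_abs _) _; apply: rsum_le. Qed.

(** The gradient on the segment is compared with a fixed vector [a], the gradient at the reference
    point, instead of the one at [y]; this is the remainder that a frozen derivative leaves. *)
Lemma frozen_linearization p (g : vec p -> R) G S (c z y a : vec p) r eps d :
  has_grad_on g G S -> (forall w, cube c r w -> S w) ->
  (forall w k, cube c r w -> Rabs (G w k - a k) <= eps) ->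
  cube c r z -> cube c r y -> (forall k, Rabs (z k - y k) <= d) ->
  Rabs (g z - g y - \rsum_k (a k * (z k - y k))) <= INR p * (eps * d).
Proof.
move=> hg hS heps hz hy hd.
set v := fun k => z k - y k.
have zE : z = move_along y v 1 by apply: funext => k; rewrite /move_along /v; ring.
have hseg s : 0 <= s <= 1 -> cube c r (move_along y v s).
  by move=> hs; apply: cube_segment => //; rewrite -zE.
have [s [hs e]] := segment_MVT Rlt_0_1 hg (fun s hs => hS _ (hseg s hs)).
rewrite -zE Rmult_1_l in e; rewrite e.
have -> : dotv (G (move_along y v s)) v - \rsum_k (a k * v k)
  = \rsum_k ((G (move_along y v s) k - a k) * v k).
  by rewrite -rsumB; apply: eq_bigr => k _; ring.
have -> : INR p * (eps * d) = \rsum_(k < p) (eps * d) by rewrite rsum_const card_ord.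
apply: rsum_abs_le => k.
rewrite Rabs_mult; apply: Rabs_mult_le; last exact: hd.
by apply: heps; apply: hseg; lra.
Qed.

(* Two applications of the mean value theorem: the first-order remainder is
   [s * v^T Hess v] at an intermediate point, with [0 < s]. *)
Lemma convex_remainder p (g : vec p -> R) G Hs S (c z y : vec p) r :
  has_grad_on g G S -> (forall k, has_grad_on (fun z => G z k) (fun z => Hs z k) S) ->
  (forall w, cube c r w -> S w) ->
  (forall w v, cube c r w -> (exists k, v k <> 0) -> 0 < dotv v (mxapp (Hs w) v)) ->
  cube c r z -> cube c r y -> z <> y ->
  0 < g z - g y - dotv (G y) (vsub z y).
Proof.
move=> hg hG hS hpos hz hy zy.
set v := vsub z y.
have zE : z = move_along y v 1 by apply: funext => k; rewrite /move_along /v /vsub; ring.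
have hseg s : 0 <= s <= 1 -> cube c r (move_along y v s).
  by move=> hs; apply: cube_segment => //; rewrite -zE.
have v0 : exists k, v k <> 0.
  apply: NNPP => h; apply: zy; apply: funext => k.
  by apply: NNPP => hk; apply: h; exists k; rewrite /v /vsub; lra.
have [s [hs e]] := segment_MVT Rlt_0_1 hg (fun s hs => hS _ (hseg s hs)).
rewrite -zE Rmult_1_l in e; rewrite e.
have dG u : 0 <= u <= s -> derivable_pt_lim (fun u => dotv (G (move_along y v u)) v) u
    (dotv v (mxapp (Hs (move_along y v u)) v)).
  move=> hu; rewrite dotv_comm /dotv.
  elim: (index_enum _) => [|k l IH].
    apply: (derivable_pt_lim_ext (fun=> 0)); first by move=> x; rewrite big_nil.
    by rewrite big_nil; exact: derivable_pt_lim_const.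
  apply: (derivable_pt_lim_ext (fun u => G (move_along y v u) k * v k
    + \big[Rplus/0]_(i <- l) (G (move_along y v u) i * v i))); first by move=> x; rewrite big_cons.
  rewrite big_cons; apply: derivable_pt_lim_plus IH.
  have h1 := line_derivable (hG k) (hS _ (hseg u ltac:(lra))).
  have := derivable_pt_lim_mult _ _ _ _ _ h1 (derivable_pt_lim_const (v k) u).
  by rewrite /fct_cte Rmult_0_r Rplus_0_r.
have [u [e2 hu]] := MVT_cor2 _ _ 0 s (proj1 hs) dG.
have y0 : move_along y v 0 = y by apply: funext => k; rewrite /move_along; ring.
rewrite y0 in e2; rewrite e2.
have := hpos (move_along y v u) v (hseg u ltac:(lra)) v0; nra.
Qed.

(** * Uniform stability of the linearised system *)

Lemma rsum_const_ord n c : \rsum_(i < n) c = INR n * c.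
Proof. by rewrite rsum_const card_ord. Qed.

Lemma rsum_exchange (I J : finType) (F : I -> J -> R) :
  \rsum_i \rsum_j F i j = \rsum_j \rsum_i F i j.
Proof. exact: exchange_big. Qed.

Lemma rsum_split n m (F : 'I_(n + m) -> R) :
  \rsum_(a < n + m) F a = \rsum_(k < n) F (lshift m k) + \rsum_(l < m) F (rshift n l).
Proof. exact: big_split_ord. Qed.

Lemma zjoin_lshift n m (x : vec n) (u : vec m) k : zjoin x u (lshift m k) = x k.
Proof. by rewrite /zjoin -[lshift m k]/(unsplit (inl k)) unsplitK. Qed.

Lemma zjoin_rshift n m (x : vec n) (u : vec m) l : zjoin x u (rshift n l) = u l.
Proof. by rewrite /zjoin -[rshift n l]/(unsplit (inr l)) unsplitK. Qed.

Definition supabs (I : finType) (F : I -> R) := \big[Rmax/0]_i Rabs (F i).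

Lemma bigRmax_ub (I : eqType) (s : seq I) (F : I -> R) i : i \in s -> F i <= \big[Rmax/0]_(j <- s) F j.
Proof.
elim: s => [//|j s IH]; rewrite inE big_cons => /orP[/eqP->|/IH h]; first exact: Rmax_l.
exact: Rle_trans h (Rmax_r _ _).
Qed.

Lemma supabs_ub (I : finType) (F : I -> R) i : Rabs (F i) <= supabs F.
Proof. exact: (bigRmax_ub (fun i => Rabs (F i)) (mem_index_enum i)). Qed.

Lemma supabs_lub (I : finType) (F : I -> R) c : 0 <= c -> (forall i, Rabs (F i) <= c) -> supabs F <= c.
Proof. by move=> c0 h; rewrite /supabs; elim/big_ind: _ => // x y; exact: Rmax_lub. Qed.

Lemma supabs_ge0 (I : finType) (F : I -> R) : 0 <= supabs F.
Proof.
rewrite /supabs; elim/big_ind: _ => [|x y hx hy|i _]; [lra| |exact: Rabs_pos].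
exact: Rle_trans hx (Rmax_l _ _).
Qed.

(** Cauchy-Schwarz for [b / sqrt w] and [sqrt w q]. The condition on [b] is (P2) or (P4) expressed
    for a row of the unscaled inverse. *)
Lemma weighted_row (I : finType) (w b q : I -> R) s : (forall i, 0 < w i) ->
  \rsum_i (b i * b i / w i) <= 2 -> 0 <= s -> 2 * \rsum_i (w i * (q i * q i)) <= s * s ->
  Rabs (\rsum_i (b i * q i)) <= s.
Proof.
move=> w0 hb s0 hs.
have sq i : sqrt (w i) * sqrt (w i) = w i by apply: sqrt_sqrt; apply: Rlt_le.
have sp i : 0 < sqrt (w i) by apply: sqrt_lt_R0.
have -> : \rsum_i (b i * q i) = \rsum_i (b i / sqrt (w i) * (sqrt (w i) * q i)).
  by apply: eq_bigr => i _; field; have := sp i; lra.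
have h := rsum_CS (fun i => b i / sqrt (w i)) (fun i => sqrt (w i) * q i).
have e1 : \rsum_i (b i / sqrt (w i) * (b i / sqrt (w i))) = \rsum_i (b i * b i / w i).
  by apply: eq_bigr => i _; move: (sq i) (sp i); move: (sqrt (w i)) => r <- r0; field; lra.
have e2 : \rsum_i (sqrt (w i) * q i * (sqrt (w i) * q i)) = \rsum_i (w i * (q i * q i)).
  by apply: eq_bigr => i _; move: (sq i); move: (sqrt (w i)) => r <-; ring.
rewrite e1 e2 in h; apply: Rsqr_incr_0_var => //; rewrite -Rsqr_abs /Rsqr.
have q0 : 0 <= \rsum_i (w i * (q i * q i)).
  by apply: rsum_ge0 => i; apply: Rmult_le_pos; [exact: Rlt_le|exact: Rle_0_sqr].
by nra.
Qed.

Lemma row_bound (I : finType) (b q : I -> R) c s : 0 <= s -> \rsum_i Rabs (b i) <= c ->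
  (forall i, Rabs (q i) <= s) -> Rabs (\rsum_i (b i * q i)) <= c * s.
Proof.
move=> s0 hb hq; apply: Rle_trans (Rmult_le_compat_r _ _ _ s0 hb).
rewrite -rsumZr; apply: rsum_abs_le => i.
by rewrite Rabs_mult; apply: Rmult_le_compat_l => //; exact: Rabs_pos.
Qed.

Lemma row_bound_entries p (b q : 'I_p -> R) K s : (forall i, Rabs (b i) <= K) ->
  (forall i, Rabs (q i) <= s) -> Rabs (\rsum_i (b i * q i)) <= INR p * K * s.
Proof.
move=> hb hq.
have -> : INR p * K * s = \rsum_(i < p) (K * s) by rewrite rsum_const_ord; ring.
apply: rsum_abs_le => i.
by rewrite Rabs_mult; exact: Rabs_mult_le.
Qed.

Section Stability.
Variables (n m : nat) (K alpha : R).
Hypotheses (K0 : 0 <= K) (alpha0 : 0 < alpha).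
Let a := INR n.
Let b := INR m.

(* With [u] the weighted L2 norm of the control and [e] the bound on the data, these are
   the constants in [|X| <= state_const (u + e)], [|Lam| <= costate_const (u + e)],
   [alpha u^2 <= energy_const e (u + e)], [u <= weighted_control_const e] and
   [|U| <= control_const e], where [|.|] is the sup norm. *)
Definition state_const := 4 * (b + 1) * K + 2.
Definition costate_const := 6 * a * K * state_const + 4 * (b + 1) * K + 2.
Definition energy_const :=
  a * (3 * a * K * state_const + 4 * b * K + costate_const + state_const) + 2 * b.
Definition weighted_control_const := 1 + 2 * energy_const / alpha.
Definition control_const :=
  b * (1 + a * K * (state_const + costate_const) * (weighted_control_const + 1)) / alpha.
Definition stability_const :=
  (state_const + costate_const) * (weighted_control_const + 1) + control_const + 1.

Variables (N : nat) (w : 'I_N.+1 -> R) (B Bd : 'I_N.+1 -> 'I_N.+1 -> R).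
Hypothesis w0 : forall i, 0 < w i.
Hypothesis w2 : \rsum_i w i = 2.
Hypothesis B1 : forall i, \rsum_j Rabs (B i j) <= 2.
Hypothesis Bd1 : forall i, \rsum_j Rabs (Bd i j) <= 2.
Hypothesis B2 : forall i, \rsum_j (B i j * B i j / w j) <= 2.
Hypothesis Bd2 : forall i, \rsum_j (Bd i j * Bd i j / w j) <= 2.
Hypothesis BdE : forall i j, w i * Bd i j = - (w j * B j i).
Hypothesis Blast : forall j, B ord_max j = w j.

Variables (J : 'I_N.+1 -> 'I_n -> 'I_(n + m) -> R) (Hh : 'I_N.+1 -> 'I_(n + m) -> 'I_(n + m) -> R).
Variable V : 'I_n -> 'I_n -> R.
Hypothesis JK : forall i k c, Rabs (J i k c) <= K.
Hypothesis HK : forall i c d, Rabs (Hh i c d) <= K.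
Hypothesis VK : forall k l, Rabs (V k l) <= K.
Hypothesis Jrow : forall i k, \rsum_l Rabs (J i k (lshift m l)) <= 1 / 4.
Hypothesis Jcol : forall i l, \rsum_k Rabs (J i k (lshift m l)) <= 1 / 4.
Hypothesis Hpos : forall i z, alpha * dotv z z <= dotv z (mxapp (Hh i) z).
Hypothesis Vpos : forall z, 0 <= dotv z (mxapp V z).

Variables (X : 'I_N.+1 -> vec n) (U : 'I_N.+1 -> vec m) (Lam : 'I_N.+1 -> vec n).
(** [y] and [g] are the linearisations of [f] and of the gradient of [H]. The data of the linear
    system are [p] for the state, [q] for the costate, and the control components of [g] for
    stationarity. *)
Let Z i := zjoin (X i) (U i).
Let y i := mxapp (J i) (Z i).
Let g i c := mxapp (Hh i) (Z i) c + \rsum_k (Lam i k * J i k c).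
Let p i k := X i k - \rsum_j (B i j * y j k).
Let q i k := Lam i k - mxapp V (X ord_max) k + \rsum_j (Bd i j * g j (lshift m k)).
Variable e : R.
Hypothesis e0 : 0 <= e.
Hypothesis pe : forall i k, Rabs (p i k) <= e.
Hypothesis qe : forall i k, Rabs (q i k) <= e.
Hypothesis ge : forall i l, Rabs (g i (rshift n l)) <= e.

Let x := supabs (fun ik : 'I_N.+1 * 'I_n => X ik.1 ik.2).
Let l := supabs (fun ik : 'I_N.+1 * 'I_n => Lam ik.1 ik.2).
Let u2 := \rsum_i \rsum_(l < m) (w i * (U i l * U i l)).
Let u := sqrt u2.

Let a0 : 0 <= a. Proof. exact: pos_INR. Qed.
Let b0 : 0 <= b. Proof. exact: pos_INR. Qed.
Let x0 : 0 <= x. Proof. exact: supabs_ge0. Qed.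
Let l0 : 0 <= l. Proof. exact: supabs_ge0. Qed.
Let xub i k : Rabs (X i k) <= x. Proof. exact: (supabs_ub (fun ik => X ik.1 ik.2) (i, k)). Qed.
Let lub i k : Rabs (Lam i k) <= l. Proof. exact: (supabs_ub (fun ik => Lam ik.1 ik.2) (i, k)). Qed.
Let u20 : 0 <= u2.
Proof.
apply: rsum_ge0 => i; apply: rsum_ge0 => c.
by apply: Rmult_le_pos; [exact: Rlt_le|exact: Rle_0_sqr].
Qed.
Let u0 : 0 <= u. Proof. exact: sqrt_pos. Qed.
Let uu : u * u = u2. Proof. exact: sqrt_sqrt. Qed.

(** Influence of the control on state and costate, measured in L2: pointwise
    [|C_j U_j|^2 <= b K^2 |U_j|^2], then [weighted_row]. *)
Let control_row (C : 'I_N.+1 -> 'I_m -> R) (r : 'I_N.+1 -> R) :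
  (forall i c, Rabs (C i c) <= K) -> \rsum_j (r j * r j / w j) <= 2 ->
  Rabs (\rsum_j (r j * \rsum_c (C j c * U j c))) <= 2 * (b + 1) * K * u.
Proof.
move=> hC hr; apply: weighted_row hr _ _ => //; first by apply: Rmult_le_pos => //; nra.
have h j : w j * ((\rsum_c (C j c * U j c)) * (\rsum_c (C j c * U j c)))
    <= b * (K * K) * \rsum_c (w j * (U j c * U j c)).
  have h1 := rsum_CS (C j) (U j).
  have h2 : \rsum_c (C j c * C j c) <= b * (K * K).
    rewrite /b -rsum_const_ord; apply: rsum_le => c.
    have := hC j c; have := Rabs_pos (C j c).
    by rewrite -[C j c * C j c]/(Rsqr (C j c)) (Rsqr_abs (C j c)) /Rsqr; nra.
  have h3 : 0 <= \rsum_c (U j c * U j c) by apply: rsum_ge0 => c; exact: Rle_0_sqr.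
  rewrite rsumZ; have := w0 j; move: h1 h2 h3.
  move: (\rsum_c (C j c * U j c)) (\rsum_c (C j c * C j c)) (\rsum_c (U j c * U j c)) => s1 s2 s3.
  move=> h1 h2 h3 wj; have : s1 * s1 <= b * (K * K) * s3 by nra.
  by nra.
apply: (Rle_trans _ (2 * (b * (K * K) * u2))).
  apply: Rmult_le_compat_l; first by lra.
  by rewrite /u2 -rsumZ; apply: rsum_le.
rewrite -uu.
have -> : 2 * (b * (K * K) * (u * u)) = (2 * b) * (K * K * (u * u)) by ring.
have -> : 2 * (b + 1) * K * u * (2 * (b + 1) * K * u)
  = (4 * (b + 1) * (b + 1)) * (K * K * (u * u)) by ring.
apply: Rmult_le_compat_r; last by nra.
by apply: Rmult_le_pos; exact: Rle_0_sqr.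
Qed.

(** The state feeds back with factor [2 * 1/4] from [B1] and [Jrow]; the resulting half of [x] is
    absorbed on the left. *)
Let state_bound : x <= state_const * (u + e).
Proof.
suff h : x <= 1 / 2 * x + 2 * (b + 1) * K * u + e.
  have : 0 <= (b + 1) * K by nra.
  by rewrite /state_const; nra.
have bK : 0 <= 2 * (b + 1) * K * u by apply: Rmult_le_pos => //; nra.
apply: supabs_lub; first by lra.
case=> i k /=.
have -> : X i k = \rsum_j (B i j * \rsum_(l < n) (J j k (lshift m l) * X j l))
  + \rsum_j (B i j * \rsum_(l < m) (J j k (rshift n l) * U j l)) + p i k.
  suff e1 : \rsum_j (B i j * y j k) = \rsum_j (B i j * \rsum_(l < n) (J j k (lshift m l) * X j l))
      + \rsum_j (B i j * \rsum_(l < m) (J j k (rshift n l) * U j l)).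
    by rewrite /p e1; ring.
  rewrite -rsumD; apply: eq_bigr => j _.
  rewrite -Rmult_plus_distr_l /y /mxapp rsum_split; congr (_ * (_ + _)).
    by apply: eq_bigr => c _; rewrite /Z zjoin_lshift.
  by apply: eq_bigr => c _; rewrite /Z zjoin_rshift.
apply: Rabs_add_le => //.
apply: Rabs_add_le; last first.
  by apply: (control_row (C := fun j l => J j k (rshift n l))).
have -> : 1 / 2 * x = 2 * (1 / 4 * x) by field.
apply: row_bound => //; first by lra.
by move=> j; apply: row_bound => // c; exact: xub.
Qed.

(** The same absorption with [Bd1] and the column sums of the Jacobian. Of [3 a K x], one part comes
    from the terminal Hessian [V], two from the state block of [Hh]. *)
Let costate_bound : l <= costate_const * (u + e).
Proof.
suff h : l <= 1 / 2 * l + 3 * a * K * x + 2 * (b + 1) * K * u + e.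
  have bK : 0 <= (b + 1) * K by nra.
  have aK : 0 <= a * K by nra.
  have : a * K * x <= a * K * (state_const * (u + e)) by apply: Rmult_le_compat_l.
  by rewrite /costate_const; nra.
have bK : 0 <= 2 * (b + 1) * K * u by apply: Rmult_le_pos => //; nra.
have aKx : 0 <= a * K * x by apply: Rmult_le_pos => //; nra.
apply: supabs_lub; first by lra.
case=> i k /=.
have -> : Lam i k = - (\rsum_j (Bd i j * \rsum_k' (J j k' (lshift m k) * Lam j k')))
  + mxapp V (X ord_max) k
  + - (\rsum_j (Bd i j * \rsum_l (Hh j (lshift m k) (lshift m l) * X j l)))
  + - (\rsum_j (Bd i j * \rsum_l (Hh j (lshift m k) (rshift n l) * U j l))) + q i k.
  suff e1 : \rsum_j (Bd i j * g j (lshift m k)) =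
      \rsum_j (Bd i j * \rsum_k' (J j k' (lshift m k) * Lam j k'))
      + (\rsum_j (Bd i j * \rsum_l (Hh j (lshift m k) (lshift m l) * X j l))
      + \rsum_j (Bd i j * \rsum_l (Hh j (lshift m k) (rshift n l) * U j l))).
    by rewrite /q e1; ring.
  rewrite -!rsumD; apply: eq_bigr => j _.
  rewrite -!Rmult_plus_distr_l /g /mxapp rsum_split Rplus_comm; congr (_ * (_ + (_ + _))).
  - by apply: eq_bigr => c _; rewrite Rmult_comm.
  - by apply: eq_bigr => c _; rewrite /Z zjoin_lshift.
  - by apply: eq_bigr => c _; rewrite /Z zjoin_rshift.
apply: Rabs_add_le => //.
apply: Rabs_add_le; last first.
  by rewrite Rabs_Ropp; apply: (control_row (C := fun j l => Hh j (lshift m k) (rshift n l))).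
have -> : 1 / 2 * l + 3 * a * K * x = 2 * (1 / 4 * l) + a * K * x + 2 * (a * K * x) by field.
apply: Rabs_add_le; last first.
  by rewrite Rabs_Ropp; apply: row_bound => // j; apply: row_bound_entries => // c; exact: xub.
apply: Rabs_add_le; last first.
  by apply: row_bound_entries => // c; exact: xub.
rewrite Rabs_Ropp; apply: row_bound => //; first by lra.
by move=> j; apply: row_bound => // c; exact: lub.
Qed.

Let su i := \rsum_c Rabs (U i c).

(** The weights themselves form an admissible row in [weighted_row], because they add up to 2. *)
Let weighted_abs c : \rsum_i (w i * Rabs (U i c)) <= 2 * u.
Proof.
apply: Rle_trans (Rle_abs _) _; apply: (weighted_row w0) => //.
- rewrite (eq_bigr w) => [|i _]; first by rewrite w2; lra.
  by field; have := w0 i; lra.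
- by lra.
have : \rsum_i (w i * (Rabs (U i c) * Rabs (U i c))) <= u2; last by have := uu; nra.
apply: rsum_le => i; rewrite -Rabs_mult Rabs_pos_eq; last exact: Rle_0_sqr.
apply: (rsum_term c (F := fun c => w i * (U i c * U i c))) => c'.
by apply: Rmult_le_pos; [exact: Rlt_le|exact: Rle_0_sqr].
Qed.

Let weighted_su : \rsum_i (w i * su i) <= 2 * b * u.
Proof.
have -> : \rsum_i (w i * su i) = \rsum_c \rsum_i (w i * Rabs (U i c)).
  by rewrite exchange_big; apply: eq_bigr => i _; rewrite rsumZ.
have -> : 2 * b * u = \rsum_(c < m) (2 * u) by rewrite rsum_const_ord -/b; ring.
by apply: rsum_le => c; exact: weighted_abs.
Qed.

Let control_abs (r : 'I_m -> R) i : (forall c, Rabs (r c) <= K) ->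
  Rabs (\rsum_c (r c * U i c)) <= K * su i.
Proof.
move=> hr; rewrite /su -rsumZ; apply: rsum_abs_le => c.
by rewrite Rabs_mult; apply: Rmult_le_compat_r => //; exact: Rabs_pos.
Qed.

Let g_bound i k : Rabs (g i (lshift m k)) <= a * K * x + K * su i + 1 / 4 * l.
Proof.
apply: Rabs_add_le; last first.
  rewrite (eq_bigr (fun k' => J i k' (lshift m k) * Lam i k')) => [|k' _]; last exact: Rmult_comm.
  by apply: row_bound => // c; exact: lub.
rewrite /mxapp rsum_split; apply: Rabs_add_le.
  by apply: row_bound_entries => // c; rewrite /Z zjoin_lshift.
rewrite (eq_bigr (fun c => Hh i (lshift m k) (rshift n c) * U i c)) => [|c _].
  exact: control_abs.
by rewrite /Z zjoin_rshift.
Qed.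

Let y_bound i k : Rabs (y i k) <= 1 / 4 * x + K * su i.
Proof.
rewrite /y /mxapp rsum_split; apply: Rabs_add_le.
  by apply: row_bound => // c; rewrite /Z zjoin_lshift.
rewrite (eq_bigr (fun c => J i k (rshift n c) * U i c)) => [|c _].
  exact: control_abs.
by rewrite /Z zjoin_rshift.
Qed.

Let weighted_bound (F : 'I_N.+1 -> R) s : (forall i, Rabs (F i) <= s + K * su i) ->
  \rsum_i (w i * Rabs (F i)) <= 2 * s + 2 * b * K * u.
Proof.
move=> hF; apply: (Rle_trans _ (\rsum_i (w i * s + K * (w i * su i)))).
  by apply: rsum_le => i; have := hF i; have := w0 i; nra.
by rewrite rsumD rsumZr rsumZ w2; have := weighted_su; nra.
Qed.

(** By [BdE], [- Bd] is the adjoint of [B] in the inner product weighted by [w]. *)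
Let adjoint (s t : 'I_N.+1 -> R) :
  \rsum_i (w i * (\rsum_j (B i j * s j)) * t i) = - \rsum_i (w i * s i * \rsum_j (Bd i j * t j)).
Proof.
rewrite -rsumN.
have -> : \rsum_i (w i * (\rsum_j (B i j * s j)) * t i) = \rsum_i \rsum_j (w i * B i j * s j * t i).
  by apply: eq_bigr => i _; rewrite -rsumZ -rsumZr; apply: eq_bigr => j _; ring.
rewrite exchange_big; apply: eq_bigr => i _.
rewrite -rsumZ -rsumN; apply: eq_bigr => j _.
have -> : - (w i * s i * (Bd i j * t j)) = - (w i * Bd i j) * s i * t j by ring.
by rewrite BdE; ring.
Qed.

(** With [X = p + B y] and [Lam = q + V X_N - Bd g] inserted, the terms in [B] and [Bd] cancel by
    adjointness. [Blast] identifies [sum_i w_i y_i] with the terminal value of [B y], which leaves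
    the form of [V]. *)
Let energy_coord k :
  \rsum_i (w i * X i k * g i (lshift m k)) - \rsum_i (w i * Lam i k * y i k)
  = \rsum_i (w i * p i k * g i (lshift m k)) - \rsum_i (w i * q i k * y i k)
    - mxapp V (X ord_max) k * (X ord_max k - p ord_max k).
Proof.
have -> : \rsum_i (w i * X i k * g i (lshift m k)) = \rsum_i (w i * p i k * g i (lshift m k))
    + \rsum_i (w i * (\rsum_j (B i j * y j k)) * g i (lshift m k)).
  by rewrite -rsumD; apply: eq_bigr => i _; rewrite /p; ring.
have -> : \rsum_i (w i * Lam i k * y i k) = \rsum_i (w i * q i k * y i k)
    + mxapp V (X ord_max) k * (\rsum_i (w i * y i k))
    - \rsum_i (w i * y i k * \rsum_j (Bd i j * g j (lshift m k))).
  by rewrite -rsumZ -rsumD -rsumB; apply: eq_bigr => i _; rewrite /q; ring.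
have -> : \rsum_i (w i * y i k) = X ord_max k - p ord_max k.
  rewrite /p; have -> : \rsum_j (B ord_max j * y j k) = \rsum_i (w i * y i k).
    by apply: eq_bigr => j _; rewrite Blast.
  by ring.
by rewrite adjoint; ring.
Qed.

(** Pairing [g] with [Z] and [y] with [Lam] cancels the Jacobian terms. What remains are the two
    quadratic forms on one side and products containing a datum on the other. *)
Let energy : \rsum_i (w i * dotv (Z i) (mxapp (Hh i) (Z i))) + dotv (X ord_max) (mxapp V (X ord_max))
  = \rsum_k (\rsum_i (w i * p i k * g i (lshift m k)) - \rsum_i (w i * q i k * y i k)
      + mxapp V (X ord_max) k * p ord_max k)
    + \rsum_(c < m) \rsum_i (w i * U i c * g i (rshift n c)).
Proof.
have e1 i : dotv (Z i) (mxapp (Hh i) (Z i)) = \rsum_k (X i k * g i (lshift m k))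
    - \rsum_k (Lam i k * y i k) + \rsum_(c < m) (U i c * g i (rshift n c)).
  have e2 : \rsum_k (Lam i k * y i k) = \rsum_c (Z i c * \rsum_k (Lam i k * J i k c)).
    rewrite /y /mxapp.
    have -> : \rsum_k (Lam i k * \rsum_j (J i k j * Z i j)) = \rsum_k \rsum_j (Lam i k * (J i k j * Z i j)).
      by apply: eq_bigr => k _; rewrite rsumZ.
    rewrite exchange_big; apply: eq_bigr => c _; rewrite -rsumZ.
    by apply: eq_bigr => k _; ring.
  have e3 : \rsum_c (Z i c * g i c) = \rsum_k (X i k * g i (lshift m k))
      + \rsum_(c < m) (U i c * g i (rshift n c)).
    rewrite rsum_split; congr (_ + _); apply: eq_bigr => c _; by rewrite /Z ?zjoin_lshift ?zjoin_rshift.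
  have -> : \rsum_k (X i k * g i (lshift m k)) - \rsum_k (Lam i k * y i k)
    + \rsum_(c < m) (U i c * g i (rshift n c)) = \rsum_c (Z i c * g i c) - \rsum_k (Lam i k * y i k).
    by rewrite e3; ring.
  by rewrite e2 -rsumB; apply: eq_bigr => c _; rewrite /g; ring.
have -> : \rsum_i (w i * dotv (Z i) (mxapp (Hh i) (Z i))) =
    \rsum_k (\rsum_i (w i * X i k * g i (lshift m k)) - \rsum_i (w i * Lam i k * y i k))
    + \rsum_(c < m) \rsum_i (w i * U i c * g i (rshift n c)).
  rewrite rsumB (rsum_exchange (fun k i => w i * X i k * g i (lshift m k))).
  rewrite (rsum_exchange (fun k i => w i * Lam i k * y i k)).
  rewrite (rsum_exchange (fun c i => w i * U i c * g i (rshift n c))) /= -rsumB -rsumD.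
  apply: eq_bigr => i _; rewrite e1 Rmult_plus_distr_l Rmult_minus_distr_l -!rsumZ.
  by congr (_ - _ + _); apply: eq_bigr => c _; ring.
have -> : \rsum_k (\rsum_i (w i * p i k * g i (lshift m k)) - \rsum_i (w i * q i k * y i k)
      + mxapp V (X ord_max) k * p ord_max k)
    = \rsum_k (\rsum_i (w i * X i k * g i (lshift m k)) - \rsum_i (w i * Lam i k * y i k))
    + dotv (X ord_max) (mxapp V (X ord_max)).
  by rewrite /dotv -rsumD; apply: eq_bigr => k _; rewrite energy_coord; ring.
by ring.
Qed.

Let state_const0 : 0 <= state_const.
Proof.
have h : 0 <= (b + 1) * K by nra.
by rewrite /state_const; lra.
Qed.

Let costate_const0 : 0 <= costate_const.
Proof.
have h1 : 0 <= a * K * state_const by apply: Rmult_le_pos => //; nra.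
have h2 : 0 <= (b + 1) * K by nra.
by rewrite /costate_const; lra.
Qed.

Let energy_const0 : 0 <= energy_const.
Proof.
have h1 : 0 <= a * K * state_const by apply: Rmult_le_pos => //; nra.
have h2 : 0 <= b * K by nra.
rewrite /energy_const; apply: Rplus_le_le_0_compat; last by lra.
by apply: Rmult_le_pos => //; lra.
Qed.

Let weighted_pairing (s t : 'I_N.+1 -> R) c : (forall i, Rabs (s i) <= e) ->
  \rsum_i (w i * Rabs (t i)) <= c -> Rabs (\rsum_i (w i * s i * t i)) <= e * c.
Proof.
move=> hs ht; apply: Rle_trans (Rmult_le_compat_l _ _ _ e0 ht).
rewrite -rsumZ; apply: rsum_abs_le => i.
rewrite !Rabs_mult (Rabs_pos_eq (w i)); last exact: Rlt_le.
have -> : e * (w i * Rabs (t i)) = w i * Rabs (t i) * e by ring.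
have -> : w i * Rabs (s i) * Rabs (t i) = w i * Rabs (t i) * Rabs (s i) by ring.
by apply: Rmult_le_compat_l => //; apply: Rmult_le_pos; [exact: Rlt_le|exact: Rabs_pos].
Qed.

(** Every term on the right of [energy] has one factor bounded by [e]; the other factor is at most a
    multiple of [u + e] by the state and costate bounds. *)
Let energy_bound : alpha * (u * u) <= energy_const * e * (u + e).
Proof.
apply: (Rle_trans _ (\rsum_i (w i * dotv (Z i) (mxapp (Hh i) (Z i)))
    + dotv (X ord_max) (mxapp V (X ord_max)))).
  have : alpha * (u * u) <= \rsum_i (w i * dotv (Z i) (mxapp (Hh i) (Z i))).
    rewrite uu /u2 -rsumZ; apply: rsum_le => i.
    have -> : alpha * \rsum_(c < m) (w i * (U i c * U i c)) = w i * (alpha * \rsum_(c < m) (U i c * U i c)).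
      by rewrite -!rsumZ; apply: eq_bigr => c _; ring.
    apply: Rmult_le_compat_l; first exact: Rlt_le.
    apply: Rle_trans (Hpos i (Z i)); apply: Rmult_le_compat_l; first by lra.
    rewrite /dotv rsum_split.
    rewrite -[X in X <= _]Rplus_0_l; apply: Rplus_le_compat.
      by apply: rsum_ge0 => k; exact: Rle_0_sqr.
    by apply: Req_le; apply: eq_bigr => c _; rewrite /Z zjoin_rshift.
  by have := Vpos (X ord_max); lra.
rewrite energy.
have h1 k : Rabs (\rsum_i (w i * p i k * g i (lshift m k)) - \rsum_i (w i * q i k * y i k)
      + mxapp V (X ord_max) k * p ord_max k)
    <= e * (3 * (a * K * x) + 4 * (b * K * u) + l + x).
  apply: Rle_trans (Rabs_triang _ _) _.
  have t1 : Rabs (\rsum_i (w i * p i k * g i (lshift m k)))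
      <= e * (2 * (a * K * x + 1 / 4 * l) + 2 * b * K * u).
    apply: weighted_pairing => //; apply: weighted_bound => i.
    by have := g_bound i k; lra.
  have t2 : Rabs (\rsum_i (w i * q i k * y i k)) <= e * (2 * (1 / 4 * x) + 2 * b * K * u).
    by apply: weighted_pairing => //; apply: weighted_bound.
  have t3 : Rabs (mxapp V (X ord_max) k * p ord_max k) <= e * (a * K * x).
    rewrite Rabs_mult Rmult_comm; apply: Rabs_mult_le => //.
    by apply: row_bound_entries => // c; exact: xub.
  have := Rabs_triang (\rsum_i (w i * p i k * g i (lshift m k))) (- \rsum_i (w i * q i k * y i k)).
  rewrite Rabs_Ropp -/(Rminus _ _).
  have : 0 <= e * l by nra.
  have : 0 <= e * x by nra.
  by lra.
have h2 c : Rabs (\rsum_i (w i * U i c * g i (rshift n c))) <= e * (2 * u).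
  rewrite (eq_bigr (fun i => w i * g i (rshift n c) * U i c)) => [|i _]; last by ring.
  by apply: weighted_pairing => //; exact: weighted_abs.
apply: (Rle_trans _ (a * (e * (3 * (a * K * x) + 4 * (b * K * u) + l + x)) + b * (e * (2 * u)))).
  apply: Rplus_le_compat.
    apply: Rle_trans (rsum_le (fun c => Rle_trans _ _ _ (Rle_abs _) (h1 c))) _.
    by rewrite rsum_const_ord -/a; lra.
  apply: Rle_trans (rsum_le (fun c => Rle_trans _ _ _ (Rle_abs _) (h2 c))) _.
  by rewrite rsum_const_ord -/b; lra.
have aK : 0 <= a * K by nra.
have bK : 0 <= b * K by nra.
have k1 : a * K * x <= a * K * (state_const * (u + e)) by apply: Rmult_le_compat_l.
have k2 : b * K * u <= b * K * (u + e) by apply: Rmult_le_compat_l; lra.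
have k3 : b * u <= b * (u + e) by apply: Rmult_le_compat_l; lra.
have -> : energy_const * e * (u + e) = e * (a * (3 * (a * K * (state_const * (u + e)))
    + 4 * (b * K * (u + e)) + costate_const * (u + e) + state_const * (u + e)) + 2 * (b * (u + e))).
  by rewrite /energy_const; ring.
have -> : a * (e * (3 * (a * K * x) + 4 * (b * K * u) + l + x)) + b * (e * (2 * u))
  = e * (a * (3 * (a * K * x) + 4 * (b * K * u) + l + x) + 2 * (b * u)) by ring.
apply: Rmult_le_compat_l => //; apply: Rplus_le_compat; last by lra.
by apply: Rmult_le_compat_l => //; have := state_bound; have := costate_bound; lra.
Qed.

Let weighted_control_bound : u <= weighted_control_const * e.
Proof.
have q0 : 0 <= 2 * energy_const / alpha.
  by apply: Rdiv_ge0 => //; lra.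
(* If [u > e], then [u + e <= 2 u] and the energy bound can be divided by [u]. *)
case: (Rle_lt_dec u e) => ue; first by rewrite /weighted_control_const; nra.
have u1 : 0 < u by lra.
have h : alpha * (u * u) <= energy_const * e * (2 * u).
  apply: Rle_trans energy_bound _; apply: Rmult_le_compat_l; last by lra.
  by apply: Rmult_le_pos.
have h2 : alpha * u <= 2 * energy_const * e.
  by apply: (Rmult_le_reg_r u) => //; lra.
have -> : weighted_control_const * e = e + (2 * energy_const * e) / alpha.
  by rewrite /weighted_control_const; field; lra.
suff : u <= 2 * energy_const * e / alpha by lra.
apply: (Rmult_le_reg_l alpha) => //.
by have -> : alpha * (2 * energy_const * e / alpha) = 2 * energy_const * e by field; lra.
Qed.

(** From L2 to sup norm at a single node: testing [Hh i] with the vector [(0, U_i)] bounds [U_i] by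
    the stationarity residual, the state and the costate at that node. *)
Let control_bound i c : Rabs (U i c) <= control_const * e.
Proof.
pose bd := e + a * K * x + a * K * l.
have aK : 0 <= a * K by nra.
have bd0 : 0 <= bd.
  have : 0 <= a * K * x by apply: Rmult_le_pos.
  have : 0 <= a * K * l by apply: Rmult_le_pos.
  by rewrite /bd; lra.
have hb c' : Rabs (\rsum_(d < m) (Hh i (rshift n c') (rshift n d) * U i d)) <= bd.
  have -> : \rsum_(d < m) (Hh i (rshift n c') (rshift n d) * U i d) = g i (rshift n c')
      - \rsum_k (Hh i (rshift n c') (lshift m k) * X i k) - \rsum_k (J i k (rshift n c') * Lam i k).
    have e1 : mxapp (Hh i) (Z i) (rshift n c') = \rsum_k (Hh i (rshift n c') (lshift m k) * X i k)
        + \rsum_(d < m) (Hh i (rshift n c') (rshift n d) * U i d).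
      by rewrite /mxapp rsum_split; congr (_ + _); apply: eq_bigr => d _; rewrite /Z ?zjoin_lshift ?zjoin_rshift.
    have e2 : \rsum_k (J i k (rshift n c') * Lam i k) = \rsum_k (Lam i k * J i k (rshift n c')).
      by apply: eq_bigr => k _; ring.
    by rewrite /g e1 e2; ring.
  rewrite /bd; apply: Rabs_add_le.
    apply: Rabs_add_le => //.
    by rewrite Rabs_Ropp; apply: row_bound_entries => // k; exact: xub.
  by rewrite Rabs_Ropp; apply: row_bound_entries => // k; exact: lub.
pose v := zjoin (fun _ : 'I_n => 0) (U i).
set t := vnorm (U i).
have t0 : 0 <= t := vnorm_ge0 _.
have tc d : Rabs (U i d) <= t := vnorm_coord _ d.
have hv : alpha * (t * t) <= b * (t * bd).
  have -> : t * t = dotv v v.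
    rewrite vnorm_sq /dotv rsum_split [X in _ = X + _]rsum0.
      by rewrite Rplus_0_l; apply: eq_bigr => d _; rewrite /v zjoin_rshift.
    by move=> k; rewrite /v zjoin_lshift; ring.
  apply: Rle_trans (Hpos i v) _; rewrite /dotv rsum_split [X in X + _]rsum0; last first.
    by move=> k; rewrite /v zjoin_lshift; ring.
  rewrite Rplus_0_l; have -> : b * (t * bd) = \rsum_(d < m) (t * bd) by rewrite rsum_const_ord.
  apply: rsum_le => d; apply: Rle_trans (Rle_abs _) _.
  rewrite Rabs_mult /v zjoin_rshift; apply: Rabs_mult_le => //.
  rewrite /mxapp rsum_split [X in X + _]rsum0; last by move=> k; rewrite zjoin_lshift; ring.
  rewrite Rplus_0_l; apply: Rle_trans (hb d); apply: Req_le; congr Rabs.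
  by apply: eq_bigr => d' _; rewrite zjoin_rshift.
have ht : alpha * t <= b * bd.
  have bbd : 0 <= b * bd by apply: Rmult_le_pos.
  by case: t0 => [t0|<-]; [apply: (Rmult_le_reg_r t) => //; lra|lra].
apply: Rle_trans (tc c) _; apply: (Rmult_le_reg_l alpha) => //; apply: Rle_trans ht _.
have -> : alpha * (control_const * e)
  = b * (e + a * K * (state_const * ((weighted_control_const + 1) * e))
      + a * K * (costate_const * ((weighted_control_const + 1) * e))).
  by rewrite /control_const; field; lra.
have ue : u + e <= (weighted_control_const + 1) * e by have := weighted_control_bound; lra.
apply: Rmult_le_compat_l => //; rewrite /bd; apply: Rplus_le_compat; first apply: Rplus_le_compat_l.
  apply: Rmult_le_compat_l => //; apply: Rle_trans state_bound _.
  exact: Rmult_le_compat_l.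
apply: Rmult_le_compat_l => //; apply: Rle_trans costate_bound _.
exact: Rmult_le_compat_l.
Qed.

Lemma linear_stability : [/\ forall i k, Rabs (X i k) <= stability_const * e,
  forall i c, Rabs (U i c) <= stability_const * e &
  forall i k, Rabs (Lam i k) <= stability_const * e].
Proof.
have ue : u + e <= (weighted_control_const + 1) * e by have := weighted_control_bound; lra.
have h1 : x <= state_const * ((weighted_control_const + 1) * e).
  by apply: Rle_trans state_bound _; exact: Rmult_le_compat_l.
have h2 : l <= costate_const * ((weighted_control_const + 1) * e).
  by apply: Rle_trans costate_bound _; exact: Rmult_le_compat_l.
have c0 : 0 <= control_const.
  have q0 : 0 <= 2 * energy_const / alpha.
    by apply: Rdiv_ge0 => //; lra.
  rewrite /control_const; apply: Rmult_le_pos; last by apply: Rlt_le; exact: Rinv_0_lt_compat.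
  apply: Rmult_le_pos => //; apply: Rplus_le_le_0_compat; first by lra.
  by apply: Rmult_le_pos; [apply: Rmult_le_pos; [nra|lra]|rewrite /weighted_control_const; lra].
have ce : 0 <= control_const * e by apply: Rmult_le_pos.
have := x0; have := l0; rewrite /stability_const => l0' x0'; split=> [i k|i c|i k].
- by have := xub i k; lra.
- by have := control_bound i c; lra.
- by have := lub i k; lra.
Qed.

End Stability.

(** * Newton iteration with frozen derivative *)

Lemma small_half_pow x c : (forall k, Rabs x <= c / 2 ^ k) -> x = 0.
Proof.
move=> h; apply: NNPP => x0; have x1 : 0 < Rabs x by apply: Rabs_pos_lt.
have [k hk] := cv_pow_half c _ x1.
have := hk k (le_n _); rewrite /Rdist Rminus_0_r.
by have := h k; have := Rle_abs (c / 2 ^ k); lra.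
Qed.

Lemma geometric_limit (u : nat -> R) c : 0 <= c -> (forall k, Rabs (u k.+1 - u k) <= c / 2 ^ k) ->
  exists l, forall k, Rabs (l - u k) <= 2 * c / 2 ^ k.
Proof.
move=> c0 hu.
have p2 k : 0 < 2 ^ k by apply: pow_lt; lra.
have hS k : c / 2 ^ k.+1 = c / 2 ^ k / 2 by rewrite /=; field; have := p2 k; lra.
have far k j : Rabs (u (k + j)%N - u k) <= 2 * c / 2 ^ k - 2 * c / 2 ^ (k + j).
  elim: j => [|j IH]; first by rewrite addn0 !Rminus_diag Rabs_R0; lra.
  have := hu (k + j)%N; have := hS (k + j)%N; rewrite addnS => h1 h2.
  have := Rabs_triang (u (k + j).+1 - u (k + j)%N) (u (k + j)%N - u k).
  have -> : u (k + j).+1 - u (k + j)%N + (u (k + j)%N - u k) = u (k + j).+1 - u k by ring.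
  rewrite {2}/Rdiv Rmult_assoc -/(Rdiv _ _) h1.
  have -> : 2 * c / 2 ^ k = 2 * (c / 2 ^ k) by rewrite /Rdiv; ring.
  have e2 : 2 * c / 2 ^ (k + j) = 2 * (c / 2 ^ (k + j)) by rewrite /Rdiv; ring.
  by move: IH; rewrite e2 /Rdiv; lra.
have far' k j : (k <= j)%N -> Rabs (u j - u k) <= 2 * c / 2 ^ k.
  move=> kj; rewrite -(subnKC kj); apply: Rle_trans (far k (j - k)%N) _.
  have : 0 <= 2 * c / 2 ^ (k + (j - k)).
    by apply: Rdiv_ge0 => //; lra.
  by lra.
have cau : Cauchy_crit u.
  move=> eps eps0; have [k hk] := cv_pow_half (2 * c) _ (Rmult_lt_0_compat _ _ eps0 (Rinv_0_lt_compat 2 ltac:(lra))).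
  exists k => i j /leP hi /leP hj; rewrite /Rdist.
  have := hk k (le_n _); rewrite /Rdist Rminus_0_r => h1.
  have -> : u i - u j = (u i - u k) - (u j - u k) by ring.
  apply: Rle_lt_trans (Rabs_triang _ _) _; rewrite Rabs_Ropp.
  by have := far' _ _ hi; have := far' _ _ hj; have := Rle_abs (2 * c / 2 ^ k); lra.
have [l hl] := R_complete _ cau.
exists l => k; apply: Rnot_lt_le => hlt.
have [j0 hj] := hl (Rabs (l - u k) - 2 * c / 2 ^ k) ltac:(lra).
pose j := maxn j0 k.
have := hj j ltac:(apply/leP; exact: leq_maxl); have := far' _ _ (leq_maxr j0 k); rewrite /Rdist -/j.
have := Rabs_triang (u j - u k) (l - u j).
have -> : u j - u k + (l - u j) = l - u k by ring.
by rewrite (Rabs_minus_sym l (u j)); lra.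
Qed.

(** The step [z - A^-1 (T z)] has length at most [kap] times the residual, and the remainder bound
    [d / (2 kap)] then halves the residual. The lengths add up to [2 kap e <= r], so the iterates
    stay where [lin] holds. *)
Lemma modified_newton (I : finType) (T : (I -> R) -> I -> R) (A : I -> I -> R) (kap r e : R) (z0 : I -> R) :
  0 < kap -> 0 <= e -> 2 * kap * e <= r ->
  (forall z c, 0 <= c -> (forall i, Rabs (mxapp A z i) <= c) -> forall i, Rabs (z i) <= kap * c) ->
  (forall z y d, 0 <= d -> (forall i, Rabs (z i - z0 i) <= r) -> (forall i, Rabs (y i - z0 i) <= r) ->
    (forall i, Rabs (z i - y i) <= d) ->
    forall i, Rabs (T z i - T y i - mxapp A (fun j => z j - y j) i) <= d / (2 * kap)) ->
  (forall i, Rabs (T z0 i) <= e) ->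
  exists z, (forall i, Rabs (z i - z0 i) <= 2 * kap * e) /\ forall i, T z i = 0.
Proof.
move=> kap0 e0 ker stab lin hT0.
(* The stability estimate with zero data excludes a kernel, so [A] is invertible. *)
have [[v [[i vi] hv]]|[B [_ hB]]] := singular_or_invertible A.
  case: vi; have := stab v 0 (Rle_refl _) (fun i => _) i.
  rewrite Rmult_0_r => h; have {}h := h ltac:(by move=> j; rewrite hv Rabs_R0; lra).
  by have := Rle_abs (v i); have := Rle_abs (- v i); rewrite Rabs_Ropp; lra.
pose zs := fix zs k := if k is j.+1 then (fun i => zs j i - mxapp B (T (zs j)) i) else z0.
have p2 k : 0 < 2 ^ k by apply: pow_lt; lra.
have q2 k : 0 <= e / 2 ^ k by exact: Rdiv_ge0.
have stepB k : (forall i, Rabs (T (zs k) i) <= e / 2 ^ k) ->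
    forall i, Rabs (mxapp B (T (zs k)) i) <= kap * (e / 2 ^ k).
  by move=> h; apply: stab => // j; rewrite hB.
(* The bound on the distance is the partial sum of the geometric series of step lengths. *)
have inv k : (forall i, Rabs (T (zs k) i) <= e / 2 ^ k) /\
    (forall i, Rabs (zs k i - z0 i) <= 2 * kap * (e - e / 2 ^ k)).
  elim: k => [|k [h1 h2]].
    split=> i; rewrite /= Rdiv_1_r; first exact: hT0.
    by rewrite !Rminus_diag Rabs_R0; lra.
  have hS : e / 2 ^ k.+1 = e / 2 ^ k / 2 by rewrite /=; field; have := p2 k; lra.
  have h3 := stepB k h1.
  have h4 j : Rabs (zs k.+1 j - zs k j) <= kap * (e / 2 ^ k).
    have -> : zs k.+1 j - zs k j = - mxapp B (T (zs k)) j by rewrite /=; ring.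
    by rewrite Rabs_Ropp.
  have h5 i : Rabs (zs k.+1 i - z0 i) <= 2 * kap * (e - e / 2 ^ k.+1).
    have -> : zs k.+1 i - z0 i = (zs k.+1 i - zs k i) + (zs k i - z0 i) by ring.
    apply: Rle_trans (Rabs_triang _ _) _.
    by rewrite hS; have := h4 i; have := h2 i; lra.
  split=> // i.
  have kq : 0 <= kap * (e / 2 ^ k) by apply: Rmult_le_pos => //; lra.
  have kq' : 0 <= kap * (e / 2 ^ k.+1) by apply: Rmult_le_pos => //; lra.
  have r1 j : Rabs (zs k.+1 j - z0 j) <= r by have := h5 j; lra.
  have r2 j : Rabs (zs k j - z0 j) <= r by have := h2 j; lra.
  have := lin (zs k.+1) (zs k) _ kq r1 r2 h4 i.
  have -> : mxapp A (fun j => zs k.+1 j - zs k j) i = - T (zs k) i.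
    have -> : (fun j => zs k.+1 j - zs k j) = fun j => (- 1) * mxapp B (T (zs k)) j + 0 * 0.
      by apply: funext => j /=; ring.
    by rewrite (mxapp_lincomb A (-1) 0 _ (fun=> 0)) hB /mxapp; ring.
  have -> : T (zs k.+1) i - T (zs k) i - - T (zs k) i = T (zs k.+1) i by ring.
  by have -> : kap * (e / 2 ^ k) / (2 * kap) = e / 2 ^ k.+1 by rewrite hS; field; have := p2 k; lra.
have ke : 0 <= kap * e by apply: Rmult_le_pos => //; lra.
have lim i : exists l, forall k, Rabs (l - zs k i) <= 2 * (kap * e) / 2 ^ k.
  apply: geometric_limit => // k.
  have -> : zs k.+1 i - zs k i = - mxapp B (T (zs k)) i by rewrite /=; ring.
  rewrite Rabs_Ropp; have -> : kap * e / 2 ^ k = kap * (e / 2 ^ k) by rewrite /Rdiv; ring.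
  exact: stepB (proj1 (inv k)) i.
have [z hz] := choice _ lim.
have zr i : Rabs (z i - z0 i) <= 2 * kap * e.
  by have := hz i 0%N; rewrite /= Rdiv_1_r; lra.
exists z; split=> // i.
pose c := \rsum_j Rabs (A i j).
(* Continuity of [T] at the limit is not assumed: [lin] bounds [T z - T (zs k)] up to the linear
   part, and every term decays like [2 ^ -k]. *)
apply: (@small_half_pow _ (2 * e + c * (2 * (kap * e)))) => k.
have d0 : 0 <= 2 * (kap * e) / 2 ^ k.
  by apply: Rdiv_ge0 => //; lra.
have r1 j : Rabs (z j - z0 j) <= r by have := zr j; lra.
have r2 j : Rabs (zs k j - z0 j) <= r.
  have : 0 <= kap * (e / 2 ^ k) by apply: Rmult_le_pos => //; lra.
  by have := proj2 (inv k) j; lra.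
have h1 := lin z (zs k) _ d0 r1 r2 (fun j => hz j k) i.
have h2 : Rabs (mxapp A (fun j => z j - zs k j) i) <= c * (2 * (kap * e) / 2 ^ k).
  by apply: row_bound => //; exact: Rle_refl.
have h3 := proj1 (inv k) i.
have -> : T z i = (T z i - T (zs k) i - mxapp A (fun j => z j - zs k j) i)
  + mxapp A (fun j => z j - zs k j) i + T (zs k) i by ring.
apply: Rle_trans (Rabs_triang _ _) _.
have := Rabs_triang (T z i - T (zs k) i - mxapp A (fun j => z j - zs k j) i) (mxapp A (fun j => z j - zs k j) i).
have e1 : 2 * (kap * e) / 2 ^ k / (2 * kap) = e / 2 ^ k by field; have := p2 k; lra.
rewrite e1 in h1.
have -> : (2 * e + c * (2 * (kap * e))) / 2 ^ k = 2 * (e / 2 ^ k) + c * (2 * (kap * e) / 2 ^ k).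
  by rewrite /Rdiv; ring.
by lra.
Qed.

(** * Radau collocation *)

Lemma sumR1E N (g : nat -> R) : sumR 1 N g = \rsum_(i < N) g i.+1.
Proof. by rewrite /sumR big_add1 big_mkord. Qed.

Lemma sumR0E N (g : nat -> R) : sumR 0 N g = g 0%N + \rsum_(i < N) g i.+1.
Proof. by rewrite /sumR big_mkord rsum_recl; congr (_ + _); apply: eq_bigr => i _. Qed.

Lemma mxapp_delta (I : finType) (A : I -> I -> R) k i :
  mxapp A (fun j => if j == k then 1 else 0) i = A i k.
Proof.
by rewrite /mxapp -(rsum_delta (A i) k); apply: eq_bigr => j _; case: eqP => _; ring.
Qed.

Lemma mxapp_inverse (I : finType) (A B : I -> I -> R) :
  (forall i k, \rsum_j (A i j * B j k) = if i == k then 1 else 0) -> forall v, mxapp A (mxapp B v) = v.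
Proof.
move=> h v; apply: funext => i; rewrite -[RHS](rsum_delta v i) /mxapp.
have -> : \rsum_j (A i j * \rsum_k (B j k * v k)) = \rsum_j \rsum_k (A i j * (B j k * v k)).
  by apply: eq_bigr => j _; rewrite rsumZ.
rewrite rsum_exchange; apply: eq_bigr => k _.
rewrite (eq_bigr (fun j => A i j * B j k * v k)) => [|j _]; last by ring.
by rewrite rsumZr h eq_sym; case: eqP => _; ring.
Qed.

Lemma inverse_unique (I : finType) (A B C : I -> I -> R) :
  (forall v, mxapp B (mxapp A v) = v) -> (forall v, mxapp A (mxapp C v) = v) -> forall i j, B i j = C i j.
Proof. by move=> hB hC i j; rewrite -[LHS]mxapp_delta -[RHS]mxapp_delta -[in LHS](hC (fun _ => _)) hB. Qed.

Lemma derivable_pt_lim_horner_eq (p : {poly R}) x l f :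
  (forall t, f t = horner p t) -> derivable_pt_lim f x l -> l = horner (deriv p) x.
Proof.
move=> e h; apply: (uniqueness_limite _ _ _ _ h).
by apply: (derivable_pt_lim_ext (horner p)) (horner_derivable p x) => t; rewrite e.
Qed.

Lemma size_deriv_le (p : {poly R}) : (size (deriv p) <= (size p).-1)%N.
Proof.
case: (eqVneq p 0%R) => [->|p0]; first by rewrite deriv0 size_poly0.
by have := lt_size_deriv p0; case: (size p).
Qed.

Lemma horner_one t : horner (1%R : {poly R}) t = 1.
Proof. exact: hornerC. Qed.

Lemma horner_deriv_one t : horner (deriv (1%R : {poly R})) t = 0.
Proof. by rewrite -polyC1 derivC horner0. Qed.

Section Collocation.
Variables (N : nat) (tau omega : nat -> R) (D : nat -> nat -> R).
Hypothesis N0 : (0 < N)%N.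
Hypothesis hR : Radau N tau omega.
Hypothesis hD : Dmat_spec N tau D.

Let tau0 : tau 0%N = -1. Proof. by case: hR. Qed.
Let tauN : tau N = 1. Proof. by case: hR => _ [_ [_ []]]. Qed.

Lemma weight_gt0 i : (1 <= i <= N)%N -> 0 < omega i.
Proof. by case: hR => _ [_ [_ [_ [h _]]]]; exact: h. Qed.

Let tauS i : (i < N)%N -> tau i < tau i.+1.
Proof.
case: hR => h0 [h1 [h2 _]]; case: i => [|i] iN; first by rewrite h0.
by apply: h2.
Qed.

Let tau_lt i j : (i < j)%N -> (j <= N)%N -> tau i < tau j.
Proof.
elim: j => [//|j IH]; rewrite ltnS leq_eqVlt => /orP[/eqP->|ij] jN; first exact: tauS.
by apply: Rlt_trans (tauS jN); apply: IH => //; exact: ltnW.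
Qed.

Lemma node_itv i : (i <= N)%N -> -1 <= tau i <= 1.
Proof.
move=> iN; rewrite -tau0 -tauN; split.
  by case: i iN => [|i] iN; [lra|apply: Rlt_le; exact: tau_lt].
by move: iN; rewrite leq_eqVlt => /orP[/eqP->|iN]; [lra|apply: Rlt_le; exact: tau_lt].
Qed.

Let tau_inj i j : (i <= N)%N -> (j <= N)%N -> tau i = tau j -> i = j.
Proof.
move=> iN jN e; case: (ltngtP i j) => // h; first by have := tau_lt h jN; lra.
by have := tau_lt h iN; lra.
Qed.

Definition lagrange_poly (j : nat) : {poly R} :=
  (\prod_(0 <= i < N.+1 | i != j) ((tau j - tau i)^-1 *: ('X - (tau i)%:P)))%R.

Lemma horner_lagrange j t : horner (lagrange_poly j) t = Lag N tau j t.
Proof.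
rewrite /lagrange_poly horner_prod /Lag; apply: eq_bigr => i _.
by rewrite hornerZ hornerXsubC; apply: Rmult_comm.
Qed.

Lemma size_lagrange j : (j <= N)%N -> (size (lagrange_poly j) <= N.+1)%N.
Proof.
move=> jN; rewrite /lagrange_poly.
suff h s : (size (\prod_(i <- s | i != j) ((tau j - tau i)^-1 *: ('X - (tau i)%:P)))%R <= (count (predC1 j) s).+1)%N.
  apply: leq_trans (h _) _; rewrite ltnS /index_iota subn0.
  have := count_predC (pred1 j) (iota 0 N.+1); rewrite size_iota count_uniq_mem ?iota_uniq //.
  by rewrite mem_iota add0n leq0n ltnS jN /= add1n => -[->].
elim: s => [|i s IH]; first by rewrite big_nil size_poly1.
rewrite big_cons /=; case: eqP => _ //=; rewrite add1n.
apply: leq_trans (size_polyMleq _ _) _.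
have : (size ((tau j - tau i)^-1 *: ('X - (tau i)%:P))%R <= 2)%N.
  by rewrite (leq_trans (size_scale_leq _ _)) // size_XsubC.
move=> h2; have := leq_add h2 IH; rewrite addnS; case: (_ + _)%N => [|k] //.
Qed.

Lemma horner_lagrange_node i j : (i <= N)%N -> (j <= N)%N ->
  horner (lagrange_poly j) (tau i) = if i == j then 1 else 0.
Proof.
move=> iN jN; rewrite horner_lagrange /Lag; case: eqP => [->|/eqP ij].
  rewrite big_nat_cond big1 // => k /andP[/andP[_ kN] kj]; apply: Rinv_r => h.
  by move: kj; rewrite (tau_inj kN jN ltac:(lra)) eqxx.
rewrite big_mkcond (bigD1_seq i) ?iota_uniq //=; last by rewrite mem_index_iota.
by rewrite ij /Rdiv Rminus_diag !Rmult_0_l.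
Qed.

Lemma Dmat_lagrange i j : (1 <= i <= N)%N -> (j <= N)%N -> D i j = horner (deriv (lagrange_poly j)) (tau i).
Proof.
by move=> iN jN; apply: derivable_pt_lim_horner_eq (hD iN jN) => t; rewrite horner_lagrange.
Qed.

Lemma lagrange_interpolation (p : {poly R}) : (size p <= N.+1)%N ->
  p = (\sum_(j < N.+1) p.[tau j] *: lagrange_poly j)%R.
Proof.
move=> sp; apply/eqP; rewrite -GRing.subr_eq0; apply/eqP.
apply: (@roots_geq_poly_eq0 _ _ (map tau (iota 0 N.+1))).
- apply/allP => z /mapP[i]; rewrite mem_iota add0n ltnS => iN ->.
  rewrite /root hornerD hornerN horner_sum.
  rewrite (eq_bigr (fun j : 'I_N.+1 => if j == inord i then p.[tau j]%R else 0)) => [|j _].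
    by rewrite -big_mkcond big_pred1_eq inordK // GRing.subrr.
  rewrite hornerZ horner_lagrange_node //; last by rewrite -ltnS.
  rewrite -val_eqE /= inordK // eq_sym; case: eqP => _; first exact: GRing.mulr1.
  exact: GRing.mulr0.
- rewrite map_inj_in_uniq ?iota_uniq // => i j; rewrite !mem_iota !add0n !ltnS.
  by move=> iN jN; exact: tau_inj.
rewrite size_map size_iota.
rewrite (leq_trans (size_polyD _ _)) // geq_max sp size_polyN.
apply: (leq_trans (size_sum _ _ _)); apply/bigmax_leqP => j _.
by apply: leq_trans (size_scale_leq _ _) _; apply: size_lagrange; rewrite -ltnS.
Qed.

Lemma Dmat_exact (p : {poly R}) i : (size p <= N.+1)%N -> (1 <= i <= N)%N ->
  sumR 0 N (fun j => D i j * horner p (tau j)) = horner (deriv p) (tau i).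
Proof.
move=> sp iN; rewrite [in RHS](lagrange_interpolation sp) GRing.raddf_sum horner_sum /sumR big_mkord.
apply: eq_bigr => j _; rewrite /= derivZ hornerZ (Dmat_lagrange iN); last by rewrite -ltnS.
exact: Rmult_comm.
Qed.

(* The argument of [horner] is parsed in [ring_scope]; [IZR 1] and [IZR (-1)] keep the
   endpoints in the form on which [ring] and [lra] operate. *)
Lemma quadrature_exact (P : {poly R}) : (size (deriv P) <= N.*2.-1)%N ->
  sumR 1 N (fun i => omega i * horner (deriv P) (tau i)) = horner P (IZR 1) - horner P (IZR (-1)).
Proof.
move=> sP; case: hR => _ [_ [_ [_ [_ hq]]]].
have E t : sumR 0 (2 * N - 2) (fun k => ((deriv P)`_k)%R * t ^ k) = horner (deriv P) t.
  rewrite (@horner_coef_wide _ (2 * N - 2).+1); last first.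
    by apply: leq_trans sP _; rewrite mul2n; lia.
  by rewrite /sumR big_mkord; apply: eq_bigr => k _; rewrite RpowE.
have [pr e] := hq (fun k => ((deriv P)`_k)%R).
rewrite (_ : sumR 1 N _ = RiemannInt pr); last first.
  by rewrite e; apply: eq_big_nat => i _; rewrite E.
rewrite -RInt.RInt_Reals.
rewrite (_ : (fun t => _) = horner (deriv P)); last by apply: funext => t; rewrite E.
apply: (RInt.is_RInt_unique (V := Hierarchy.R_CompleteNormedModule)).
apply: (RInt_analysis.is_RInt_derive (V := Hierarchy.R_CompleteNormedModule) (horner P)) => t _.
  by apply/Derive.is_derive_Reals; exact: horner_derivable.
apply: (Derive.ex_derive_continuous (V := Hierarchy.R_NormedModule) (horner (deriv P)) t); exists (horner (deriv (deriv P)) t).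
by apply/Derive.is_derive_Reals; exact: horner_derivable.
Qed.

(** Summation by parts: the quadrature is exact for [(p L_j)'], of degree at most [2N - 2]. The
    boundary term at -1 vanishes because -1 is an interpolation node, and the one at 1 survives only
    for the last node. *)
Lemma Ddag_exact (p : {poly R}) (j : 'I_N) : (size p <= N)%N ->
  \rsum_(i < N) (Ddag omega D j.+1 i.+1 * horner p (tau i.+1))
  = horner (deriv p) (tau j.+1) - (if j.+1 == N then horner p (IZR 1) / omega N else 0).
Proof.
move=> sp; have jN : (1 <= j.+1 <= N)%N by rewrite /= ltn_ord.
have wj := weight_gt0 jN.
set q := lagrange_poly j.+1.
have hq : (size (deriv (p * q)%R) <= N.*2.-1)%N.
  apply: leq_trans (size_deriv_le _) _; rewrite -!subn1; apply: leq_sub2r.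
  apply: leq_trans (size_polyMleq p q) _.
  have := leq_add sp (size_lagrange (ltn_ord j)); rewrite addnS addnn -/q.
  by case: (_ + _)%N.
have := quadrature_exact hq.
have qi i : (i <= N)%N -> horner q (tau i) = if i == j.+1 then 1 else 0.
  by move=> iN; rewrite horner_lagrange_node.
have q1 : horner q (IZR 1) = if j.+1 == N then 1 else 0 by have := qi N (leqnn N); rewrite tauN eq_sym.
have q0 : horner q (IZR (-1)) = 0 by have := qi 0%N isT; rewrite tau0.
have dE (i : 'I_N) : horner (deriv q) (tau i.+1) = D i.+1 j.+1.
  by rewrite Dmat_lagrange // ltn_ord.
rewrite !hornerM q1 q0 sumR1E => hsum.
have e1 : \rsum_(i < N) (omega i.+1 * horner (deriv (p * q)%R) (tau i.+1))
  = omega j.+1 * horner (deriv p) (tau j.+1)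
    - omega j.+1 * \rsum_(i < N) (Ddag omega D j.+1 i.+1 * horner p (tau i.+1)).
  rewrite -rsumZ -(rsum_delta (fun i : 'I_N => omega i.+1 * horner (deriv p) (tau i.+1)) j) -rsumB.
  apply: eq_bigr => i _.
  rewrite derivM hornerD !hornerM qi // dE eqSS val_eqE -!RmultE -RplusE /Ddag.
  move: (horner _ _) (horner _ _) (D _ _) => a b c.
  by case: eqP => [->|_]; field; lra.
rewrite e1 -!RmultE Rmult_0_r in hsum; apply: (Rmult_eq_reg_l (omega j.+1)); last by lra.
move: hsum; set S := \rsum_i _.
move: (horner (deriv p) _) (horner p (IZR 1)) (horner p _) => a b c.
case: eqP => [e|_] h; last by lra.
have -> : omega N = omega j.+1 by rewrite e.
have -> : omega j.+1 * (a - c / omega j.+1) = omega j.+1 * a - c by field; lra.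
by lra.
Qed.

End Collocation.

Lemma infnormN_row N B (i : 'I_N) : infnormN N B <= 2 -> \rsum_(j < N) Rabs (B i.+1 j.+1) <= 2.
Proof.
rewrite -(sumR1E N (fun j => Rabs (B i.+1 j))) => h; apply: Rle_trans h; rewrite /infnormN.
by apply: (bigRmax_ub (fun i => sumR 1 N (fun j => Rabs (B i j)))); rewrite mem_index_iota /= ltnS (valP i).
Qed.

Section OrdinalCollocation.
Variables (M : nat) (tau omega : nat -> R) (D : nat -> nat -> R).
Let N := M.+1.
Hypothesis M0 : (0 < M)%N.
Hypothesis hR : Radau N tau omega.
Hypothesis hD : Dmat_spec N tau D.
Hypothesis hP : P1234 N omega D.

Let w (i : 'I_N) := omega i.+1.
Let A (i j : 'I_N) := D i.+1 j.+1.
Let Ad (i j : 'I_N) := Ddag omega D i.+1 j.+1.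

Let w0 i : 0 < w i.
Proof. by apply: (weight_gt0 hR); rewrite /= ltn_ord. Qed.

Let is_inv_ord E F : is_inv N E F ->
  (forall v, mxapp (fun i j : 'I_N => E i.+1 j.+1) (mxapp (fun i j : 'I_N => F i.+1 j.+1) v) = v) /\
  (forall v, mxapp (fun i j : 'I_N => F i.+1 j.+1) (mxapp (fun i j : 'I_N => E i.+1 j.+1) v) = v).
Proof.
move=> h; split; apply: mxapp_inverse => i k.
  by have [+ _] := h i.+1 k.+1 (ltn_ord i) (ltn_ord k); rewrite sumR1E eqSS val_eqE.
by have [_ +] := h i.+1 k.+1 (ltn_ord i) (ltn_ord k); rewrite sumR1E eqSS val_eqE.
Qed.

(** The inverse of [W^(1/2) E] is [F W^(-1/2)]; the squared norm of its row is the sum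
    [F_ij^2 / w_j]. *)
Let scaled_rows (E : nat -> nat -> R) (F : 'I_N -> 'I_N -> R) :
  (forall v, mxapp (fun i j : 'I_N => E i.+1 j.+1) (mxapp F v) = v) ->
  (exists F', is_inv N (fun i j => sqrt (omega i) * E i j) F' /\ rows_bounded N F') ->
  forall i, \rsum_j (F i j * F i j / w j) <= 2.
Proof.
move=> hF [F' [hF' rb]] i.
have sp j : 0 < sqrt (w j) by apply: sqrt_lt_R0.
have sq j : sqrt (w j) * sqrt (w j) = w j by apply: sqrt_sqrt; exact: Rlt_le.
have e j : F i j = F' i.+1 j.+1 * sqrt (w j).
  symmetry; apply: (inverse_unique (A := fun i j : 'I_N => E i.+1 j.+1)
    (B := fun i j : 'I_N => F' i.+1 j.+1 * sqrt (w j))) => // v.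
  rewrite -[RHS](proj2 (is_inv_ord hF')).
  apply: funext => k; apply: eq_bigr => l _.
  have -> : mxapp (fun i0 j0 : 'I_N => sqrt (omega i0.+1) * E i0.+1 j0.+1) v l
    = sqrt (w l) * mxapp (fun i j : 'I_N => E i.+1 j.+1) v l.
    by rewrite /mxapp -rsumZ; apply: eq_bigr => c _; rewrite /w; ring.
  by ring.
have -> : \rsum_j (F i j * F i j / w j) = sumR 1 N (fun j => F' i.+1 j * F' i.+1 j).
  rewrite sumR1E; apply: eq_bigr => j _; rewrite e -[X in _ / X](sq j).
  by field; have := sp j; lra.
have h := rb i.+1 (ltn_ord i).
have s0 : 0 <= sumR 1 N (fun j => F' i.+1 j * F' i.+1 j).
  by rewrite sumR1E; apply: rsum_ge0 => j; exact: Rle_0_sqr.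
by apply: sqrt_le_0 h; lra.
Qed.

Lemma weights_sum : \rsum_i w i = 2.
Proof.
have dX : deriv (polyX R) = 1%R by exact: derivX.
have := @quadrature_exact N tau omega isT hR (polyX R).
rewrite dX size_poly1 sumR1E !hornerX => /(_ isT) h.
rewrite -[LHS]/(\rsum_(i < N) omega i.+1); have -> : 2 = 1 - -1 by ring.
rewrite -h; apply: eq_bigr => i _; rewrite horner_one; ring.
Qed.

Lemma quadrature_ord (P : {poly R}) : (size P <= N.+1)%N ->
  \rsum_i (w i * horner (deriv P) (tau i.+1)) = horner P (IZR 1) - horner P (IZR (-1)).
Proof.
move=> sP; rewrite -(quadrature_exact _ hR) ?sumR1E //.
apply: leq_trans (size_deriv_le _) _.
by move: sP; rewrite /N; case: (size P) => [|k]; lia.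
Qed.

Lemma Dmat_row_sum (i : 'I_N) : D i.+1 0 + \rsum_j A i j = 0.
Proof.
have := @Dmat_exact N tau omega D hR hD 1%R i.+1.
rewrite size_poly1 /= ltn_ord horner_deriv_one sumR0E => /(_ isT isT) h.
rewrite -[RHS]h horner_one; congr (_ + _); first by ring.
by apply: eq_bigr => j _; rewrite horner_one /A; ring.
Qed.

Let Dmat_ord (p : {poly R}) (i : 'I_N) : (size p <= N.+1)%N ->
  \rsum_j (A i j * (horner p (tau j.+1) - horner p (IZR (-1)))) = horner (deriv p) (tau i.+1).
Proof.
move=> sp; have tau0 : tau 0%N = -1 by case: hR.
rewrite -(@Dmat_exact N tau omega D hR hD p i.+1 sp) ?ltn_ord // sumR0E tau0.
have -> : D i.+1 0 = - \rsum_j A i j by have := Dmat_row_sum i; lra.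
by rewrite -Ropp_mult_distr_l -rsumZr -rsumN -rsumD; apply: eq_bigr => j _; rewrite /A; ring.
Qed.

Let Ddag_ord (p : {poly R}) (i : 'I_N) : (size p <= N)%N ->
  \rsum_j (Ad i j * (horner p (tau j.+1) - horner p (IZR 1))) = horner (deriv p) (tau i.+1).
Proof.
move=> sp; have h1 := @Ddag_exact N tau omega D isT hR hD p i sp.
have := @Ddag_exact N tau omega D isT hR hD 1%R i.
rewrite size_poly1 horner_deriv_one horner_one => /(_ isT) h2.
rewrite (eq_bigr (fun j => Ad i j * horner p (tau j.+1) - Ad i j * 1 * horner p (IZR 1))) => [|j _]; last by ring.
rewrite rsumB rsumZr h1.
have -> : \rsum_j (Ad i j * 1) = \rsum_(j < N) (Ddag omega D i.+1 j.+1 * horner (1%R : {poly R}) (tau j.+1)).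
  by apply: eq_bigr => j _; rewrite horner_one.
by rewrite h2; case: eqP => _; rewrite /Rdiv; ring.
Qed.

(** Exactness on the constant 1 leaves only the boundary term; it produces the term
    [grad C (X_N) / omega_N] of the terminal costate equation. *)
Lemma Ddag_row_sum (i : 'I_N) : \rsum_j Ad i j = - (if i.+1 == N then / omega N else 0).
Proof.
have := @Ddag_exact N tau omega D isT hR hD 1%R i.
rewrite size_poly1 horner_deriv_one horner_one => /(_ isT) h2.
have -> : \rsum_j Ad i j = \rsum_(j < N) (Ddag omega D i.+1 j.+1 * horner (1%R : {poly R}) (tau j.+1)).
  by apply: eq_bigr => j _; rewrite horner_one /Ad; ring.
by rewrite h2; case: eqP => _; rewrite /Rdiv; ring.
Qed.

(** [B] and [Bd] act as integration from -1 and from 1 to the nodes, exact for the derivatives of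
    polynomials of degree [N] and [N - 1]. All later estimates use only these properties. *)
Lemma collocation_inverses : exists B Bd : 'I_N -> 'I_N -> R,
  [/\ [/\ forall i, \rsum_j Rabs (B i j) <= 2, forall i, \rsum_j Rabs (Bd i j) <= 2,
      forall i, \rsum_j (B i j * B i j / w j) <= 2 & forall i, \rsum_j (Bd i j * Bd i j / w j) <= 2],
    (forall i j, w i * Bd i j = - (w j * B j i)) /\ (forall j, B ord_max j = w j),
    [/\ forall v, mxapp A (mxapp B v) = v, forall v, mxapp B (mxapp A v) = v
      & forall v, mxapp Ad (mxapp Bd v) = v],
    forall (p : {poly R}) (i : 'I_N), (size p <= N.+1)%N -> horner p (tau i.+1)
      = horner p (IZR (-1)) + \rsum_j (B i j * horner (deriv p) (tau j.+1)) &
    forall (p : {poly R}) (i : 'I_N), (size p <= N)%N -> horner p (tau i.+1)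
      = horner p (IZR 1) + \rsum_j (Bd i j * horner (deriv p) (tau j.+1))].
Proof.
case: hP => [[B [hB nB]] [rB [[Bd [hBd nBd]] rBd]]].
have [AB BA] := is_inv_ord hB; have [AdBd BdAd] := is_inv_ord hBd.
exists (fun i j => B i.+1 j.+1), (fun i j => Bd i.+1 j.+1); split.
- split=> [i|i|i|i].
  + exact: infnormN_row nB.
  + exact: infnormN_row nBd.
  + exact: (scaled_rows (F := fun i j : 'I_N => B i.+1 j.+1) AB rB).
  + exact: (scaled_rows (F := fun i j : 'I_N => Bd i.+1 j.+1) AdBd rBd).
- split=> [i j|j].
    (* [Ad = - W^-1 A^T W], hence its inverse is [- W^-1 B^T W]. *)
    have -> : Bd i.+1 j.+1 = - (w j / w i * B j.+1 i.+1); last by field; have := w0 i; lra.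
    apply: (inverse_unique (A := Ad) (B := fun i j : 'I_N => Bd i.+1 j.+1)
      (C := fun i j : 'I_N => - (w j / w i * B j.+1 i.+1))) => //.
    apply: mxapp_inverse => k l.
    have h := mxapp_delta (fun i j : 'I_N => B i.+1 j.+1).
    have := congr1 (fun F => F l) (BA (fun c => if c == k then 1 else 0)) => /=.
    rewrite {1}/mxapp eq_sym => h2.
    rewrite (eq_bigr (fun c : 'I_N => w l / w k * (B l.+1 c.+1 * A c k))) => [|c _]; last first.
      by rewrite /Ad /Ddag -/(w k) -/(w c) /A; field; have := w0 k; have := w0 c; lra.
    rewrite rsumZ; have -> : \rsum_(c < N) (B l.+1 c.+1 * A c k) = if k == l then 1 else 0.
      by rewrite -h2; apply: eq_bigr => c _; rewrite mxapp_delta.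
    by case: eqP => [->|_]; field; have := w0 k; have := w0 l; lra.
  (* Quadrature of [L_c'] gives [w^T A = e_last^T]; multiplication by [B] then yields
     [w^T = e_last^T B]. *)
  have colsum c : \rsum_i (w i * A i c) = if c == ord_max then 1 else 0.
    have sL := size_lagrange tau (ltn_ord c).
    have := quadrature_ord sL.
    have tauN : tau N = 1 by case: hR => _ [_ [_ []]].
    have tau0 : tau 0%N = -1 by case: hR.
    have := horner_lagrange_node hR (leqnn N) (ltn_ord c); rewrite tauN => ->.
    have := horner_lagrange_node hR (leq0n N) (ltn_ord c); rewrite tau0 => -> /=.
    rewrite Rminus_0_r eqSS => h; have -> : (c == ord_max) = (M == c) by rewrite eq_sym.
    rewrite -h; apply: eq_bigr => i _.
    by rewrite /A (Dmat_lagrange hD) //= ltn_ord.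
  have -> : w j = \rsum_c (w c * (if c == j then 1 else 0)).
    by rewrite -(rsum_delta w j); apply: eq_bigr => c _; case: eqP => _; ring.
  rewrite (eq_bigr (fun c => w c * \rsum_k (A c k * B k.+1 j.+1))) => [|c _]; last first.
    congr (_ * _); rewrite -(congr1 (fun F => F c) (AB (fun c => if c == j then 1 else 0))).
    by apply: eq_bigr => k _; rewrite mxapp_delta.
  rewrite (eq_bigr (fun c => \rsum_k (w c * A c k * B k.+1 j.+1))) => [|c _]; last first.
    by rewrite -rsumZ; apply: eq_bigr => k _; ring.
  rewrite rsum_exchange -(rsum_delta (fun k : 'I_N => B k.+1 j.+1) ord_max).
  by apply: eq_bigr => k _; rewrite rsumZr colsum; case: eqP => _; ring.
- by split.
- move=> p i sp.
  have e : mxapp A (fun j => horner p (tau j.+1) - horner p (IZR (-1))) = fun j => horner (deriv p) (tau j.+1).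
    by apply: funext => j; exact: Dmat_ord.
  have := congr1 (fun F => F i) (BA (fun j => horner p (tau j.+1) - horner p (IZR (-1)))).
  by rewrite e /mxapp /= => ->; apply: esym; exact: Rplus_minus.
- move=> p i sp.
  have e : mxapp Ad (fun j => horner p (tau j.+1) - horner p (IZR 1)) = fun j => horner (deriv p) (tau j.+1).
    by apply: funext => j; exact: Ddag_ord.
  have := congr1 (fun F => F i) (BdAd (fun j => horner p (tau j.+1) - horner p (IZR 1))).
  by rewrite e /mxapp /= => ->; apply: esym; exact: Rplus_minus.
Qed.

End OrdinalCollocation.

(** * The discrete optimality system near the reference trajectory *)

Lemma frozen_lipschitz p (g : vec p -> R) G S (c z y a : vec p) r eps d K :
  has_grad_on g G S -> (forall w, cube c r w -> S w) ->
  (forall w k, cube c r w -> Rabs (G w k - a k) <= eps) -> (forall k, Rabs (a k) <= K) ->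
  cube c r z -> cube c r y -> (forall k, Rabs (z k - y k) <= d) ->
  Rabs (g z - g y) <= INR p * ((K + eps) * d).
Proof.
move=> hg hS heps hK hz hy hd.
have h1 := frozen_linearization hg hS heps hz hy hd.
have h2 : Rabs (\rsum_k (a k * (z k - y k))) <= INR p * K * d by apply: row_bound_entries.
have -> : g z - g y = (g z - g y - \rsum_k (a k * (z k - y k))) + \rsum_k (a k * (z k - y k)) by ring.
by apply: Rle_trans (Rabs_triang _ _) _; lra.
Qed.

(** The linearised system is naturally an operator on structured unknowns, whereas [modified_newton]
    works with a matrix. *)
Lemma linear_matrix (I : finType) (L : (I -> R) -> I -> R) :
  (forall s t v w i, L (fun j => s * v j + t * w j) i = s * L v i + t * L w i) ->
  exists A, forall v, mxapp A v = L v.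
Proof.
move=> hL; pose dl (j i : I) := if i == j then 1 else 0 : R.
exists (fun i j => L (dl j) i) => v; apply: funext => i.
have h s : L (fun k => \big[Rplus/0]_(j <- s) (v j * dl j k)) i = \big[Rplus/0]_(j <- s) (L (dl j) i * v j).
  elim: s => [|j s IH].
    rewrite big_nil; have -> : (fun k => \big[Rplus/0]_(j <- [::]) (v j * dl j k)) = fun k => 0 * v k + 0 * v k.
      by apply: funext => k; rewrite big_nil; ring.
    by rewrite hL; ring.
  rewrite big_cons -IH.
  have -> : (fun k => \big[Rplus/0]_(j <- j :: s) (v j * dl j k))
    = fun k => v j * dl j k + 1 * \big[Rplus/0]_(j <- s) (v j * dl j k).
    by apply: funext => k; rewrite big_cons; ring.
  by rewrite hL; ring.
rewrite /mxapp -h; congr (L _ i); apply: funext => k.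
rewrite -[RHS](rsum_delta v k); apply: eq_bigr => j _.
by rewrite /dl eq_sym; case: eqP => _; ring.
Qed.

Lemma zjoin_lincomb n m s t (x x' : vec n) (u u' : vec m) :
  zjoin (fun i => s * x i + t * x' i) (fun i => s * u i + t * u' i)
  = fun a => s * zjoin x u a + t * zjoin x' u' a.
Proof. by apply: funext => a; rewrite /zjoin; case: fintype.split. Qed.

Lemma jackson_derivatives p k (g g' : R -> vec p) :
  (forall i, Ck_on k.+1 (fun t => g t i)) ->
  (forall i t, -1 <= t <= 1 -> deriv_within (-1) 1 (fun s => g s i) t (g' t i)) ->
  exists c, 0 <= c /\ forall N, (0 < N)%N -> exists q : 'I_p -> {poly R},
    forall i, (size (q i) <= N)%N /\
      forall t, -1 <= t <= 1 -> Rabs (g' t i - horner (q i) t) <= c / INR N ^ k.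
Proof.
move=> hg hd.
have [c hc] := choice _ (fun i => jackson (Ck_deriv (hg i) (fun t ht => hd i t ht))).
exists (supabs c); split=> [|N N0]; first exact: supabs_ge0.
have [q hq] := choice _ (fun i => proj2 (hc i) N N0).
exists q => i; have [sq h] := hq i; split=> // t ht; apply: Rle_trans (h t ht) _.
apply: Rmult_le_compat_r; last by have := supabs_ub c i; have := Rle_abs (c i); lra.
by apply: Rlt_le; apply: Rinv_0_lt_compat; apply: pow_lt; apply: lt_0_INR; apply/ltP.
Qed.

Lemma primitive_error (g g' : R -> R) (P : {poly R}) E s t :
  (forall u, -1 <= u <= 1 -> deriv_within (-1) 1 g u (g' u)) ->
  (forall u, -1 <= u <= 1 -> Rabs (g' u - horner (deriv P) u) <= E) ->
  -1 <= s <= 1 -> -1 <= t <= 1 -> Rabs ((g s - horner P s) - (g t - horner P t)) <= 2 * E.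
Proof.
move=> hg hE hs ht.
have E0 : 0 <= E by apply: Rle_trans (hE s hs); exact: Rabs_pos.
have := deriv_within_lipschitz (g := fun u => g u - horner P u)
  (fun u hu => deriv_withinB (hg u hu) (deriv_within_horner P u)) hE hs ht.
move/Rle_trans; apply; rewrite Rmult_comm; apply: Rmult_le_compat_r => //.
by apply: Rabs_le; lra.
Qed.

Lemma has_grad_on_sum p q (c : 'I_q -> R) (g : 'I_q -> vec p -> R) G S :
  (forall k, has_grad_on (g k) (G k) S) ->
  has_grad_on (fun z => \rsum_k (c k * g k z)) (fun z a => \rsum_k (c k * G k z a)) S.
Proof.
move=> hg z Sz eps eps0.
pose s := \rsum_k Rabs (c k).
have s0 : 0 <= s by apply: rsum_ge0 => k; exact: Rabs_pos.
have e0 : 0 < eps / (s + 1) by apply: Rdiv_lt_0_compat; lra.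
have [d [d0 hd]] := @common_radius 'I_q (fun k d => forall h, vnorm h < d ->
  Rabs (g k (fun i => z i + h i) - g k z - dotv (G k z) h) <= eps / (s + 1) * vnorm h)
  (fun k d d' hdd H h hh => H h (Rlt_le_trans _ _ _ hh (proj2 hdd)))
  (fun k => hg k z Sz _ e0).
exists d; split=> // h hh.
have -> : dotv (fun a => \rsum_k (c k * G k z a)) h = \rsum_k (c k * dotv (G k z) h).
  rewrite /dotv (eq_bigr (fun a => \rsum_k (c k * (G k z a * h a)))) => [|a _]; last first.
    by rewrite -rsumZr; apply: eq_bigr => k _; ring.
  by rewrite rsum_exchange; apply: eq_bigr => k _; rewrite rsumZ.
rewrite -!rsumB (eq_bigr (fun k => c k * (g k (fun i => z i + h i) - g k z - dotv (G k z) h))) => [|k _]; last by ring.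
have n0 := vnorm_ge0 h.
apply: (Rle_trans _ (s * (eps / (s + 1) * vnorm h))).
  apply: row_bound => [||k]; [|exact: Rle_refl|exact: hd].
  by apply: Rmult_le_pos => //; lra.
have -> : s * (eps / (s + 1) * vnorm h) = (s / (s + 1)) * (eps * vnorm h) by field; lra.
rewrite -[X in _ <= X]Rmult_1_l; apply: Rmult_le_compat_r; first by nra.
by apply: (Rmult_le_reg_r (s + 1)); [lra|rewrite /Rdiv Rmult_assoc Rinv_l; lra].
Qed.

Lemma perturbed_coercive p (A A0 : 'I_p -> 'I_p -> R) alpha dl :
  (forall v, alpha * dotv v v <= dotv v (mxapp A0 v)) ->
  (forall a b, Rabs (A a b - A0 a b) <= dl) -> INR p * dl < alpha ->
  forall v, (exists k, v k <> 0) -> 0 < dotv v (mxapp A v).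
Proof.
move=> hA0 hd hp v [k vk].
have vv := dotv_gt0 vk.
have e : dotv v (mxapp A v) = dotv v (mxapp A0 v) + \rsum_a \rsum_b (v a * ((A a b - A0 a b) * v b)).
  rewrite /dotv -rsumD; apply: eq_bigr => a _; rewrite rsumZ -Rmult_plus_distr_l -rsumD.
  by congr (_ * _); apply: eq_bigr => b _; ring.
have dl0 : 0 <= dl by apply: Rle_trans (hd k k); exact: Rabs_pos.
have h : Rabs (\rsum_a \rsum_b (v a * ((A a b - A0 a b) * v b))) <= INR p * dl * dotv v v.
  apply: (Rle_trans _ (\rsum_(a < p) \rsum_(b < p) (dl / 2 * (v a * v a) + dl / 2 * (v b * v b)))).
    apply: rsum_abs_le => a; apply: rsum_abs_le => b.
    rewrite !Rabs_mult; have h1 := hd a b; have va := Rabs_pos (v a); have vb := Rabs_pos (v b).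
    have e1 : v a * v a = Rabs (v a) * Rabs (v a) by rewrite -Rabs_mult Rabs_pos_eq //; exact: Rle_0_sqr.
    have e2 : v b * v b = Rabs (v b) * Rabs (v b) by rewrite -Rabs_mult Rabs_pos_eq //; exact: Rle_0_sqr.
    rewrite e1 e2; move: (Rabs (v a)) (Rabs (v b)) (Rabs (A a b - A0 a b)) va vb h1 => x y z x0 y0 z0.
    have h2 : z * (x * y) <= dl * (x * y) by apply: Rmult_le_compat_r => //; exact: Rmult_le_pos.
    have h3 : dl * (x * y) <= dl * ((x * x + y * y) / 2).
      by apply: Rmult_le_compat_l => //; have := Rle_0_sqr (x - y); rewrite /Rsqr; lra.
    by lra.
  have -> : \rsum_(a < p) \rsum_(b < p) (dl / 2 * (v a * v a) + dl / 2 * (v b * v b))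
    = \rsum_(a < p) (INR p * (dl / 2 * (v a * v a)) + dl / 2 * dotv v v).
    by apply: eq_bigr => a _; rewrite rsumD rsum_const_ord rsumZ.
  rewrite rsumD !rsumZ rsum_const_ord -/(dotv v v); lra.
have := Rabs_bounds h; rewrite e; have := hA0 v; nra.
Qed.

Section Problem.
Variables (n m : nat).
Variables (f : vec n -> vec m -> vec n) (C : vec n -> R).
Variables (Df : vec (n + m) -> 'I_n -> 'I_(n + m) -> R).
Variables (D2f : vec (n + m) -> 'I_n -> 'I_(n + m) -> 'I_(n + m) -> R).
Variables (gradC : vec n -> vec n) (hessC : vec n -> 'I_n -> 'I_n -> R).
Variables (x0 : vec n) (xs : R -> vec n) (us : R -> vec m) (lams : R -> vec n).
Variables (Omega : vec (n + m) -> Prop) (rho : R).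

Definition fjoin (k : 'I_n) (z : vec (n + m)) : R :=
  f (fun i => z (lshift m i)) (fun j => z (rshift n j)) k.
Definition zstar (t : R) : vec (n + m) := zjoin (xs t) (us t).
Definition gradH (z : vec (n + m)) (lam : vec n) (a : 'I_(n + m)) : R := \rsum_k (lam k * Df z k a).

(** One radius that collects what closeness to the reference must provide: the data are
    differentiable there, and the derivatives entering the linearisation vary by at most [eps], for
    [f] along the trajectory and for [C] at its end. *)
Definition tube (r eps : R) : Prop :=
  (forall t z, -1 <= t <= 1 -> cube (zstar t) r z -> Omega z /\
    (forall k a, Rabs (Df z k a - Df (zstar t) k a) <= eps) /\
    (forall k a b, Rabs (D2f z k a b - D2f (zstar t) k a b) <= eps)) /\
  (forall x, cube (xs 1) r x -> open_ball (xs 1) rho x /\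
    forall k l, Rabs (hessC x k l - hessC (xs 1) k l) <= eps).

Lemma tube_le r r' eps : r' <= r -> tube r eps -> tube r' eps.
Proof.
move=> h [h1 h2]; split=> [t z ht hz|x hx]; [apply: h1 => //|apply: h2]; exact: cube_le hz || exact: cube_le hx.
Qed.

(** * Uniform consequences of the smoothness assumptions *)

Section Regularity.
Hypothesis rho0 : 0 < rho.
Hypothesis hOmega : is_open Omega.
Hypothesis hball : forall t, -1 <= t <= 1 -> forall z, vnorm (vsub z (zstar t)) <= rho -> Omega z.
Hypothesis hf : forall k, C2_with (fjoin k) (fun z => Df z k) (fun z => D2f z k) Omega.
Hypothesis hC : C2_with C gradC hessC (open_ball (xs 1) rho).
Hypothesis hxs : forall k t, -1 <= t <= 1 -> cont_within (-1) 1 (fun s => xs s k) t.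
Hypothesis hus : forall j t, -1 <= t <= 1 -> cont_within (-1) 1 (fun s => us s j) t.
Hypothesis hlams : forall k t, -1 <= t <= 1 -> cont_within (-1) 1 (fun s => lams s k) t.

Let sub_closure p (S : vec p -> Prop) z : S z -> Defs.closure S z.
Proof.
move=> Sz eps eps0; exists z; split=> //.
have -> : vsub z z = fun i => 0 * z i by apply: funext => i; rewrite /vsub; ring.
by rewrite vnormZ Rabs_R0; lra.
Qed.

Let cont_sub p (g : vec p -> R) (S : vec p -> Prop) : cont_on g (Defs.closure S) -> cont_on g S.
Proof.
move=> hg z Sz eps eps0; have [d [d0 hd]] := hg z (sub_closure Sz) eps eps0.
by exists d; split=> // w Sw; apply: hd; exact: sub_closure.
Qed.

Let zcont a t : -1 <= t <= 1 -> cont_within (-1) 1 (fun s => zstar s a) t.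
Proof. by move=> ht; rewrite /zstar /zjoin; case: fintype.split => k; [exact: hxs|exact: hus]. Qed.

Let zOmega t : -1 <= t <= 1 -> Omega (zstar t).
Proof.
move=> ht; apply: (hball ht).
have -> : vsub (zstar t) (zstar t) = fun i => 0 * zstar t i.
  by apply: funext => i; rewrite /vsub; ring.
by rewrite vnormZ Rabs_R0; lra.
Qed.

Lemma tube_exists eps : 0 < eps -> exists r, 0 < r /\ tube r eps.
Proof.
move=> eps0.
have p0 := pos_INR (n + m); have n0 := pos_INR n.
pose r1 := rho / (INR (n + m) + 1) / 2.
have r10 : 0 < r1 by do !apply: Rdiv_lt_0_compat; lra.
have r1O t z : -1 <= t <= 1 -> cube (zstar t) r1 z -> Omega z.
  move=> ht hz; apply: (hball ht); apply: Rlt_le; apply: cube_vnorm_lt hz; first by lra.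
  have -> : r1 * (INR (n + m) + 1) = rho / 2 by rewrite /r1; field; lra.
  by lra.
pose r2 := rho / (INR n + 1) / 2.
have r20 : 0 < r2 by do !apply: Rdiv_lt_0_compat; lra.
have r2O x : cube (xs 1) r2 x -> open_ball (xs 1) rho x.
  move=> hx; apply: cube_vnorm_lt hx; first by lra.
  have -> : r2 * (INR n + 1) = rho / 2 by rewrite /r2; field; lra.
  by lra.
have heine (g : vec (n + m) -> R) : cont_on g (Defs.closure Omega) -> exists r, 0 < r /\
    forall t z, -1 <= t <= 1 -> cube (zstar t) r z -> Rabs (g z - g (zstar t)) <= eps.
  by move=> /cont_sub hg; exact: (heine_curve (c := zstar) (S := Omega) zcont hg r10 r1O eps0).
have [e1 [e10 h1]] := @common_radius ('I_n * 'I_(n + m))%type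
  (fun ka r => forall t z, -1 <= t <= 1 -> cube (zstar t) r z ->
     Rabs (Df z ka.1 ka.2 - Df (zstar t) ka.1 ka.2) <= eps)
  (fun ka e e' he h t z ht hz => h t z ht (cube_le (proj2 he) hz))
  (fun ka => heine (fun z => Df z ka.1 ka.2) (proj1 (proj2 (proj2 (hf ka.1))) ka.2)).
have [e2 [e20 h2]] := @common_radius ('I_n * 'I_(n + m) * 'I_(n + m))%type
  (fun ka r => forall t z, -1 <= t <= 1 -> cube (zstar t) r z ->
     Rabs (D2f z ka.1.1 ka.1.2 ka.2 - D2f (zstar t) ka.1.1 ka.1.2 ka.2) <= eps)
  (fun ka e e' he h t z ht hz => h t z ht (cube_le (proj2 he) hz))
  (fun ka => heine (fun z => D2f z ka.1.1 ka.1.2 ka.2) (proj2 (proj2 (proj2 (hf ka.1.1))) ka.1.2 ka.2)).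
have locC k l : exists r, 0 < r /\ forall x, cube (xs 1) r x -> open_ball (xs 1) rho x ->
    Rabs (hessC x k l - hessC (xs 1) k l) <= eps.
  have c1 : open_ball (xs 1) rho (xs 1) by apply: r2O; apply: cube_center; lra.
  have [d [d0 hd]] := cont_sub (proj2 (proj2 (proj2 hC)) k l) c1 eps0.
  exists (d / (INR n + 1) / 2); split; first by do !apply: Rdiv_lt_0_compat; lra.
  move=> x hx hx'; apply: Rlt_le; apply: hd => //; apply: cube_vnorm_lt hx.
    by apply: Rlt_le; do !apply: Rdiv_lt_0_compat; lra.
  have -> : d / (INR n + 1) / 2 * (INR n + 1) = d / 2 by field; lra.
  by lra.
have [e3 [e30 h3]] := @common_radius ('I_n * 'I_n)%type
  (fun kl r => forall x, cube (xs 1) r x -> open_ball (xs 1) rho x ->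
     Rabs (hessC x kl.1 kl.2 - hessC (xs 1) kl.1 kl.2) <= eps)
  (fun kl e e' he h x hx => h x (cube_le (proj2 he) hx))
  (fun kl => locC kl.1 kl.2).
pose r := Rmin (Rmin r1 r2) (Rmin e1 (Rmin e2 e3)).
have l1 : r <= r1 := Rle_trans _ _ _ (Rmin_l _ _) (Rmin_l _ _).
have l2 : r <= r2 := Rle_trans _ _ _ (Rmin_l _ _) (Rmin_r _ _).
have l3 : r <= e1 := Rle_trans _ _ _ (Rmin_r _ _) (Rmin_l _ _).
have l4 : r <= e2 := Rle_trans _ _ _ (Rmin_r _ _) (Rle_trans _ _ _ (Rmin_r _ _) (Rmin_l _ _)).
have l5 : r <= e3 := Rle_trans _ _ _ (Rmin_r _ _) (Rle_trans _ _ _ (Rmin_r _ _) (Rmin_r _ _)).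
exists r; split; first by do !apply: Rmin_glb_lt.
split=> [t z ht hz|x hx]; split.
- exact: r1O ht (cube_le l1 hz).
- split=> [k a|k a b]; first exact: (h1 (k, a) t z ht (cube_le l3 hz)).
  exact: (h2 (k, a, b) t z ht (cube_le l4 hz)).
- exact: r2O (cube_le l2 hx).
- by move=> k l; apply: (h3 (k, l) x (cube_le l5 hx)); apply: r2O (cube_le l2 hx).
Qed.

Lemma problem_bound : exists K, 0 <= K /\
  (forall t k a, -1 <= t <= 1 -> Rabs (Df (zstar t) k a) <= K) /\
  (forall t k a b, -1 <= t <= 1 -> Rabs (D2f (zstar t) k a b) <= K) /\
  (forall t k, -1 <= t <= 1 -> Rabs (lams t k) <= K) /\
  (forall t a b, -1 <= t <= 1 -> Rabs (hessH D2f (xs t) (us t) (lams t) a b) <= K) /\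
  (forall k l, Rabs (hessC (xs 1) k l) <= K).
Proof.
have bnd (g : R -> R) : (forall t, -1 <= t <= 1 -> cont_within (-1) 1 g t) ->
    exists c, 0 <= c /\ forall t, -1 <= t <= 1 -> Rabs (g t) <= c by exact: cont_within_bounded.
have fin (I : finType) (g : I -> R -> R) :
    (forall i, exists c, 0 <= c /\ forall t, -1 <= t <= 1 -> Rabs (g i t) <= c) ->
    exists c, 0 <= c /\ forall i t, -1 <= t <= 1 -> Rabs (g i t) <= c.
  move=> h; have [c hc] := choice _ h.
  exists (supabs c); split=> [|i t ht]; first exact: supabs_ge0.
  apply: Rle_trans (supabs_ub c i); apply: Rle_trans (Rle_abs _); exact: (proj2 (hc i)).
have cz (g : vec (n + m) -> R) : cont_on g (Defs.closure Omega) ->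
    exists c, 0 <= c /\ forall t, -1 <= t <= 1 -> Rabs (g (zstar t)) <= c.
  by move=> /cont_sub hg; apply: bnd => t ht; exact: (cont_within_comp (c := zstar) (S := Omega) zcont hg zOmega ht).
have [c1 [c10 h1]] := fin ('I_n * 'I_(n + m))%type (fun ka t => Df (zstar t) ka.1 ka.2)
  (fun ka => cz (fun z => Df z ka.1 ka.2) (proj1 (proj2 (proj2 (hf ka.1))) ka.2)).
have [c2 [c20 h2]] := fin ('I_n * 'I_(n + m) * 'I_(n + m))%type (fun ka t => D2f (zstar t) ka.1.1 ka.1.2 ka.2)
  (fun ka => cz (fun z => D2f z ka.1.1 ka.1.2 ka.2) (proj2 (proj2 (proj2 (hf ka.1.1))) ka.1.2 ka.2)).
have [c3 [c30 h3]] := fin 'I_n (fun k t => lams t k) (fun k => bnd (fun t => lams t k) (hlams k)).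
pose c4 := INR n * (c3 * c2).
have c40 : 0 <= c4 by apply: Rmult_le_pos; [exact: pos_INR|nra].
pose c5 := supabs (fun kl : 'I_n * 'I_n => hessC (xs 1) kl.1 kl.2).
have c50 : 0 <= c5 by exact: supabs_ge0.
exists (c1 + c2 + c3 + c4 + c5); split; first by lra.
split=> [t k a ht|]; first by have := h1 (k, a) t ht; rewrite /=; lra.
split=> [t k a b ht|]; first by have := h2 (k, a, b) t ht; rewrite /=; lra.
split=> [t k ht|]; first by have := h3 k t ht; lra.
split=> [t a b ht|k l].
  suff : Rabs (hessH D2f (xs t) (us t) (lams t) a b) <= c4 by lra.
  rewrite /c4 -rsum_const_ord; apply: rsum_abs_le => k; rewrite Rabs_mult.
  apply: Rabs_mult_le; [exact: h3|].
  exact: (h2 (k, a, b)).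
by have := supabs_ub (fun kl : 'I_n * 'I_n => hessC (xs 1) kl.1 kl.2) (k, l); rewrite -/c5 /=; lra.
Qed.

(** Symmetry is what turns the lower bound (A2) on eigenvalues into coercivity of the quadratic
    form. *)
Lemma D2f_sym t k a b : -1 <= t <= 1 -> D2f (zstar t) k a b = D2f (zstar t) k b a.
Proof.
move=> ht; have [h1 [h2 [_ h4]]] := hf k.
apply: (schwarz h1 h2) => //.
- exact: hOmega (zOmega ht).
- by move=> c d; apply: cont_sub.
- exact: zOmega.
Qed.

Lemma hessC_sym k l : hessC (xs 1) k l = hessC (xs 1) l k.
Proof.
have [h1 [h2 [_ h4]]] := hC.
apply: (schwarz h1 h2) => //.
- by exists rho.
- by move=> c d; apply: cont_sub.
rewrite /open_ball; have -> : vsub (xs 1) (xs 1) = fun i => 0 * xs 1 i.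
  by apply: funext => i; rewrite /vsub; ring.
by rewrite vnormZ Rabs_R0; lra.
Qed.

Lemma hessH_coercive alpha t : -1 <= t <= 1 ->
  min_eig_gt (hessH D2f (xs t) (us t) (lams t)) alpha ->
  forall v, alpha * dotv v v <= dotv v (mxapp (hessH D2f (xs t) (us t) (lams t)) v).
Proof.
move=> ht; apply: min_eig_coercive => a b; rewrite /hessH; apply: eq_bigr => k _.
by congr (_ * _); exact: D2f_sym.
Qed.

Lemma hessC_coercive alpha : min_eig_gt (hessC (xs 1)) alpha ->
  forall v, alpha * dotv v v <= dotv v (mxapp (hessC (xs 1)) v).
Proof. by apply: min_eig_coercive; exact: hessC_sym. Qed.

End Regularity.

(** * Estimates in the tube *)

Section LocalAnalysis.
Variables (K alpha : R).
Hypothesis K0 : 0 <= K.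
Hypothesis alpha0 : 0 < alpha.
Hypothesis hgrad : forall k, has_grad_on (fjoin k) (fun z => Df z k) Omega.
Hypothesis hgrad2 : forall k a, has_grad_on (fun z => Df z k a) (fun z => D2f z k a) Omega.
Hypothesis hC1 : has_grad_on C gradC (open_ball (xs 1) rho).
Hypothesis hgradC : forall k, has_grad_on (fun z => gradC z k) (fun z => hessC z k) (open_ball (xs 1) rho).
Hypothesis DfK : forall t k a, -1 <= t <= 1 -> Rabs (Df (zstar t) k a) <= K.
Hypothesis D2fK : forall t k a b, -1 <= t <= 1 -> Rabs (D2f (zstar t) k a b) <= K.
Hypothesis lamsK : forall t k, -1 <= t <= 1 -> Rabs (lams t k) <= K.
Hypothesis hessHK : forall t a b, -1 <= t <= 1 -> Rabs (hessH D2f (xs t) (us t) (lams t) a b) <= K.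
Hypothesis hessCK : forall k l, Rabs (hessC (xs 1) k l) <= K.
Hypothesis hessHpos : forall t, -1 <= t <= 1 -> forall v,
  alpha * dotv v v <= dotv v (mxapp (hessH D2f (xs t) (us t) (lams t)) v).
Hypothesis hessCpos : forall v, alpha * dotv v v <= dotv v (mxapp (hessC (xs 1)) v).
Hypothesis rowA3 : forall t k, -1 <= t <= 1 -> \rsum_l Rabs (Df (zstar t) k (lshift m l)) <= 1 / 4.
Hypothesis colA3 : forall t l, -1 <= t <= 1 -> \rsum_k Rabs (Df (zstar t) k (lshift m l)) <= 1 / 4.
Let p := INR (n + m).
Let a0 := INR n.
Let p0 : 0 <= p. Proof. exact: pos_INR. Qed.
Let a00 : 0 <= a0. Proof. exact: pos_INR. Qed.

Section Node.
Variables (r eps : R).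
Hypothesis r0 : 0 <= r.
Hypothesis eps0 : 0 <= eps.
Hypothesis eps1 : eps <= 1.
Hypothesis htube : tube r eps.
Variable t : R.
Hypothesis ht : -1 <= t <= 1.
Let zs := zstar t.

Let inO z : cube zs r z -> Omega z. Proof. by move=> hz; case: (proj1 htube t z ht hz). Qed.
Let dDf z k a : cube zs r z -> Rabs (Df z k a - Df zs k a) <= eps.
Proof. by move=> hz; case: (proj1 htube t z ht hz) => _ [h _]; exact: h. Qed.
Let dD2f z k a b : cube zs r z -> Rabs (D2f z k a b - D2f zs k a b) <= eps.
Proof. by move=> hz; case: (proj1 htube t z ht hz) => _ [_ h]; exact: h. Qed.

Lemma fjoin_remainder k z y d : cube zs r z -> cube zs r y -> (forall a, Rabs (z a - y a) <= d) ->
  Rabs (fjoin k z - fjoin k y - \rsum_a (Df zs k a * (z a - y a))) <= p * (eps * d).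
Proof. by move=> hz hy hd; apply: (frozen_linearization (hgrad k) inO) hz hy hd => w a hw; exact: dDf. Qed.

Lemma fjoin_lipschitz k z y d : cube zs r z -> cube zs r y -> (forall a, Rabs (z a - y a) <= d) ->
  Rabs (fjoin k z - fjoin k y) <= p * ((K + eps) * d).
Proof.
move=> hz hy hd; apply: (frozen_lipschitz (a := Df zs k) (hgrad k) inO _ _ hz hy hd).
  by move=> w a hw; exact: dDf.
by move=> a; exact: DfK.
Qed.

Lemma Df_bound z k a : cube zs r z -> Rabs (Df z k a) <= K + 1.
Proof.
move=> hz; have -> : Df z k a = (Df z k a - Df zs k a) + Df zs k a by ring.
by apply: Rle_trans (Rabs_triang _ _) _; have := dDf k a hz; have := DfK k a ht; rewrite -/zs; lra.
Qed.

Lemma Df_lipschitz k a z y d : cube zs r z -> cube zs r y -> (forall a, Rabs (z a - y a) <= d) ->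
  Rabs (Df z k a - Df y k a) <= p * ((K + eps) * d).
Proof.
move=> hz hy hd; apply: (frozen_lipschitz (a := D2f zs k a) (hgrad2 k a) inO _ _ hz hy hd).
  by move=> w b hw; exact: dD2f.
by move=> b; exact: D2fK.
Qed.

Lemma gradH_lipschitz a z lam d : 0 <= d -> cube zs r z -> cube zs d z -> cube (lams t) d lam ->
  Rabs (gradH z lam a - gradH zs (lams t) a) <= a0 * ((K + 1) + K * (p * (K + 1))) * d.
Proof.
move=> d0 hz hzd hl; rewrite /gradH -rsumB.
have -> : a0 * ((K + 1) + K * (p * (K + 1))) * d
  = \rsum_(k < n) (((K + 1) + K * (p * (K + 1))) * d) by rewrite rsum_const_ord -/a0; ring.
apply: rsum_abs_le => k.
have -> : lam k * Df z k a - lams t k * Df zs k a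
  = (lam k - lams t k) * Df z k a + lams t k * (Df z k a - Df zs k a) by ring.
apply: Rle_trans (Rabs_triang _ _) _; rewrite !Rabs_mult.
have h1 : Rabs (lam k - lams t k) * Rabs (Df z k a) <= d * (K + 1).
  by apply: Rabs_mult_le; [exact: hl|exact: Df_bound].
have h2 : Rabs (lams t k) * Rabs (Df z k a - Df zs k a) <= K * (p * ((K + eps) * d)).
  apply: Rabs_mult_le; [exact: lamsK|].
  by apply: Df_lipschitz => //; apply: cube_center.
have h3 : K * (p * ((K + eps) * d)) <= K * (p * ((K + 1) * d)).
  by do 2 apply: Rmult_le_compat_l => //; apply: Rmult_le_compat_r; lra.
by lra.
Qed.

(** The product [lam * Df] leaves three errors: the remainder of [Df], the distance of [lam] from
    the reference costate times the linear part, and the change of multiplier times the distance of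
    [Df] from its reference. [r <= eps] makes the second of order [eps d]. *)
Lemma gradH_remainder a z y lam mu d : r <= eps -> 0 <= d -> cube zs r z -> cube zs r y ->
  cube (lams t) r lam -> cube (lams t) r mu ->
  (forall a, Rabs (z a - y a) <= d) -> (forall k, Rabs (lam k - mu k) <= d) ->
  Rabs (gradH z lam a - gradH y mu a
    - (mxapp (hessH D2f (xs t) (us t) (lams t)) (fun b => z b - y b) a
       + \rsum_k ((lam k - mu k) * Df zs k a)))
  <= a0 * ((K + 1) * p + p * K + 1) * (eps * d).
Proof.
move=> re d0 hz hy hl hm hd hd'.
have -> : mxapp (hessH D2f (xs t) (us t) (lams t)) (fun b => z b - y b) a
    = \rsum_k (lams t k * \rsum_b (D2f zs k a b * (z b - y b))).
  rewrite /mxapp /hessH.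
  rewrite (eq_bigr (fun b => \rsum_k (lams t k * (D2f zs k a b * (z b - y b))))) => [|b _]; last first.
    by rewrite -rsumZr; apply: eq_bigr => k _; rewrite /zs /zstar; ring.
  by rewrite rsum_exchange; apply: eq_bigr => k _; rewrite rsumZ.
rewrite /gradH -rsumB -rsumD -rsumB.
have -> : a0 * ((K + 1) * p + p * K + 1) * (eps * d)
  = \rsum_(k < n) (((K + 1) * p + p * K + 1) * (eps * d)) by rewrite rsum_const_ord -/a0; ring.
apply: rsum_abs_le => k; set S := \rsum_b _.
have -> : lam k * Df z k a - mu k * Df y k a - (lams t k * S + (lam k - mu k) * Df zs k a)
  = lam k * (Df z k a - Df y k a - S) + (lam k - lams t k) * S + (lam k - mu k) * (Df y k a - Df zs k a).
  by ring.
have hlam : Rabs (lam k) <= K + 1.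
  have -> : lam k = (lam k - lams t k) + lams t k by ring.
  by apply: Rle_trans (Rabs_triang _ _) _; have := hl k; have := lamsK k ht; lra.
have h1 : Rabs (lam k) * Rabs (Df z k a - Df y k a - S) <= (K + 1) * (p * (eps * d)).
  apply: Rabs_mult_le => //.
  by apply: (frozen_linearization (hgrad2 k a) inO) hz hy hd => w b hw; exact: dD2f.
have h2 : Rabs (lam k - lams t k) * Rabs S <= eps * (p * K * d).
  apply: Rabs_mult_le.
    by apply: Rle_trans (hl k) re.
  by apply: row_bound_entries => // b; exact: D2fK.
have h3 : Rabs (lam k - mu k) * Rabs (Df y k a - Df zs k a) <= d * eps.
  by apply: Rabs_mult_le => //; exact: dDf.
apply: Rle_trans (Rabs_triang _ _) _; rewrite Rabs_mult.
have := Rabs_triang (lam k * (Df z k a - Df y k a - S)) ((lam k - lams t k) * S).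
by rewrite !Rabs_mult; lra.
Qed.

Lemma gradC_remainder k x y d : cube (xs 1) r x -> cube (xs 1) r y -> (forall a, Rabs (x a - y a) <= d) ->
  Rabs (gradC x k - gradC y k - \rsum_a (hessC (xs 1) k a * (x a - y a))) <= a0 * (eps * d).
Proof.
move=> hz hy hd; apply: (frozen_linearization (hgradC k)) hz hy hd => [w hw|w a hw].
  by case: (proj2 htube w hw).
by case: (proj2 htube w hw) => _ h; exact: h.
Qed.

Lemma gradC_lipschitz k x y d : cube (xs 1) r x -> cube (xs 1) r y -> (forall a, Rabs (x a - y a) <= d) ->
  Rabs (gradC x k - gradC y k) <= a0 * ((K + eps) * d).
Proof.
move=> hz hy hd; apply: (frozen_lipschitz (a := hessC (xs 1) k) (hgradC k) _ _ _ hz hy hd) => [w hw|w a hw|a].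
- by case: (proj2 htube w hw).
- by case: (proj2 htube w hw) => _ h; exact: h.
- exact: hessCK.
Qed.

End Node.

Section Collocated.
(** There are [N.+1] collocation nodes here, so this [N] is one less than in the theorem; index [i]
    stands for the node [tau_(i+1)]. *)
Variables (N : nat) (t : 'I_N.+1 -> R) (w : 'I_N.+1 -> R) (B Bd : 'I_N.+1 -> 'I_N.+1 -> R).
Hypothesis t_itv : forall i, -1 <= t i <= 1.
Hypothesis t_last : t ord_max = 1.
Hypothesis w0 : forall i, 0 < w i.
Hypothesis w2 : \rsum_i w i = 2.
Hypothesis B1 : forall i, \rsum_j Rabs (B i j) <= 2.
Hypothesis Bd1 : forall i, \rsum_j Rabs (Bd i j) <= 2.
Hypothesis B2 : forall i, \rsum_j (B i j * B i j / w j) <= 2.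
Hypothesis Bd2 : forall i, \rsum_j (Bd i j * Bd i j / w j) <= 2.
Hypothesis BdE : forall i j, w i * Bd i j = - (w j * B j i).
Hypothesis Blast : forall j, B ord_max j = w j.

(* The components of [T] after multiplication by the inverses of [D_{1:N}] and [D^ddag]. *)
Definition state_residual (X : 'I_N.+1 -> vec n) (U : 'I_N.+1 -> vec m) i k :=
  X i k - x0 k - \rsum_j (B i j * fjoin k (zjoin (X j) (U j))).
Definition control_residual (X : 'I_N.+1 -> vec n) (U : 'I_N.+1 -> vec m) (Lam : 'I_N.+1 -> vec n) i c :=
  gradH (zjoin (X i) (U i)) (Lam i) (rshift n c).
Definition costate_residual (X : 'I_N.+1 -> vec n) (U : 'I_N.+1 -> vec m) (Lam : 'I_N.+1 -> vec n) i k :=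
  Lam i k - gradC (X ord_max) k + \rsum_j (Bd i j * gradH (zjoin (X j) (U j)) (Lam j) (lshift m k)).

(** * Newton iteration for the discrete optimality system *)

Section Newton.
Let kap := stability_const n m K alpha.
(** [2 p] bounds the state remainder, the other terms those of the terminal gradient and of the
    gradient of [H]. The factors 2 are row sums of [B] and [Bd]; the sum serves all components at
    once. *)
Definition remainder_const := 2 * p + a0 + 2 * (a0 * ((K + 1) * p + p * K + 1)).

(** State, control and costate at the collocation nodes form one vector of unknowns; the values at
    [tau_0] are eliminated. *)
Let I : finType := ('I_N.+1 * ('I_n + 'I_m + 'I_n))%type.
Let getX (z : I -> R) : 'I_N.+1 -> vec n := fun i k => z (i, inl (inl k)).
Let getU (z : I -> R) : 'I_N.+1 -> vec m := fun i c => z (i, inl (inr c)).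
Let getL (z : I -> R) : 'I_N.+1 -> vec n := fun i k => z (i, inr k).
Let getZ (z : I -> R) i := zjoin (getX z i) (getU z i).

Let T (z : I -> R) (ip : I) : R := match ip with
  | (i, inl (inl k)) => state_residual (getX z) (getU z) i k
  | (i, inl (inr c)) => control_residual (getX z) (getU z) (getL z) i c
  | (i, inr k) => costate_residual (getX z) (getU z) (getL z) i k end.

Let J i := Df (zstar (t i)).
Let Hh i := hessH D2f (xs (t i)) (us (t i)) (lams (t i)).
Let V := hessC (xs 1).
Let G (z : I -> R) i a := mxapp (Hh i) (getZ z i) a + \rsum_k (getL z i k * J i k a).

Let L (z : I -> R) (ip : I) : R := match ip with
  | (i, inl (inl k)) => getX z i k - \rsum_j (B i j * mxapp (J j) (getZ z j) k)
  | (i, inl (inr c)) => G z i (rshift n c)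
  | (i, inr k) => getL z i k - mxapp V (getX z ord_max) k + \rsum_j (Bd i j * G z j (lshift m k)) end.

Let getZ_lincomb s r v v' i : getZ (fun j => s * v j + r * v' j) i = fun a => s * getZ v i a + r * getZ v' i a.
Proof. exact: zjoin_lincomb. Qed.

Let G_lincomb s r v v' i a : G (fun j => s * v j + r * v' j) i a = s * G v i a + r * G v' i a.
Proof.
rewrite /G getZ_lincomb mxapp_lincomb.
have -> : \rsum_k (getL (fun j => s * v j + r * v' j) i k * J i k a)
  = s * \rsum_k (getL v i k * J i k a) + r * \rsum_k (getL v' i k * J i k a).
  by rewrite -!rsumZ -rsumD; apply: eq_bigr => k _; rewrite /getL; ring.
by ring.
Qed.

Let L_lincomb s r v v' ip : L (fun j => s * v j + r * v' j) ip = s * L v ip + r * L v' ip.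
Proof.
case: ip => i [[k|c]|k]; rewrite /L; last 1 first.
- rewrite (mxapp_lincomb V s r (getX v ord_max) (getX v' ord_max)).
  have -> : \rsum_j (Bd i j * G (fun j0 => s * v j0 + r * v' j0) j (lshift m k))
    = s * \rsum_j (Bd i j * G v j (lshift m k)) + r * \rsum_j (Bd i j * G v' j (lshift m k)).
    by rewrite -!rsumZ -rsumD; apply: eq_bigr => j _; rewrite G_lincomb; ring.
  by rewrite /getL; ring.
- have -> : \rsum_j (B i j * mxapp (J j) (getZ (fun j0 => s * v j0 + r * v' j0) j) k)
    = s * \rsum_j (B i j * mxapp (J j) (getZ v j) k) + r * \rsum_j (B i j * mxapp (J j) (getZ v' j) k).
    by rewrite -!rsumZ -rsumD; apply: eq_bigr => j _; rewrite getZ_lincomb mxapp_lincomb; ring.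
  by rewrite /getX; ring.
exact: G_lincomb.
Qed.

Lemma stability_const_gt0 : 0 < kap.
Proof.
have n0 := pos_INR n; have m0 := pos_INR m; have i0 := Rinv_0_lt_compat _ alpha0.
have s0 : 0 <= state_const m K by rewrite /state_const; nra.
have nK : 0 <= INR n * K by nra.
have mK : 0 <= INR m * K by nra.
have nKs : 0 <= INR n * K * state_const m K by nra.
have c0 : 0 <= costate_const n m K by rewrite /costate_const; lra.
have e0 : 0 <= energy_const n m K by rewrite /energy_const; nra.
have w0' : 0 <= weighted_control_const n m K alpha by rewrite /weighted_control_const /Rdiv; nra.
have u0 : 0 <= control_const n m K alpha.
  rewrite /control_const /Rdiv; apply: Rmult_le_pos; last by lra.
  apply: Rmult_le_pos => //; apply: Rplus_le_le_0_compat; first by lra.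
  by apply: Rmult_le_pos; [apply: Rmult_le_pos; lra|lra].
by rewrite /kap /stability_const; nra.
Qed.

Let hessCpos0 v : 0 <= dotv v (mxapp V v).
Proof. by apply: Rle_trans (hessCpos v); apply: Rmult_le_pos; [lra|exact: dotv_ge0]. Qed.

Let L_stable z e : 0 <= e -> (forall i, Rabs (L z i) <= e) -> forall i, Rabs (z i) <= kap * e.
Proof.
move=> e0 he.
have [h1 h2 h3] := @linear_stability n m K alpha K0 alpha0 N w B Bd w0 w2 B1 Bd1 B2 Bd2 BdE Blast
  J Hh V (fun i k c => DfK k c (t_itv i)) (fun i a b => hessHK a b (t_itv i)) hessCK
  (fun i k => rowA3 k (t_itv i)) (fun i l => colA3 l (t_itv i)) (fun i => hessHpos (t_itv i)) hessCpos0
  (getX z) (getU z) (getL z) e e0 (fun i k => he (i, inl (inl k))) (fun i k => he (i, inr k))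
  (fun i c => he (i, inl (inr c))).
by case=> i [[k|c]|k]; [exact: h1|exact: h2|exact: h3].
Qed.

Variables (r eps : R).
Hypothesis r0 : 0 < r.
Hypothesis reps : 2 * r <= eps.
Hypothesis eps1 : eps <= 1.
Hypothesis epsC : remainder_const * eps <= 1 / (2 * kap).
Hypothesis htube : tube (2 * r) eps.

Let near (z : I -> R) := forall i, cube (zstar (t i)) (2 * r) (getZ z i) /\ cube (lams (t i)) (2 * r) (getL z i).

Let getZ_diff (z y : I -> R) d i a : (forall ip, Rabs (z ip - y ip) <= d) -> Rabs (getZ z i a - getZ y i a) <= d.
Proof. by move=> h; rewrite /getZ /zjoin; case: fintype.split => k; exact: h. Qed.

(** Linear parts cancel inside the sums over nodes, so the remainders at the nodes are merely summed
    against rows of [B] and [Bd]; no factor depends on [N]. *)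
Let remainder z y d : 0 <= d -> near z -> near y -> (forall ip, Rabs (z ip - y ip) <= d) ->
  forall ip, Rabs (T z ip - T y ip - L (fun j => z j - y j) ip) <= remainder_const * eps * d.
Proof.
move=> d0 hz hy hd.
have e0 : 0 <= eps by lra.
have r20 : 0 <= 2 * r by lra.
have n0 := a00.
have ed : 0 <= eps * d by nra.
have pK : 0 <= p * K by nra.
pose c := a0 * ((K + 1) * p + p * K + 1).
have c0 : 0 <= c by apply: Rmult_le_pos => //; nra.
have GZ i a : G (fun j => z j - y j) i a = mxapp (Hh i) (fun b => getZ z i b - getZ y i b) a
    + \rsum_k ((getL z i k - getL y i k) * Df (zstar (t i)) k a).
  rewrite /G; congr (mxapp _ _ _ + _); apply: funext => b.
  by rewrite /getZ /zjoin; case: fintype.split.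
have hG i a : Rabs (gradH (getZ z i) (getL z i) a - gradH (getZ y i) (getL y i) a
    - G (fun j => z j - y j) i a) <= c * (eps * d).
  rewrite GZ; have [hz1 hz2] := hz i; have [hy1 hy2] := hy i.
  apply: (gradH_remainder eps1 htube (t_itv i)) => //.
    by move=> b; exact: getZ_diff.
  by move=> k; exact: hd.
case=> i [[k|l]|k]; rewrite /T /L.
- rewrite /state_residual.
  have -> : getX z i k - x0 k - \rsum_j (B i j * fjoin k (zjoin (getX z j) (getU z j)))
      - (getX y i k - x0 k - \rsum_j (B i j * fjoin k (zjoin (getX y j) (getU y j))))
      - (getX (fun j => z j - y j) i k - \rsum_j (B i j * mxapp (J j) (getZ (fun j => z j - y j) j) k))
    = - \rsum_j (B i j * (fjoin k (getZ z j) - fjoin k (getZ y j)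
        - \rsum_a (J j k a * (getZ z j a - getZ y j a)))).
    have -> : \rsum_j (B i j * (fjoin k (getZ z j) - fjoin k (getZ y j)
        - \rsum_a (J j k a * (getZ z j a - getZ y j a))))
      = \rsum_j (B i j * fjoin k (getZ z j)) - \rsum_j (B i j * fjoin k (getZ y j))
        - \rsum_j (B i j * mxapp (J j) (getZ (fun j => z j - y j) j) k).
      rewrite -!rsumB; apply: eq_bigr => j _; rewrite -!Rmult_minus_distr_l; congr (_ * (_ - _)).
      apply: eq_bigr => a _; congr (_ * _).
      by rewrite /getZ /zjoin; case: fintype.split.
    by rewrite /getZ /getX; ring.
  rewrite Rabs_Ropp; apply: (Rle_trans _ (2 * (p * (eps * d)))).
    apply: row_bound => [|//|j]; first by apply: Rmult_le_pos.
    have [hz1 _] := hz j; have [hy1 _] := hy j.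
    apply: (fjoin_remainder htube (t_itv j)) => // a; exact: getZ_diff.
  have ae : 0 <= a0 * (eps * d) by apply: Rmult_le_pos.
  have ce : 0 <= c * (eps * d) by apply: Rmult_le_pos.
  by rewrite /remainder_const -/c; lra.
- apply: Rle_trans (hG i (rshift n l)) _.
  have ae : 0 <= a0 * (eps * d) by apply: Rmult_le_pos.
  have ce : 0 <= c * (eps * d) by apply: Rmult_le_pos.
  have pe : 0 <= p * (eps * d) by apply: Rmult_le_pos.
  by rewrite /remainder_const -/c; lra.
rewrite /costate_residual.
have hX (v : I -> R) : near v -> cube (xs 1) (2 * r) (getX v ord_max).
  move=> hv; have [h _] := hv ord_max => l; have := h (lshift m l).
  by rewrite /getZ zjoin_lshift t_last /zstar zjoin_lshift.
have rC1 := gradC_remainder htube k (hX z hz) (hX y hy) (fun a => hd _).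
have rC2 : Rabs (\rsum_j (Bd i j * (gradH (getZ z j) (getL z j) (lshift m k)
    - gradH (getZ y j) (getL y j) (lshift m k) - G (fun j => z j - y j) j (lshift m k)))) <= 2 * (c * (eps * d)).
  by apply: row_bound => [|//|j]; [apply: Rmult_le_pos|exact: hG].
have -> : getL z i k - gradC (getX z ord_max) k
      + \rsum_j (Bd i j * gradH (zjoin (getX z j) (getU z j)) (getL z j) (lshift m k))
    - (getL y i k - gradC (getX y ord_max) k
      + \rsum_j (Bd i j * gradH (zjoin (getX y j) (getU y j)) (getL y j) (lshift m k)))
    - (getL (fun j => z j - y j) i k - mxapp V (getX (fun j => z j - y j) ord_max) k
      + \rsum_j (Bd i j * G (fun j => z j - y j) j (lshift m k)))
  = - (gradC (getX z ord_max) k - gradC (getX y ord_max) k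
      - \rsum_a (hessC (xs 1) k a * (getX z ord_max a - getX y ord_max a)))
    + \rsum_j (Bd i j * (gradH (getZ z j) (getL z j) (lshift m k)
    - gradH (getZ y j) (getL y j) (lshift m k) - G (fun j => z j - y j) j (lshift m k))).
  have -> : \rsum_j (Bd i j * (gradH (getZ z j) (getL z j) (lshift m k)
      - gradH (getZ y j) (getL y j) (lshift m k) - G (fun j => z j - y j) j (lshift m k)))
    = \rsum_j (Bd i j * gradH (getZ z j) (getL z j) (lshift m k))
      - \rsum_j (Bd i j * gradH (getZ y j) (getL y j) (lshift m k))
      - \rsum_j (Bd i j * G (fun j => z j - y j) j (lshift m k)).
    by rewrite -!rsumB; apply: eq_bigr => j _; ring.
  have -> : mxapp V (getX (fun j => z j - y j) ord_max) k
    = \rsum_a (hessC (xs 1) k a * (getX z ord_max a - getX y ord_max a)) by [].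
  by rewrite /getL /getZ; ring.
apply: Rle_trans (Rabs_triang _ _) _; rewrite Rabs_Ropp.
have pe : 0 <= p * (eps * d) by apply: Rmult_le_pos.
have -> : remainder_const * eps * d = 2 * (p * (eps * d)) + a0 * (eps * d) + 2 * (c * (eps * d)).
  by rewrite /remainder_const -/c; ring.
by rewrite -/a0 in rC1; lra.
Qed.

(** The start lies within [r] of the reference and the iterates within [r] of the start, hence the
    tube of radius [2 r]; [epsC] is the condition that halves the residual. *)
Lemma discrete_newton X0 U0 Lam0 e : 0 <= e -> 2 * kap * e <= r ->
  (forall i, cube (zstar (t i)) r (zjoin (X0 i) (U0 i))) ->
  (forall i, cube (lams (t i)) r (Lam0 i)) ->
  (forall i k, Rabs (state_residual X0 U0 i k) <= e) ->
  (forall i c, Rabs (control_residual X0 U0 Lam0 i c) <= e) ->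
  (forall i k, Rabs (costate_residual X0 U0 Lam0 i k) <= e) ->
  exists X U Lam,
    [/\ forall i k, state_residual X U i k = 0, forall i c, control_residual X U Lam i c = 0
      & forall i k, costate_residual X U Lam i k = 0] /\
    [/\ forall i k, Rabs (X i k - X0 i k) <= 2 * kap * e, forall i c, Rabs (U i c - U0 i c) <= 2 * kap * e
      & forall i k, Rabs (Lam i k - Lam0 i k) <= 2 * kap * e].
Proof.
move=> e0 ker hZ hL rX rU rL.
have kap0 := stability_const_gt0.
have [A hA] := linear_matrix L_lincomb.
pose z0 (ip : I) : R := match ip with
  | (i, inl (inl k)) => X0 i k | (i, inl (inr c)) => U0 i c | (i, inr k) => Lam0 i k end.
have hnear z : (forall ip, Rabs (z ip - z0 ip) <= r) -> near z.
  move=> hz i; have -> : 2 * r = r + r by ring.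
  split; [apply: cube_trans (hZ i) _|apply: cube_trans (hL i) _] => a; last exact: hz.
  exact: (getZ_diff (y := z0)).
have stab z c : 0 <= c -> (forall i, Rabs (mxapp A z i) <= c) -> forall i, Rabs (z i) <= kap * c.
  by rewrite hA; exact: L_stable.
have lin z y d : 0 <= d -> (forall i, Rabs (z i - z0 i) <= r) -> (forall i, Rabs (y i - z0 i) <= r) ->
    (forall i, Rabs (z i - y i) <= d) ->
    forall i, Rabs (T z i - T y i - mxapp A (fun j => z j - y j) i) <= d / (2 * kap).
  move=> d0 hz hy hd ip; rewrite hA.
  apply: Rle_trans (remainder d0 (hnear _ hz) (hnear _ hy) hd ip) _.
  have -> : d / (2 * kap) = 1 / (2 * kap) * d by field; lra.
  exact: Rmult_le_compat_r.
have res ip : Rabs (T z0 ip) <= e by case: ip => i [[k|c]|k]; [exact: rX|exact: rU|exact: rL].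
have [z [hz1 hz2]] := modified_newton kap0 e0 ker stab lin res.
exists (getX z), (getU z), (getL z); split; split=> i k.
- exact: (hz2 (i, inl (inl k))).
- exact: (hz2 (i, inl (inr k))).
- exact: (hz2 (i, inr k)).
- exact: (hz1 (i, inl (inl k))).
- exact: (hz1 (i, inl (inr k))).
- exact: (hz1 (i, inr k)).
Qed.

End Newton.

(** * The polynomial starting point *)

Section StartingPoint.
Hypothesis hx : forall k t, -1 <= t <= 1 ->
  deriv_within (-1) 1 (fun s => xs s k) t (fjoin k (zstar t)).
Hypothesis hlam : forall k t, -1 <= t <= 1 ->
  deriv_within (-1) 1 (fun s => lams s k) t (- gradH (zstar t) (lams t) (lshift m k)).
Hypothesis hx0 : xs (-1) = x0.
Hypothesis hlam1 : lams 1 = gradC (xs 1).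
Hypothesis hu0 : forall t c, -1 <= t <= 1 -> gradH (zstar t) (lams t) (rshift n c) = 0.
Variables (r eps : R).
Hypothesis r0 : 0 <= r.
Hypothesis eps0 : 0 <= eps.
Hypothesis eps1 : eps <= 1.
Hypothesis htube : tube r eps.

Definition gradH_lip_const := a0 * ((K + 1) + K * (p * (K + 1))).
(** Integrating the derivative error [E] over a length of at most 2 costs [2 E]; the costate adds
    the error of the terminal gradient caused by the state error [2 E]. *)
Definition start_const := 2 * a0 * (K + 1) + 2.
Definition residual_const := 2 * (1 + p * (K + 1) * start_const + gradH_lip_const * start_const).

Lemma gradH_lip_const_ge0 : 0 <= gradH_lip_const.
Proof.
apply: Rmult_le_pos => //; apply: Rplus_le_le_0_compat; first by lra.
by apply: Rmult_le_pos => //; apply: Rmult_le_pos; lra.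
Qed.

Lemma start_const_ge : 2 <= start_const.
Proof. by rewrite /start_const; have : 0 <= a0 * (K + 1) by [apply: Rmult_le_pos; lra]; lra. Qed.

Variables (P Q : 'I_n -> {poly R}) (E : R).
Hypothesis E0 : 0 <= E.
Hypothesis Er : start_const * E <= r.
Hypothesis PE : forall k t, -1 <= t <= 1 -> Rabs (fjoin k (zstar t) - horner (deriv (P k)) t) <= E.
Hypothesis QE : forall k t, -1 <= t <= 1 ->
  Rabs (- gradH (zstar t) (lams t) (lshift m k) - horner (deriv (Q k)) t) <= E.
Hypothesis P0 : forall k, horner (P k) (IZR (-1)) = x0 k.
(** The terminal costate is [grad C] at the endpoint of the state polynomial rather than at [xs 1];
    with this choice the terminal terms of the costate residual cancel exactly. *)
Let X1 : vec n := fun k => horner (P k) (IZR 1).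
Hypothesis Q1 : forall k, horner (Q k) (IZR 1) = gradC X1 k.
Hypothesis PB : forall k i, horner (P k) (t i) = horner (P k) (IZR (-1)) + \rsum_j (B i j * horner (deriv (P k)) (t j)).
Hypothesis QB : forall k i, horner (Q k) (t i) = horner (Q k) (IZR 1) + \rsum_j (Bd i j * horner (deriv (Q k)) (t j)).

Let X i : vec n := fun k => horner (P k) (t i).
Let U i : vec m := us (t i).
Let Lam i : vec n := fun k => horner (Q k) (t i).

Let P_error k s : -1 <= s <= 1 -> Rabs (horner (P k) s - xs s k) <= 2 * E.
Proof.
move=> hs; have := primitive_error (s := s) (t := -1) (hx k) (PE k) hs ltac:(lra).
rewrite P0 hx0 Rminus_diag Rminus_0_r => h.
by rewrite Rabs_minus_sym.
Qed.

Let two_E : 2 * E <= start_const * E.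
Proof. by apply: Rmult_le_compat_r => //; exact: start_const_ge. Qed.

Lemma final_gradient_error x d k : cube (xs 1) r x -> cube (xs 1) d x ->
  Rabs (gradC x k - lams 1 k) <= a0 * (K + 1) * d.
Proof.
move=> hxr hxd.
have d0 : 0 <= d by apply: Rle_trans (hxd k); exact: Rabs_pos.
have := gradC_lipschitz htube k hxr (cube_center (xs 1) r0) hxd.
rewrite hlam1 => h; apply: Rle_trans h _; rewrite Rmult_assoc; apply: Rmult_le_compat_l => //.
by apply: Rmult_le_compat_r; lra.
Qed.

Let Q_error k s : -1 <= s <= 1 -> Rabs (horner (Q k) s - lams s k) <= start_const * E.
Proof.
move=> hs; have := primitive_error (s := s) (t := 1) (hlam k) (QE k) hs ltac:(lra).
have h1 : Rabs (gradC X1 k - lams 1 k) <= a0 * (K + 1) * (2 * E).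
  apply: final_gradient_error => l; last by apply: P_error; lra.
  by apply: Rle_trans (P_error l _) _; lra.
rewrite Q1 Rabs_minus_sym => h2.
have -> : horner (Q k) s - lams s k = (lams 1 k - gradC X1 k - (lams s k - horner (Q k) s)) + (gradC X1 k - lams 1 k).
  by ring.
apply: Rle_trans (Rabs_triang _ _) _; rewrite /start_const.
by lra.
Qed.

Lemma start_near i : cube (zstar (t i)) (start_const * E) (zjoin (X i) (U i)) /\
  cube (lams (t i)) (start_const * E) (Lam i).
Proof.
split=> [a|k]; last exact: Q_error.
rewrite /zstar /zjoin; case: fintype.split => k; first by apply: Rle_trans two_E; exact: P_error.
by rewrite /U Rminus_diag Rabs_R0; have := two_E; lra.
Qed.

Let near_r i : cube (zstar (t i)) r (zjoin (X i) (U i)).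
Proof. exact: cube_le Er (proj1 (start_near i)). Qed.

Let dE0 : 0 <= start_const * E. Proof. by have := two_E; lra. Qed.

Let state_term_ge0 : 0 <= p * (K + 1) * (start_const * E).
Proof. by apply: Rmult_le_pos => //; apply: Rmult_le_pos; lra. Qed.

Let costate_term_ge0 : 0 <= gradH_lip_const * (start_const * E).
Proof. by apply: Rmult_le_pos => //; exact: gradH_lip_const_ge0. Qed.

Let G_error i a : Rabs (gradH (zjoin (X i) (U i)) (Lam i) a - gradH (zstar (t i)) (lams (t i)) a)
  <= gradH_lip_const * (start_const * E).
Proof.
have [h1 h2] := start_near i.
exact: (gradH_lipschitz r0 eps1 htube (t_itv i)).
Qed.

(** [PB] writes the nodal values as [B] applied to [P'], so the residual is [B] applied to the
    defect [P' - f]: the approximation error plus a Lipschitz term, with row sums at most 2. *)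
Lemma start_state_residual i k : Rabs (state_residual X U i k) <= residual_const * E.
Proof.
rewrite /state_residual /X PB P0.
have -> : x0 k + \rsum_j (B i j * horner (deriv (P k)) (t j)) - x0 k
    - \rsum_j (B i j * fjoin k (zjoin (X j) (U j)))
  = \rsum_j (B i j * (horner (deriv (P k)) (t j) - fjoin k (zjoin (X j) (U j)))).
  have -> : \rsum_j (B i j * (horner (deriv (P k)) (t j) - fjoin k (zjoin (X j) (U j))))
    = \rsum_j (B i j * horner (deriv (P k)) (t j)) - \rsum_j (B i j * fjoin k (zjoin (X j) (U j))).
    by rewrite -rsumB; apply: eq_bigr => j _; ring.
  by ring.
have h3 := state_term_ge0; have h4 := costate_term_ge0.
apply: (Rle_trans _ (2 * (E + p * (K + 1) * (start_const * E)))); last first.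
  by rewrite /residual_const; lra.
apply: row_bound => // [|j]; first by lra.
have -> : horner (deriv (P k)) (t j) - fjoin k (zjoin (X j) (U j))
  = - (fjoin k (zstar (t j)) - horner (deriv (P k)) (t j))
    - (fjoin k (zjoin (X j) (U j)) - fjoin k (zstar (t j))) by ring.
apply: Rle_trans (Rabs_triang _ _) _; rewrite !Rabs_Ropp; apply: Rplus_le_compat; first exact: PE.
have [h1 _] := start_near j.
apply: Rle_trans (fjoin_lipschitz htube (t_itv j) k (near_r j) (cube_center _ r0) h1) _.
rewrite Rmult_assoc; apply: Rmult_le_compat_l => //.
by apply: Rmult_le_compat_r => //; lra.
Qed.

Lemma start_control_residual i c : Rabs (control_residual X U Lam i c) <= residual_const * E.
Proof.
have := G_error i (rshift n c); rewrite hu0 // Rminus_0_r => h; apply: Rle_trans h _.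
have h3 := state_term_ge0; have h4 := costate_term_ge0.
by rewrite /residual_const; lra.
Qed.

Lemma start_costate_residual i k : Rabs (costate_residual X U Lam i k) <= residual_const * E.
Proof.
rewrite /costate_residual.
have -> : X ord_max = X1 by rewrite /X t_last.
rewrite /Lam QB Q1.
have -> : gradC X1 k + \rsum_j (Bd i j * horner (deriv (Q k)) (t j)) - gradC X1 k
    + \rsum_j (Bd i j * gradH (zjoin (X j) (U j)) (Lam j) (lshift m k))
  = \rsum_j (Bd i j * (horner (deriv (Q k)) (t j) + gradH (zjoin (X j) (U j)) (Lam j) (lshift m k))).
  have -> : \rsum_j (Bd i j * (horner (deriv (Q k)) (t j) + gradH (zjoin (X j) (U j)) (Lam j) (lshift m k)))
    = \rsum_j (Bd i j * horner (deriv (Q k)) (t j))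
      + \rsum_j (Bd i j * gradH (zjoin (X j) (U j)) (Lam j) (lshift m k)).
    by rewrite -rsumD; apply: eq_bigr => j _; ring.
  by ring.
have h3 := state_term_ge0; have h4 := costate_term_ge0.
apply: (Rle_trans _ (2 * (E + gradH_lip_const * (start_const * E)))); last first.
  by rewrite /residual_const; lra.
apply: row_bound => // [|j]; first by lra.
set g := gradH (zjoin (X j) (U j)) _ _; set gs := gradH (zstar (t j)) (lams (t j)) (lshift m k).
have -> : horner (deriv (Q k)) (t j) + g = - (- gs - horner (deriv (Q k)) (t j)) + (g - gs) by ring.
apply: Rle_trans (Rabs_triang _ _) _; rewrite Rabs_Ropp; apply: Rplus_le_compat; first exact: QE.
exact: G_error.
Qed.

Hypothesis Qw : forall k, \rsum_i (w i * horner (deriv (Q k)) (t i)) = horner (Q k) (IZR 1) - horner (Q k) (IZR (-1)).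

Definition initial_costate_const := a0 * (K + 1) + 2 * gradH_lip_const.

(** The recovered [Lambda_0] is compared with [lams (-1)] through the exact quadrature of [Q']. The
    contributions are the terminal gradient, the change of [grad H] at the nodes, and twice [2 E]:
    once from the quadrature of the error of [Q'], once from its integral. *)
Lemma initial_costate_error (Y : 'I_N.+1 -> vec n) (V : 'I_N.+1 -> vec m) (Mu : 'I_N.+1 -> vec n) d k :
  d <= r -> 0 <= d ->
  (forall i, cube (zstar (t i)) d (zjoin (Y i) (V i))) -> (forall i, cube (lams (t i)) d (Mu i)) ->
  Rabs (gradC (Y ord_max) k + \rsum_i (w i * gradH (zjoin (Y i) (V i)) (Mu i) (lshift m k)) - lams (-1) k)
    <= initial_costate_const * d + 4 * E.
Proof.
move=> dr d0 hY hM.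
have hX : cube (xs 1) d (Y ord_max).
  by move=> l; have := hY ord_max (lshift m l); rewrite t_last /zstar !zjoin_lshift.
have h1 := final_gradient_error k (cube_le dr hX) hX.
have wb (F : 'I_N.+1 -> R) s : 0 <= s -> (forall i, Rabs (F i) <= s) -> Rabs (\rsum_i (w i * F i)) <= 2 * s.
  move=> s0 hF; apply: row_bound => //; apply: Req_le; rewrite -w2; apply: eq_bigr => i _.
  by apply: Rabs_pos_eq; exact: Rlt_le.
pose gs i := gradH (zstar (t i)) (lams (t i)) (lshift m k).
pose g i := gradH (zjoin (Y i) (V i)) (Mu i) (lshift m k).
have h2 : Rabs (\rsum_i (w i * (g i - gs i))) <= 2 * (gradH_lip_const * d).
  apply: wb => [|i]; first by apply: Rmult_le_pos => //; exact: gradH_lip_const_ge0.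
  by apply: (gradH_lipschitz r0 eps1 htube (t_itv i)) => //; exact: cube_le (hY i).
have h3 : Rabs (\rsum_i (w i * (- gs i - horner (deriv (Q k)) (t i)))) <= 2 * E by apply: wb => // i; exact: QE.
have h4 := primitive_error (s := 1) (t := -1) (hlam k) (QE k) ltac:(lra) ltac:(lra).
have e : \rsum_i (w i * g i) = \rsum_i (w i * (g i - gs i)) - \rsum_i (w i * (- gs i - horner (deriv (Q k)) (t i)))
    - (horner (Q k) (IZR 1) - horner (Q k) (IZR (-1))).
  by rewrite -Qw -!rsumB; apply: eq_bigr => i _; ring.
rewrite -/(g _) e.
have -> : gradC (Y ord_max) k + (\rsum_i (w i * (g i - gs i)) - \rsum_i (w i * (- gs i - horner (deriv (Q k)) (t i)))
    - (horner (Q k) (IZR 1) - horner (Q k) (IZR (-1)))) - lams (-1) k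
  = (gradC (Y ord_max) k - lams 1 k) + \rsum_i (w i * (g i - gs i))
    - \rsum_i (w i * (- gs i - horner (deriv (Q k)) (t i)))
    + (lams 1 k - horner (Q k) (IZR 1) - (lams (-1) k - horner (Q k) (IZR (-1)))) by ring.
rewrite /initial_costate_const.
move: (gradC _ _ - _) (\rsum_i _) (\rsum_i _) (lams 1 k - _ - _) h1 h2 h3 h4 => A1 A3 A2 A4 h1 h2 h3 h4.
have := Rabs_triang (A1 + A2 - A3) A4; have := Rabs_triang (A1 + A2) (- A3); have := Rabs_triang A1 A2.
by rewrite Rabs_Ropp -/(Rminus _ _); lra.
Qed.

End StartingPoint.

(** * Strict minimality from convexity of the Lagrangian *)

Section StrictMinimum.
Variables (r eps : R).
Hypothesis reps : r <= eps.
Hypothesis eps1 : eps <= 1.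
Hypothesis eps0 : 0 <= eps.
Hypothesis htube : tube r eps.

(** Perturbation allowed by [perturbed_coercive]: the first summand for the Hessian of [H], whose
    entries move by at most [n (2K + 1) eps], the second for that of [C]. *)
Definition convexity_const := INR (n + m) * (INR n * (2 * K + 1)) + INR n.
Hypothesis epsA : convexity_const * eps < alpha.

(** The multiplier is the discrete one, held fixed; it is close enough to [lams s] for the Hessian
    of [lam . f] to remain positive definite on the cube. *)
Let convex_H s lam z y : -1 <= s <= 1 -> cube (lams s) r lam ->
  cube (zstar s) r z -> cube (zstar s) r y -> z <> y ->
  0 < \rsum_k (lam k * fjoin k z) - \rsum_k (lam k * fjoin k y) - dotv (gradH y lam) (vsub z y).
Proof.
move=> ht hl hz hy zy.
apply: (convex_remainder (G := fun z a => gradH z lam a)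
  (Hs := fun z a b => \rsum_k (lam k * D2f z k a b)) (S := Omega) (c := zstar s) (r := r)
  (g := fun z => \rsum_k (lam k * fjoin k z))) => //.
- exact: has_grad_on_sum hgrad.
- by move=> a; apply: (has_grad_on_sum lam (G := fun k z => D2f z k a)) => k; exact: hgrad2.
- by move=> z1 hw; case: (proj1 htube s z1 ht hw).
move=> z1 v hw; apply: (perturbed_coercive (dl := INR n * ((2 * K + 1) * eps)) (hessHpos ht)).
  move=> a b; rewrite /hessH -rsumB -rsum_const_ord; apply: rsum_abs_le => k.
  rewrite -/(zstar s).
  have -> : lam k * D2f z1 k a b - lams s k * D2f (zstar s) k a b
    = (lam k - lams s k) * D2f z1 k a b + lams s k * (D2f z1 k a b - D2f (zstar s) k a b) by ring.
  have [_ [_ /(_ k a b) h1]] := proj1 htube s z1 ht hw.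
  have h2 : Rabs (D2f z1 k a b) <= K + 1.
    have -> : D2f z1 k a b = (D2f z1 k a b - D2f (zstar s) k a b) + D2f (zstar s) k a b by ring.
    by apply: Rle_trans (Rabs_triang _ _) _; have := D2fK k a b ht; lra.
  have h3 : Rabs (lam k - lams s k) * Rabs (D2f z1 k a b) <= eps * (K + 1).
    by apply: Rabs_mult_le => //; exact: Rle_trans (hl k) reps.
  have h4 : Rabs (lams s k) * Rabs (D2f z1 k a b - D2f (zstar s) k a b) <= K * eps.
    by apply: Rabs_mult_le => //; exact: lamsK.
  by apply: Rle_trans (Rabs_triang _ _) _; rewrite !Rabs_mult; lra.
have : 0 <= INR n * eps by apply: Rmult_le_pos => //; exact: pos_INR.
by move: epsA; rewrite /convexity_const; lra.
Qed.

Let convex_C x y : cube (xs 1) r x -> cube (xs 1) r y -> x <> y -> 0 < C x - C y - dotv (gradC y) (vsub x y).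
Proof.
move=> hx hy xy.
apply: (convex_remainder hC1 hgradC _ _ hx hy xy) => [z1 hw|z1 v hw].
  by case: (proj2 htube z1 hw).
apply: (perturbed_coercive (dl := eps) hessCpos) => [a b|].
  by case: (proj2 htube z1 hw) => _ h; exact: h.
have : 0 <= INR (n + m) * (INR n * (2 * K + 1)) * eps.
  apply: Rmult_le_pos => //; apply: Rmult_le_pos; first exact: pos_INR.
  by apply: Rmult_le_pos; [exact: pos_INR|lra].
by move: epsA; rewrite /convexity_const; lra.
Qed.

Variables (X : 'I_N.+1 -> vec n) (U : 'I_N.+1 -> vec m) (Lam : 'I_N.+1 -> vec n).
Hypothesis rX : forall i k, state_residual X U i k = 0.
Hypothesis rU : forall i c, control_residual X U Lam i c = 0.
Hypothesis rL : forall i k, costate_residual X U Lam i k = 0.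
Hypothesis nearX : forall i, cube (zstar (t i)) r (zjoin (X i) (U i)).
Hypothesis nearL : forall i, cube (lams (t i)) r (Lam i).
Variables (X' : 'I_N.+1 -> vec n) (U' : 'I_N.+1 -> vec m).
Hypothesis rX' : forall i k, state_residual X' U' i k = 0.
Hypothesis nearX' : forall i, cube (zstar (t i)) r (zjoin (X' i) (U' i)).

Let Z i := zjoin (X i) (U i).
Let Z' i := zjoin (X' i) (U' i).

(* Stationarity makes the linear part of the Lagrangian vanish along feasible differences. *)
Lemma objective_difference : C (X' ord_max) - C (X ord_max) =
  (C (X' ord_max) - C (X ord_max) - dotv (gradC (X ord_max)) (vsub (X' ord_max) (X ord_max)))
  + \rsum_i (w i * (\rsum_k (Lam i k * fjoin k (Z' i)) - \rsum_k (Lam i k * fjoin k (Z i))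
      - dotv (gradH (Z i) (Lam i)) (vsub (Z' i) (Z i)))).
Proof.
pose y k i := fjoin k (Z' i) - fjoin k (Z i).
have dX i k : X' i k - X i k = \rsum_j (B i j * y k j).
  have := rX i k; have := rX' i k; rewrite /state_residual => h1 h2.
  have -> : \rsum_j (B i j * y k j) = \rsum_j (B i j * fjoin k (Z' j)) - \rsum_j (B i j * fjoin k (Z j)).
    by rewrite -rsumB; apply: eq_bigr => j _; rewrite /y; ring.
  by rewrite /Z /Z'; lra.
pose gx k i := gradH (Z i) (Lam i) (lshift m k).
have hlam k i : Lam i k = gradC (X ord_max) k - \rsum_j (Bd i j * gx k j).
  by have := rL i k; rewrite /costate_residual /gx /Z; lra.
have gdot i : dotv (gradH (Z i) (Lam i)) (vsub (Z' i) (Z i)) = \rsum_k (gx k i * (X' i k - X i k)).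
  rewrite /dotv rsum_split [X in _ + X]rsum0; last first.
    by move=> c; have := rU i c; rewrite /control_residual /Z => ->; ring.
  by rewrite Rplus_0_r; apply: eq_bigr => k _; rewrite /vsub /Z /Z' !zjoin_lshift.
(* Summation by parts, [w_i B_ij = - w_j Bd_ji]. *)
have adj k : \rsum_i (w i * (gx k i * (X' i k - X i k))) = - \rsum_i (w i * (y k i * \rsum_j (Bd i j * gx k j))).
  rewrite -rsumN.
  have -> : \rsum_i (w i * (gx k i * (X' i k - X i k))) = \rsum_i \rsum_j (w i * B i j * y k j * gx k i).
    apply: eq_bigr => i _; rewrite dX.
    have -> : w i * (gx k i * \rsum_j (B i j * y k j)) = w i * gx k i * \rsum_j (B i j * y k j) by ring.
    by rewrite -rsumZ; apply: eq_bigr => j _; ring.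
  rewrite rsum_exchange; apply: eq_bigr => i _.
  have -> : - (w i * (y k i * \rsum_j (Bd i j * gx k j))) = - (w i * y k i) * \rsum_j (Bd i j * gx k j) by ring.
  rewrite -rsumZ; apply: eq_bigr => j _.
  have -> : - (w i * y k i) * (Bd i j * gx k j) = - (w i * Bd i j) * y k i * gx k j by ring.
  by rewrite BdE; ring.
(* After cancellation only the constant part [grad C (X_N)] of the costate is left; the last row of
   [B] is [w], so it pairs with [X'_N - X_N]. *)
have lin : \rsum_i (w i * (\rsum_k (Lam i k * fjoin k (Z' i)) - \rsum_k (Lam i k * fjoin k (Z i))
      - dotv (gradH (Z i) (Lam i)) (vsub (Z' i) (Z i))))
    = dotv (gradC (X ord_max)) (vsub (X' ord_max) (X ord_max)).
  rewrite (eq_bigr (fun i => \rsum_k (w i * (gradC (X ord_max) k * y k i)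
      - w i * (y k i * \rsum_j (Bd i j * gx k j)) - w i * (gx k i * (X' i k - X i k))))) => [|i _]; last first.
    rewrite gdot -!rsumB -rsumZ; apply: eq_bigr => k _; rewrite {1 2}hlam /y; ring.
  rewrite rsum_exchange; apply: eq_bigr => k _; rewrite !rsumB adj /vsub dX.
  have -> : \rsum_j (B ord_max j * y k j) = \rsum_i (w i * y k i) by apply: eq_bigr => j _; rewrite Blast.
  have -> : \rsum_i (w i * (gradC (X ord_max) k * y k i)) = gradC (X ord_max) k * \rsum_i (w i * y k i).
    by rewrite -rsumZ; apply: eq_bigr => i _; ring.
  by ring.
by rewrite lin; ring.
Qed.

Lemma strict_minimum : (forall i, X' i = X i /\ U' i = U i) \/ C (X ord_max) < C (X' ord_max).
Proof.
case: (classic (forall i, Z' i = Z i)) => [hZ|hZ]; [left=> i|right].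
  split; apply: funext => k.
    by have := congr1 (fun z => z (lshift m k)) (hZ i); rewrite /Z /Z' !zjoin_lshift.
  by have := congr1 (fun z => z (rshift n k)) (hZ i); rewrite /Z /Z' !zjoin_rshift.
have [i0 hi0] := not_all_ex_not _ _ hZ.
suff : 0 < C (X' ord_max) - C (X ord_max) by lra.
rewrite objective_difference.
have hlast (Y : 'I_N.+1 -> vec n) (V : 'I_N.+1 -> vec m) :
    (forall i, cube (zstar (t i)) r (zjoin (Y i) (V i))) -> cube (xs 1) r (Y ord_max).
  by move=> h l; have := h ord_max (lshift m l); rewrite t_last /zstar !zjoin_lshift.
have c0 : 0 <= C (X' ord_max) - C (X ord_max) - dotv (gradC (X ord_max)) (vsub (X' ord_max) (X ord_max)).
  case: (classic (X' ord_max = X ord_max)) => [->|ne].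
    by rewrite /dotv rsum0 => [|k]; rewrite /vsub; lra.
  by apply: Rlt_le; apply: convex_C ne; [exact: hlast nearX'|exact: hlast nearX].
pose F i := w i * (\rsum_k (Lam i k * fjoin k (Z' i)) - \rsum_k (Lam i k * fjoin k (Z i))
  - dotv (gradH (Z i) (Lam i)) (vsub (Z' i) (Z i))).
rewrite -[X in _ + X]/(\rsum_i F i).
have F0 i : 0 <= F i.
  apply: Rmult_le_pos; first exact: Rlt_le.
  case: (classic (Z' i = Z i)) => [->|ne]; last by apply: Rlt_le; apply: (convex_H (t_itv i)).
  by rewrite /dotv (rsum0 (F := fun a => gradH (Z i) (Lam i) a * vsub (Z i) (Z i) a)) => [|k]; rewrite /vsub; lra.
have F1 : 0 < F i0 by apply: Rmult_lt_0_compat => //; apply: (convex_H (t_itv i0)).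
by have := rsum_term i0 F0; lra.
Qed.

End StrictMinimum.

End Collocated.
End LocalAnalysis.

End Problem.

(** * Convergence *)

(** Ordinal [i] becomes node [i + 1], and index 0 receives the first argument: the initial state,
    the recovered initial costate, or a default control. *)
Definition extend p M (x0 : vec p) (X : 'I_M.+1 -> vec p) : nat -> vec p :=
  fun i => if i is j.+1 then X (inord j) else x0.

Lemma extendS p M (x0 : vec p) (X : 'I_M.+1 -> vec p) (i : 'I_M.+1) : extend x0 X i.+1 = X i.
Proof. by rewrite /extend inord_val. Qed.

Lemma extend_ind p M (x0 : vec p) (X : 'I_M.+1 -> vec p) (Pr : nat -> vec p -> Prop) :
  Pr 0%N x0 -> (forall j : 'I_M.+1, Pr j.+1 (X j)) -> forall i, (i <= M.+1)%N -> Pr i (extend x0 X i).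
Proof.
move=> h0 hS [|i] iM //; have -> : i.+1 = (Ordinal iM).+1 by [].
by rewrite extendS.
Qed.

Lemma fjoin_zjoin n m (f : vec n -> vec m -> vec n) k x u : fjoin f k (zjoin x u) = f x u k.
Proof.
rewrite /fjoin; congr (f _ _ k); apply: funext => i.
  by rewrite zjoin_lshift.
by rewrite zjoin_rshift.
Qed.

(** * From the integrated system back to the collocation equations *)

Section Conversion.
Variables (n m : nat).
Variables (f : vec n -> vec m -> vec n).
Variables (Df : vec (n + m) -> 'I_n -> 'I_(n + m) -> R).
Variables (gradC : vec n -> vec n) (x0 : vec n).
Variables (M : nat) (tau omega : nat -> R) (D : nat -> nat -> R).
Let N := M.+1.
Hypothesis M0 : (0 < M)%N.
Hypothesis hR : Radau N tau omega.
Hypothesis hD : Dmat_spec N tau D.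
Let A (i j : 'I_N) := D i.+1 j.+1.
Let Ad (i j : 'I_N) := Ddag omega D i.+1 j.+1.
Variables (B Bd : 'I_N -> 'I_N -> R).
Hypothesis AB : forall v, mxapp A (mxapp B v) = v.
Hypothesis BA : forall v, mxapp B (mxapp A v) = v.
Hypothesis AdBd : forall v, mxapp Ad (mxapp Bd v) = v.

(** The rows of [D] sum to zero, so the column of [X_0] is removed by subtracting [x0] from all
    nodes. *)
Let state_eq (X : nat -> vec n) (i : 'I_N) k : X 0%N = x0 ->
  sumR 0 N (fun j => D i.+1 j * X j k) = mxapp A (fun j => X j.+1 k - x0 k) i.
Proof.
move=> hX; rewrite sumR0E hX.
have h : D i.+1 0%N + \rsum_j A i j = 0 := Dmat_row_sum hR hD i.
have -> : D i.+1 0%N = - \rsum_j A i j by lra.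
rewrite /mxapp -Ropp_mult_distr_l -rsumZr -rsumN -rsumD; apply: eq_bigr => j _.
by rewrite /A; ring.
Qed.

Lemma feasible_residual (X : nat -> vec n) (U : nat -> vec m) : feasible_NLP f x0 N D X U ->
  forall i k, state_residual f x0 B (fun i : 'I_N => X i.+1) (fun i : 'I_N => U i.+1) i k = 0.
Proof.
move=> [h1 h2] i k; rewrite /state_residual.
have e : mxapp A (fun j => X j.+1 k - x0 k) = fun j : 'I_N => fjoin f k (zjoin (X j.+1) (U j.+1)).
  apply: funext => j; rewrite -state_eq // fjoin_zjoin; apply: h1.
  by rewrite /= ltn_ord.
have := congr1 (fun F => F i) (BA (fun j => X j.+1 k - x0 k)); rewrite e /mxapp => ->.
by ring.
Qed.

Variables (X : 'I_N -> vec n) (U : 'I_N -> vec m) (Lam : 'I_N -> vec n) (u0 : vec m).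
Hypothesis rX : forall i k, state_residual f x0 B X U i k = 0.
Hypothesis rU : forall i c, control_residual Df X U Lam i c = 0.
Hypothesis rL : forall i k, costate_residual Df gradC Bd X U Lam i k = 0.

Lemma extend_feasible : feasible_NLP f x0 N D (extend x0 X) (extend u0 U).
Proof.
have key (i : 'I_N) k : sumR 0 N (fun j => D i.+1 j * extend x0 X j k)
    = f (extend x0 X i.+1) (extend u0 U i.+1) k.
  rewrite state_eq // !extendS -fjoin_zjoin.
  have e : (fun j : 'I_N => extend x0 X j.+1 k - x0 k) = mxapp B (fun j => fjoin f k (zjoin (X j) (U j))).
    by apply: funext => j; rewrite extendS; exact: Rminus_diag_uniq (rX j k).
  by rewrite e AB.
by split=> // -[|i'] k // iN; exact: (key (Ordinal iN) k).
Qed.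

Let lam0 : vec n := fun k => gradC (X ord_max) k
  + \rsum_(i < N) (omega i.+1 * gradH Df (zjoin (X i) (U i)) (Lam i) (lshift m k)).

(** [Ddag] inverts [Bd] on the variable part of the costate, and its row sum acts on the constant
    part [grad C (X_N)]. The row sum is zero except in the last row, so the interior and the
    terminal equation arise together. *)
Let costate_eq (i : 'I_N) k :
  sumR 1 N (fun j => Ddag omega D i.+1 j * extend lam0 Lam j k) + gradH Df (zjoin (X i) (U i)) (Lam i) (lshift m k)
  = - (if i.+1 == N then / omega N else 0) * gradC (X ord_max) k.
Proof.
pose g j := gradH Df (zjoin (X j) (U j)) (Lam j) (lshift m k).
have hL j : Lam j k = gradC (X ord_max) k - mxapp Bd g j.
  have h : Lam j k - gradC (X ord_max) k + mxapp Bd g j = 0 := rL j k.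
  by lra.
rewrite sumR1E (eq_bigr (fun j => Ad i j * gradC (X ord_max) k - Ad i j * mxapp Bd g j)) => [|j _]; last first.
  by rewrite extendS hL /Ad; ring.
have e1 : \rsum_j (Ad i j * mxapp Bd g j) = g i by rewrite -[RHS](congr1 (fun F => F i) (AdBd g)).
have e2 : \rsum_j Ad i j = - (if i.+1 == N then / omega N else 0) := Ddag_row_sum hR hD i.
by rewrite rsumB rsumZr e1 e2 -/(g i); ring.
Qed.

Lemma extend_T_zero :
  T_zero f x0 Df gradC N omega D (extend x0 X) (extend u0 U) (extend lam0 Lam).
Proof.
have XN : extend x0 X N = X ord_max by rewrite -(extendS x0 X ord_max).
have [feas _] := extend_feasible.
split; first by move=> i k iN; rewrite feas //; ring.
split; first by move=> k; rewrite /=; ring.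
split.
  move=> k; rewrite sumR1E XN.
  pose S := \rsum_(i < N) (omega i.+1 * gradH Df (zjoin (X i) (U i)) (Lam i) (lshift m k)).
  have -> : extend lam0 Lam 0%N k = gradC (X ord_max) k + S by [].
  suff -> : \rsum_(i < N) (omega i.+1 * gradxH Df (extend x0 X i.+1) (extend u0 U i.+1) (extend lam0 Lam i.+1) k) = S.
    by ring.
  by apply: eq_bigr => i _; rewrite !extendS.
have gE (i : 'I_N) k : gradxH Df (extend x0 X i.+1) (extend u0 U i.+1) (extend lam0 Lam i.+1) k
    = gradH Df (zjoin (X i) (U i)) (Lam i) (lshift m k) by rewrite !extendS.
have interior (i : 'I_N) k : (i.+1 < N)%N ->
    sumR 1 N (fun j => Ddag omega D i.+1 j * extend lam0 Lam j k)
    + gradxH Df (extend x0 X i.+1) (extend u0 U i.+1) (extend lam0 Lam i.+1) k = 0.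
  by move=> iN; rewrite gE costate_eq (ltn_eqF iN); ring.
have final k : sumR 1 N (fun j => Ddag omega D (@ord_max M).+1 j * extend lam0 Lam j k)
    + gradxH Df (extend x0 X (@ord_max M).+1) (extend u0 U (@ord_max M).+1) (extend lam0 Lam (@ord_max M).+1) k
    + gradC (extend x0 X N) k / omega N = 0.
  by rewrite gE costate_eq XN /= eqxx /Rdiv; ring.
have stat (i : 'I_N) c : graduH Df (extend x0 X i.+1) (extend u0 U i.+1) (extend lam0 Lam i.+1) c = 0.
  by rewrite !extendS; exact: rU.
split; first by case=> [|i'] k // /andP[_ iN]; exact: (interior (Ordinal (ltnW iN))).
split; first exact: final.
by case=> [|i'] c // iN; exact: (stat (Ordinal iN)).
Qed.

End Conversion.

Theorem theorem1p1
  (n m : nat)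
  (f : vec n -> vec m -> vec n) (C : vec n -> R) (x0 : vec n)
  (Df : vec (n + m) -> 'I_n -> 'I_(n + m) -> R)
  (D2f : vec (n + m) -> 'I_n -> 'I_(n + m) -> 'I_(n + m) -> R)
  (gradC : vec n -> vec n) (hessC : vec n -> 'I_n -> 'I_n -> R)
  (xs : R -> vec n) (us : R -> vec m) (lams : R -> vec n)
  (Omega : vec (n + m) -> Prop) (rho : R)
  (tau omega : nat -> nat -> R) (D : nat -> nat -> nat -> R)
  (eta : nat) :
  (3 <= eta)%N ->
  (* (xs,us) is a local minimizer of (P); xs in C^1, us in C^0 *)
  loc_min_P f C x0 xs us ->
  (* standing assumptions *)
  is_open Omega -> 0 < rho ->
  (forall t, -1 <= t <= 1 -> forall z, vnorm (vsub z (zjoin (xs t) (us t))) <= rho -> Omega z) ->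
  (forall k, C2_with (fun z => f (fun i => z (lshift m i)) (fun j => z (rshift n j)) k)
                     (fun z => Df z k) (fun z => D2f z k) Omega) ->
  C2_with C gradC hessC (open_ball (xs 1) rho) ->
  (* costate lambda* *)
  (forall k t, -1 <= t <= 1 ->
     deriv_within (-1) 1 (fun s => lams s k) t (- gradxH Df (xs t) (us t) (lams t) k)) ->
  (forall k, lams 1 k = gradC (xs 1) k) ->
  (forall t, -1 <= t <= 1 -> forall l, graduH Df (xs t) (us t) (lams t) l = 0) ->
  (* (A1) *)
  (forall k, Ck_on eta.+1 (fun t => xs t k)) ->
  (forall k, Ck_on eta.+1 (fun t => lams t k)) ->
  (* (A2) *)
  (exists alpha, 0 < alpha /\ min_eig_gt (hessC (xs 1)) alpha /\
     forall t, -1 <= t <= 1 -> min_eig_gt (hessH D2f (xs t) (us t) (lams t)) alpha) ->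
  (* (A3) *)
  (forall t, -1 <= t <= 1 ->
     infnorm (jac_x Df (xs t) (us t)) <= 1 / 4 /\
     infnorm (fun k l => jac_x Df (xs t) (us t) l k) <= 1 / 4) ->
  (* Radau data, differentiation matrix, (P1)-(P4) for every N *)
  (forall N, (2 <= N)%N -> Radau N (tau N) (omega N)) ->
  (forall N, (2 <= N)%N -> Dmat_spec N (tau N) (D N)) ->
  (forall N, (2 <= N)%N -> P1234 N (omega N) (D N)) ->
  exists c : R, exists N0 : nat, forall N : nat, (N0 <= N)%N -> (eta.+1 < N)%N ->
    exists (X : nat -> vec n) (U : nat -> vec m) (Lam : nat -> vec n),
      strict_loc_min_NLP f C x0 N (D N) X U /\
      T_zero f x0 Df gradC N (omega N) (D N) X U Lam /\
      (forall i, (i <= N)%N ->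
         vnorm (vsub (X i) (xs (tau N i))) <= c / INR N ^ (eta - 2)) /\
      (forall i, (1 <= i <= N)%N ->
         vnorm (vsub (U i) (us (tau N i))) <= c / INR N ^ (eta - 2)) /\
      (forall i, (i <= N)%N ->
         vnorm (vsub (Lam i) (lams (tau N i))) <= c / INR N ^ (eta - 2)).
Proof.
move=> eta3 [[hx1 [hu0 [hode hx0]]] _] hO rho0 hball hf hC hlamd hlam1 hlamu hxC hlamC.
move=> [alpha [al0 [hCeig hHeig]]] hA3 hR hD hP.
(* Order of the asserted rate; the derivatives of state and costate are approximated to this
   order. *)
pose et := (eta - 2)%N.
have et_eta : (et.+1 <= eta.+1)%N by rewrite ltnS leq_subr.
have hxs k t ht := Ck_cont (hx1 k) ht : cont_within (-1) 1 (fun s => xs s k) t.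
have hus j t ht := Ck_cont (hu0 j) ht : cont_within (-1) 1 (fun s => us s j) t.
have hlams k t ht := Ck_cont (hlamC k) ht : cont_within (-1) 1 (fun s => lams s k) t.
have hf' k : C2_with (fjoin f k) (fun z => Df z k) (fun z => D2f z k) Omega := hf k.
have hgrad k := proj1 (hf' k).
have hgrad2 k a := proj1 (proj2 (hf' k)) a.
have hC1 := proj1 hC.
have hgradC k := proj1 (proj2 hC) k.
have [K [K0 [DfK [D2fK [lamsK [hessHK hessCK]]]]]] := problem_bound hessC rho0 hball hf' hxs hus hlams.
have hessHpos t ht := hessH_coercive rho0 hO hball hf' ht (hHeig t ht).
have hessCpos := hessC_coercive rho0 hC hCeig.
have rowA3 t k : -1 <= t <= 1 -> \rsum_l Rabs (Df (zstar xs us t) k (lshift m l)) <= 1 / 4.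
  move=> ht; apply: Rle_trans (proj1 (hA3 t ht)).
  exact: (bigRmax_ub (fun k => \rsum_l Rabs (jac_x Df (xs t) (us t) k l)) (mem_index_enum k)).
have colA3 t l : -1 <= t <= 1 -> \rsum_k Rabs (Df (zstar xs us t) k (lshift m l)) <= 1 / 4.
  move=> ht; apply: Rle_trans (proj2 (hA3 t ht)).
  exact: (bigRmax_ub (fun l => \rsum_k Rabs (jac_x Df (xs t) (us t) k l)) (mem_index_enum l)).
have hx k t : -1 <= t <= 1 -> deriv_within (-1) 1 (fun s => xs s k) t (fjoin f k (zstar xs us t)).
  by move=> ht; rewrite fjoin_zjoin; exact: hode.
have hlam k t : -1 <= t <= 1 ->
    deriv_within (-1) 1 (fun s => lams s k) t (- gradH Df (zstar xs us t) (lams t) (lshift m k)) := hlamd k t.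
have hlam1' : lams 1 = gradC (xs 1) by apply: funext.
have hu0' t c (ht : -1 <= t <= 1) : gradH Df (zstar xs us t) (lams t) (rshift n c) = 0 := hlamu t ht c.
pose kap := stability_const n m K alpha.
have kap0 : 0 < kap := stability_const_gt0 n m K0 al0.
have n0 := pos_INR n; have m0 := pos_INR m; have p0 := pos_INR (n + m).
have gl0 := gradH_lip_const_ge0 n m K0; have sc2 := start_const_ge n K0.
have rc0 : 0 <= remainder_const n m K.
  rewrite /remainder_const; have h1 : 0 <= (K + 1) * INR (n + m) by nra.
  have h2 : 0 <= INR (n + m) * K by nra.
  by nra.
have cc0 : 0 <= convexity_const n m K.
  rewrite /convexity_const; have h1 : 0 <= INR n * (2 * K + 1) by nra.
  by nra.
have res0 : 0 <= residual_const n m K.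
  rewrite /residual_const; have h1 : 0 <= INR (n + m) * (K + 1) by nra.
  by nra.
have ic0 : 0 <= initial_costate_const n m K by rewrite /initial_costate_const; nra.
have k2 : 0 < 1 / (2 * kap) by apply: Rdiv_lt_0_compat; lra.
(* The three bounds are the normalisation, the contraction of the Newton step and strict convexity;
   the summand 1 keeps the denominators positive. *)
pose eps := Rmin 1 (Rmin (1 / (2 * kap) / (remainder_const n m K + 1)) (alpha / (convexity_const n m K + 1) / 2)).
have eps_gt0 : 0 < eps by do !apply: Rmin_glb_lt; do ?apply: Rdiv_lt_0_compat; lra.
have eps1 : eps <= 1 := Rmin_l _ _.
have epsC : remainder_const n m K * eps <= 1 / (2 * kap).
  have h : eps <= 1 / (2 * kap) / (remainder_const n m K + 1) := Rle_trans _ _ _ (Rmin_r _ _) (Rmin_l _ _).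
  have e : 1 / (2 * kap) = (1 / (2 * kap) / (remainder_const n m K + 1)) * (remainder_const n m K + 1).
    by field; lra.
  by rewrite e; nra.
have epsA : convexity_const n m K * eps < alpha.
  have h : eps <= alpha / (convexity_const n m K + 1) / 2 := Rle_trans _ _ _ (Rmin_r _ _) (Rmin_r _ _).
  have e : alpha = (alpha / (convexity_const n m K + 1) / 2) * (2 * (convexity_const n m K + 1)).
    by field; lra.
  by rewrite e; nra.
have [r4 [r40 htube4]] := tube_exists rho0 hball hf' hC hxs hus eps_gt0.
(* The Newton iteration uses the tube of radius [2 r]; solution and competitors of the nonlinear
   program are placed in the one of radius [4 r], which still lies in the tube of radius [r4]. *)
pose r := Rmin r4 eps / 4.
have rm0 : 0 < Rmin r4 eps by apply: Rmin_glb_lt.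
have r0 : 0 < r by rewrite /r; lra.
have rr4 : 4 * r <= r4 by rewrite /r; have := Rmin_l r4 eps; lra.
have reps : 4 * r <= eps by rewrite /r; have := Rmin_r r4 eps; lra.
have tube4 := tube_le rr4 htube4.
have tube2 : tube Df D2f hessC xs us Omega rho (2 * r) eps by apply: tube_le tube4; lra.
have [cx [cx0 hcx]] := jackson_derivatives (g := xs) (g' := fun t k => fjoin f k (zstar xs us t))
  (fun k => Ck_le et_eta (hxC k)) hx.
have [cl [cl0 hcl]] := jackson_derivatives (g := lams)
  (g' := fun t k => - gradH Df (zstar xs us t) (lams t) (lshift m k)) (fun k => Ck_le et_eta (hlamC k)) hlam.
(* The derivative of the costate is approximated with size [N - 1]; the factor [2 ^ et] restores
   powers of [N]. *)
pose c1 := cx + cl * 2 ^ et.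
have two_et : 0 < 2 ^ et by apply: pow_lt; lra.
have c10 : 0 <= c1 by rewrite /c1; nra.
(* Distance of the start from the reference plus the distance travelled by the iteration, in units
   of [E]; [cI] below plays the same role for [Lambda_0]. *)
pose cF := start_const n K + 2 * kap * residual_const n m K.
have kr0 : 0 <= 2 * kap * residual_const n m K by nra.
have cF0 : 0 <= cF by rewrite /cF; lra.
pose cI := initial_costate_const n m K * cF + 4.
have cI0 : 0 <= cI by rewrite /cI; nra.
have [N0 hN0] := INR_unbounded (cF * c1 / r).
(* The dimension factor converts coordinate bounds into bounds of the Euclidean norm. *)
exists ((INR n + INR m) * ((cF + cI) * c1)), N0 => N N0N etaN.
have [M eN M0] : exists2 M, N = M.+1 & (0 < M)%N.
  by case: N etaN {N0N} => [|[|M]] //; exists M.+1.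
have N2 : (2 <= N)%N by rewrite eN.
have NR : 0 < INR N by apply: lt_0_INR; apply/ltP; rewrite eN.
have NR1 : 1 <= INR N by apply: (le_INR 1); apply/leP; rewrite eN.
have Nk : 0 < INR N ^ et by apply: pow_lt.
pose E := c1 / INR N ^ et.
have E0 : 0 <= E by exact: Rdiv_ge0.
(* This is where [eta >= 3] enters: the exponent is at least 1, so [E] tends to zero and the start
   falls inside the tube for [N >= N0]. *)
have EN : E <= c1 / INR N.
  apply: Rmult_le_compat_l => //; apply: Rinv_le_contravar => //.
  have : (1 <= et)%N by rewrite /et; lia.
  case: (et) => // j _ /=; rewrite -[X in X <= _]Rmult_1_r; apply: Rmult_le_compat_l; first by lra.
  exact: pow_R1_Rle.
have cFE : cF * E <= r.
  have h1 : INR N0 <= INR N by apply: le_INR; apply/leP.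
  have h2 : cF * c1 <= r * INR N.
    have -> : cF * c1 = r * (cF * c1 / r) by field; lra.
    by apply: Rmult_le_compat_l; lra.
  apply: (Rle_trans _ (cF * (c1 / INR N))); first exact: Rmult_le_compat_l.
  apply: (Rmult_le_reg_r (INR N)) => //.
  by have -> : cF * (c1 / INR N) * INR N = cF * c1 by field; lra.
have krE : 0 <= 2 * kap * residual_const n m K * E by apply: Rmult_le_pos.
have scE0 : 0 <= start_const n K * E by apply: Rmult_le_pos; lra.
have scE : start_const n K * E <= r by move: cFE; rewrite /cF; lra.
have kE : 2 * kap * (residual_const n m K * E) <= r by move: cFE; rewrite /cF; lra.
(* Sizes [N] and [N - 1] for the derivatives give primitives of degree [N] and [N - 1], the limits
   of exactness of [D] and [Ddag]. *)
have [q hq] := hcx N (ltnW N2).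
have [ql hql] := hcl M M0.
have [P hPp] := choice _ (fun k => poly_primitive (q k) (IZR (-1)) (x0 k)).
pose X1 : vec n := fun k => horner (P k) (IZR 1).
have [Q hQp] := choice _ (fun k => poly_primitive (ql k) (IZR 1) (gradC X1 k)).
have PE k t : -1 <= t <= 1 -> Rabs (fjoin f k (zstar xs us t) - horner (deriv (P k)) t) <= E.
  case: (hPp k) => _ -> _ ht; apply: Rle_trans (proj2 (hq k) t ht) _.
  apply: Rmult_le_compat_r; first by apply: Rlt_le; exact: Rinv_0_lt_compat.
  by rewrite /c1; nra.
have QE k t : -1 <= t <= 1 ->
    Rabs (- gradH Df (zstar xs us t) (lams t) (lshift m k) - horner (deriv (Q k)) t) <= E.
  case: (hQp k) => _ -> _ ht; apply: Rle_trans (proj2 (hql k) t ht) _.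
  have Mp : 0 < INR M by apply: lt_0_INR; apply/ltP.
  have M1 : 1 <= INR M by apply: (le_INR 1); apply/leP.
  have Mk : 0 < INR M ^ et by apply: pow_lt.
  have hM : INR N ^ et <= 2 ^ et * INR M ^ et.
    by rewrite -Rpow_mult_distr; apply: pow_incr; rewrite eN S_INR; lra.
  apply: (Rle_trans _ (cl * 2 ^ et / INR N ^ et)).
    rewrite /Rdiv Rmult_assoc; apply: Rmult_le_compat_l => //.
    apply: (Rmult_le_reg_r (INR M ^ et * INR N ^ et)); first by nra.
    have -> : / INR M ^ et * (INR M ^ et * INR N ^ et) = INR N ^ et by field; lra.
    by have -> : 2 ^ et * / INR N ^ et * (INR M ^ et * INR N ^ et) = 2 ^ et * INR M ^ et by field; lra.
  apply: Rmult_le_compat_r; first by apply: Rlt_le; exact: Rinv_0_lt_compat.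
  by rewrite /c1; lra.
have P0 k : horner (P k) (IZR (-1)) = x0 k by case: (hPp k).
have Q1 k : horner (Q k) (IZR 1) = gradC X1 k by case: (hQp k).
have sP k : (size (P k) <= M.+2)%N.
  by case: (hPp k) => h _ _; apply: leq_trans h _; rewrite ltnS -eN; exact: (proj1 (hq k)).
have sQ k : (size (Q k) <= M.+1)%N.
  by case: (hQp k) => h _ _; apply: leq_trans h _; rewrite ltnS; exact: (proj1 (hql k)).
have {hR hD hP} [hR hD hP] : [/\ Radau N (tau N) (omega N), Dmat_spec N (tau N) (D N) & P1234 N (omega N) (D N)].
  by split; [exact: hR|exact: hD|exact: hP].
rewrite -/et.
move: (tau N) (omega N) (D N) hR hD hP => {tau omega D} tau omega D.
rewrite eN => hR hD hP.
have [B [Bd [[B1 Bd1 B2 Bd2] [BdE Blast] [AB BA AdBd] hB hBd]]] := collocation_inverses M0 hR hD hP.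
pose t (i : 'I_M.+1) := tau i.+1.
pose w (i : 'I_M.+1) := omega i.+1.
have t_itv i : -1 <= t i <= 1 by apply: (node_itv hR).
have t_last : t ord_max = 1 by case: hR => _ [_ [_ []]].
have tau0 : tau 0%N = -1 by case: hR.
have w0 i : 0 < w i by apply: (weight_gt0 hR); rewrite /= ltn_ord.
have w2 : \rsum_i w i = 2 := weights_sum hR.
have PB k i := hB (P k) i (sP k).
have QB k i := hBd (Q k) i (sQ k).
have Qw k : \rsum_i (w i * horner (deriv (Q k)) (t i)) = horner (Q k) (IZR 1) - horner (Q k) (IZR (-1)).
  by apply: (quadrature_ord M0 hR); exact: leqW.
have r2 : 0 <= 2 * r by lra.
have scE2 : start_const n K * E <= 2 * r by lra.
pose X0 (i : 'I_M.+1) : vec n := fun k => horner (P k) (t i).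
pose U0 (i : 'I_M.+1) : vec m := us (t i).
pose L0 (i : 'I_M.+1) : vec n := fun k => horner (Q k) (t i).
have near0 i := start_near K0 hgradC hessCK t_itv hx hlam hx0 hlam1' r2 eps1 tube2 E0 scE2 PE QE P0 Q1 i.
have rX0 := start_state_residual K0 hgrad hgradC DfK hessCK t_itv B1 hx hlam hx0 hlam1' r2 eps1 tube2
  E0 scE2 PE QE P0 Q1 PB.
have rU0 := start_control_residual K0 hgrad2 hgradC DfK D2fK lamsK hessCK t_itv hx hlam hx0 hlam1' hu0' r2
  eps1 tube2 E0 scE2 PE QE P0 Q1.
have rL0 := start_costate_residual K0 hgrad2 hgradC DfK D2fK lamsK hessCK t_itv t_last Bd1 hx hlam hx0 hlam1'
  r2 eps1 tube2 E0 scE2 PE QE P0 Q1 QB.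
have e0 : 0 <= residual_const n m K * E by apply: Rmult_le_pos.
have reps2 : 2 * r <= eps by lra.
have [X [U [Lam [[rX rU rL] [dX dU dL]]]]] := discrete_newton K0 al0 hgrad hgrad2 hgradC DfK D2fK lamsK hessHK
  hessCK hessHpos hessCpos rowA3 colA3 t_itv t_last w0 w2 B1 Bd1 B2 Bd2 BdE Blast r0 reps2 eps1 epsC tube2
  (X0 := X0) (U0 := U0) (Lam0 := L0) e0 kE (fun i => cube_le scE (proj1 (near0 i)))
  (fun i => cube_le scE (proj2 (near0 i))) rX0 rU0 rL0.
have cFE_split : cF * E = start_const n K * E + 2 * kap * (residual_const n m K * E) by rewrite /cF; ring.
have nearZ i : cube (zstar xs us (t i)) (cF * E) (zjoin (X i) (U i)).
  rewrite cFE_split; apply: cube_trans (proj1 (near0 i)) _ => a.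
  by rewrite /zjoin; case: fintype.split => k; [exact: dX|exact: dU].
have nearL i : cube (lams (t i)) (cF * E) (Lam i).
  by rewrite cFE_split; apply: cube_trans (proj2 (near0 i)) _ => k; exact: dL.
(* A default value: the nonlinear program has no control at index 0. *)
pose u0 : vec m := us (-1).
pose lam0 : vec n := fun k => gradC (X ord_max) k
  + \rsum_(i < M.+1) (omega i.+1 * gradH Df (zjoin (X i) (U i)) (Lam i) (lshift m k)).
have cFE0 : 0 <= cF * E by apply: Rmult_le_pos.
have bound p (v : vec p) s : 0 <= s <= (cF + cI) * E -> (p <= n + m)%N -> (forall k, Rabs (v k) <= s) ->
    vnorm v <= (INR n + INR m) * ((cF + cI) * c1) / INR M.+1 ^ et.
  rewrite -eN => hs pnm hv; apply: Rle_trans (vnorm_le (proj1 hs) hv) _.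
  have -> : (INR n + INR m) * ((cF + cI) * c1) / INR N ^ et = (INR n + INR m) * ((cF + cI) * E) by rewrite /E /Rdiv; ring.
  apply: Rmult_le_compat; [exact: pos_INR|by case: hs|rewrite -plus_INR|by case: hs].
  by apply: le_INR; apply/leP.
have cIE0 : 0 <= cI * E by apply: Rmult_le_pos.
have sF : 0 <= cF * E <= (cF + cI) * E by lra.
have sI : 0 <= cI * E <= (cF + cI) * E by lra.
exists (extend x0 X), (extend u0 U), (extend lam0 Lam).
split; [split|split; [|split; [|split]]].
- exact: (extend_feasible hR hD AB).
- exists r; split=> // X' U' feas' nX nU.
  have rX' := feasible_residual hR hD BA feas'.
  have near4 i : cube (zstar xs us (t i)) (4 * r) (zjoin (X i) (U i)) by apply: cube_le (nearZ i); lra.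
  have nearL4 i : cube (lams (t i)) (4 * r) (Lam i) by apply: cube_le (nearL i); lra.
  have near' i : cube (zstar xs us (t i)) (4 * r) (zjoin (X' i.+1) (U' i.+1)).
    have h : cube (zjoin (X i) (U i)) r (zjoin (X' i.+1) (U' i.+1)).
      move=> a; rewrite /zjoin; case: fintype.split => k; apply: Rlt_le.
        have := nX i.+1 (ltn_ord i); rewrite extendS; apply: Rle_lt_trans; exact: (vnorm_coord (vsub _ _)).
      have := nU i.+1 (ltn_ord i); rewrite extendS; apply: Rle_lt_trans; exact: (vnorm_coord (vsub _ _)).
    by apply: cube_le (cube_trans (nearZ i) h); lra.
  have eps0' : 0 <= eps by lra.
  have := strict_minimum K0 hgrad hgrad2 hC1 hgradC D2fK lamsK hessHpos hessCpos 
    t_itv t_last w0 BdE Blast reps eps1 eps0' tube4 epsA rX rU rL near4 nearL4 rX' near'.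
  have -> : extend x0 X M.+1 = X ord_max by rewrite -(extendS x0 X ord_max).
  case=> [h|h]; [left|by right]; split; first apply: (extend_ind (Pr := fun i v => X' i = v)) => [|j].
  - by case: feas'.
  - by case: (h j).
  case=> [|i] // iN; have [_] := h (Ordinal iN); rewrite -(extendS u0 U (Ordinal iN)).
  exact.
- exact: (extend_T_zero hR hD AB AdBd).
- apply: (extend_ind (Pr := fun i v => vnorm (vsub v (xs (tau i))) <= _)) => [|j].
    apply: (bound _ _ _ sF); first exact: leq_addr.
    by move=> k; rewrite /vsub tau0 hx0 Rminus_diag Rabs_R0.
  apply: (bound _ _ _ sF); first exact: leq_addr.
  by move=> k; have := nearZ j (lshift m k); rewrite /zstar !zjoin_lshift.
- case=> [|i] // iN.
  have -> : extend u0 U i.+1 = U (Ordinal iN) by rewrite -(extendS u0 U (Ordinal iN)).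
  apply: (bound _ _ _ sF); first exact: leq_addl.
  by move=> k; have := nearZ (Ordinal iN) (rshift n k); rewrite /zstar !zjoin_rshift.
apply: (extend_ind (Pr := fun i v => vnorm (vsub v (lams (tau i))) <= _)) => [|j].
  apply: (bound _ _ _ sI); first exact: leq_addr.
  move=> k; rewrite /vsub tau0; have cFr : cF * E <= 2 * r by lra.
  have := initial_costate_error K0 hgrad2 hgradC DfK D2fK lamsK hessCK t_itv t_last w0 w2 hlam hlam1'
    r2 eps1 tube2 E0 QE Qw k cFr cFE0 nearZ nearL.
  by move/Rle_trans; apply; rewrite /cI; lra.
apply: (bound _ _ _ sF); first exact: leq_addr.
by move=> k; exact: nearL.
Qed.
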